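(* Let $\ell$ be a prime and let $\sigma=\nu_1\times\nu_2\rtimes\rho$ be an irreducible unramified principal series representation of $G(\mathbf{Q}_\ell)$, with central character $\omega_\sigma=\nu_1\nu_2\rho^2$, and let $\varphi_0\in\sigma$ be a non-zero $G(\mathbf{Z}_\ell)$-invariant vector. Let $k_1,k_2\ge 0$ be integers and $\tau_1,\tau_2$ finite-order unramified characters of $\mathbf{Q}_\ell^\times$; put $\psi_1=\psi_2=|\cdot|^{-1/2}$ and $\chi_i=|\cdot|^{1/2+k_i}\tau_i$, and assume $\chi_1\chi_2\psi_1\psi_2\omega_\sigma=1$. If $k_1=0$ or $k_2=0$, assume moreover that $\sigma$ is essentially tempered (a twist of a tempered representation by a character). Let $\mathfrak{z}$ be any $H(\mathbf{Q}_\ell)$-invariant bilinear form $I_H(\underline{\chi},\underline{\psi})\otimes\sigma\to\mathbf{C}$. Then for every integer $t\ge1$, \[\mathfrak{z}\left(F_{\underline{\phi}_t},\varphi_0\right)=\frac{1}{\ell^{2t-2}(\ell+1)^2}\left(1-\tfrac{\ell^{k_1}}{\tau_1(\ell)}\right)\left(1-\tfrac{\ell^{k_2}}{\tau_2(\ell)}\right)\mathfrak{z}\left(F_{\underline{\phi}_0},\varphi_0\right),\] and \[\mathfrak{z}\left(F_{\underline{\phi}_1},U(\ell)\varphi_0\right)=\frac{\ell}{(\ell+1)^2}\left[\left(1-\tfrac{\ell^{k_1}}{\tau_1(\ell)}\right)\left(1-\tfrac{\ell^{k_2}}{\tau_2(\ell)}\right)-L(\sigma,-\tfrac12)^{-1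}\right]\mathfrak{z}\left(F_{\underline{\phi}_0},\varphi_0\right).\]
   Context: $G=\mathrm{GSp}_4$: $G(R)=\{(g,\mu)\in\mathrm{GL}_4(R)\times R^\times: g^tJg=\mu J\}$ with $J=\begin{pmatrix}0&0&0&1\\0&0&1&0\\0&-1&0&0\\-1&0&0&0\end{pmatrix}$. $H=\mathrm{GL}_2\times_{\mathrm{GL}_1}\mathrm{GL}_2$ (pairs of matrices with equal determinant), embedded in $G$ by $\iota\left(\begin{pmatrix}a&b\\c&d\end{pmatrix},\begin{pmatrix}a'&b'\\c'&d'\end{pmatrix}\right)=\begin{pmatrix}a&0&0&b\\0&a'&b'&0\\0&c'&d'&0\\c&0&0&d\end{pmatrix}$; $H(\mathbf{Q}_\ell)$ acts on $\sigma$ through $\iota$. All representations are smooth on complex vector spaces. $|\cdot|$ is normalised with $|\ell|=\ell^{-1}$; $dx$, $d^\times x$ are Haar measures giving $\mathbf{Z}_\ell$, $\mathbf{Z}_\ell^\times$ volume 1; $e_\ell$ is the additive character with $e_\ell(\ell^{-n})=\exp(2\pi i/\ell^n)$. For a character $\chi$ of $\mathbf{Q}_\ell^\times$, $L(\chi,s)=(1-\chi(\ell)\ell^{-s})^{-1}$ if $\chi$ is unramified and $1$ otherwise. Principal series of $G$: for smooth characters $\nu_1,\nu_2,\rho$ with $|\cdot|^{\pm1}\notin\{\nu_1,\nu_2,\nu_1\nu_2,\nu_1/\nu_2\}$, $\nu_1\times\nu_2\rtimes\rho$ is the space of $f:G(\mathbf{Q}_\ell)\to\mathbf{C}$ with $f(bg)=|x^2y|\,|z|^{-3/2}\nu_1(x)\nu_2(y)\rho(z)f(g)$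 for all upper triangular $b\in G(\mathbf{Q}_\ell)$ with diagonal $(x,y,zy^{-1},zx^{-1})$, with $G$ acting by right translation; it is unramified when $\nu_1,\nu_2,\rho$ are unramified. Its spin $L$-factor is $L(\sigma,s)=L(\rho,s)L(\rho\nu_1,s)L(\rho\nu_2,s)L(\rho\nu_1\nu_2,s)$. The operator $U(\ell)$ is $U(\ell)\varphi=\sum_{u,v,w\in\mathbf{Z}/\ell}\begin{pmatrix}\ell&0&u&v\\0&\ell&w&u\\0&0&1&0\\0&0&0&1\end{pmatrix}\varphi$. Induced representations: for characters $\chi,\psi$ of $\mathbf{Q}_\ell^\times$, $I(\chi,\psi)$ is the space of smooth $f:\mathrm{GL}_2(\mathbf{Q}_\ell)\to\mathbf{C}$ with $f\left(\begin{pmatrix}a&b\\0&d\end{pmatrix}g\right)=\chi(a)\psi(d)|a/d|^{1/2}f(g)$. For pairs $\underline\chi=(\chi_1,\chi_2)$, $\underline\psi=(\psi_1,\psi_2)$, $I_H(\underline\chi,\underline\psi)$ is the space of restrictions to $H(\mathbf{Q}_\ell)$ of functions in $I(\chi_1,\psi_1)\otimes I(\chi_2,\psi_2)$, with $H$ acting by right translation. Siegel sections: for a Schwartz function $\phi$ on $\mathbf{Q}_\ell^2$ (row vectors), the integral $f(g,s)=\frac{\chi(\det g)|\det g|^{s+1/2}}{L(\chi/\psi,2s+1)}\int_{\mathbf{Q}_\ell^\times}\phi((0,x)g)(\chi/\psi)(x)|x|^{2s+1}d^\times x$ converges for $\mathrm{Re}(s)\gg0$ and extends to a Laurent polynomial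 in $\ell^{s}$; its value at $s=0$ defines $f_{\phi,\chi,\psi}\in I(\chi,\psi)$. The Fourier transform is $\hat\phi(x,y)=\iint e_\ell(xv-yu)\phi(u,v)\,du\,dv$. For $\underline\phi=\phi_1\otimes\phi_2$ set $F_{\underline\phi}$ to be the restriction to $H(\mathbf{Q}_\ell)$ of $f_{\hat\phi_1,\chi_1,\psi_1}\otimes f_{\hat\phi_2,\chi_2,\psi_2}$, an element of $I_H(\underline\chi,\underline\psi)$. Let $\phi_0=\mathrm{ch}(\mathbf{Z}_\ell\times\mathbf{Z}_\ell)$, $\phi_t=\mathrm{ch}(\ell^t\mathbf{Z}_\ell\times\mathbf{Z}_\ell^\times)$ for $t\ge1$, and $\underline\phi_t=\phi_t\otimes\phi_t$. *)

(* Defs.v *)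
From HB Require Import structures.
From mathcomp Require Import all_boot all_order all_algebra.
From mathcomp Require Import all_classical all_reals all_analysis.
From mathcomp Require Import complex ring.

Set Implicit Arguments.
Unset Strict Implicit.
Unset Printing Implicit Defensive.

Import Order.TTheory GRing.Theory Num.Theory.
Import numFieldNormedType.Exports.

Local Open Scope classical_set_scope.
Local Open Scope ring_scope.

(* A [padicFieldType l R] is a model of Q_l: a field containing Q as a dense
   subset, complete for a multiplicative ultrametric absolute value [pabs]
   with |l| = 1/l.  Such an absolute value restricts to the l-adic one on Q,
   so these axioms characterise (Q_l, |.|) up to a unique isometric
   isomorphism.  R is any model of the real numbers. *)
HB.mixin Record isPadicField (l : nat) (R : realType) K
    & GRing.Field K & Uniform K := {
  padic_prime : prime l ;
  pabs : K -> R ;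
  pabs_ge0 : forall x, 0 <= pabs x ;
  pabs_eq0 : forall x, (pabs x == 0) = (x == 0) ;
  pabsM : forall x y, pabs (x * y) = pabs x * pabs y ;
  pabsD : forall x y, pabs (x + y) <= Num.max (pabs x) (pabs y) ;
  pabs_prime : pabs l%:R = l%:R^-1 ;
  padic_entourage : @entourage K = [set A |
    exists2 e : R, 0 < e & forall x y, pabs (x - y) < e -> A (x, y)] ;
  padic_complete : forall F : set_system K,
    ProperFilter F -> cauchy F -> exists x : K, F --> x ;
  padic_dense : dense (range (ratr : rat -> K))
}.

#[short(type="padicFieldType")]
HB.structure Definition PadicField (l : nat) (R : realType) :=
  {K of isPadicField l R K & GRing.Field K & Uniform K}.

Arguments pabs {l R s} x.

Section Characters.
Variables (l : nat) (R : realType) (K : padicFieldType l R).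
Local Notation C := R[i].

(* a ^ s for a > 0 *)
Definition cpow (a : R) (s : C) : C :=
  let r := expR (complex.Re s * ln a) in
  let t := complex.Im s * ln a in
  (r * cos t +i* (r * sin t))%C.

(* |x| ^ s for x <> 0 *)
Definition abspow (s : C) (x : K) : C := cpow (pabs x) s.

(* Characters of K^* are functions on K whose value at 0 is irrelevant, so
   they are compared, multiplied and inverted on K^* only. *)
Definition smooth_char (chi : K -> C) : Prop :=
  [/\ chi 1 = 1,
      forall x y, x != 0 -> y != 0 -> chi (x * y) = chi x * chi y &
      \forall u \near (1 : K), chi u = 1].

Definition char_eq (chi chi' : K -> C) : Prop :=
  forall x, x != 0 -> chi x = chi' x.

Definition unramified (chi : K -> C) : Prop :=
  forall u, pabs u = 1 -> chi u = 1.

Definition finite_order (chi : K -> C) : Prop :=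
  exists2 n : nat, (0 < n)%N & forall x, x != 0 -> chi x ^+ n = 1.

(* As 0^-1 = 0, the inverse of the value at a pole is 0. *)
Definition Lchar (chi : K -> C) (s : C) : C :=
  if `[< unramified chi >] then (1 - chi l%:R * cpow l%:R (- s))^-1 else 1.

Definition Lspin (nu1 nu2 rho : K -> C) (s : C) : C :=
  Lchar rho s * Lchar (rho \* nu1) s * Lchar (rho \* nu2) s
  * Lchar (rho \* nu1 \* nu2) s.

(* The additive character with e (l^-n) = exp (2 pi i / l^n); it is unique,
   as Z[1/l] is dense in K. *)
Definition standard_additive_char (e : K -> C) : Prop :=
  [/\ forall x y, e (x + y) = e x * e y,
      continuous (e : K -> (C : numFieldType)^o) &
      forall n : nat, e (l%:R ^- n) =
        (cos (2 * pi / l%:R ^+ n) +i* sin (2 * pi / l%:R ^+ n))%C].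

End Characters.

Section Haar.
Variables (l : nat) (R : realType) (K : padicFieldType l R).

Definition pointed_padic : Type := K.
HB.instance Definition _ := Choice.on pointed_padic.
HB.instance Definition _ := isPointed.Build pointed_padic (0 : K).

Definition borel := g_sigma_algebraType (@open K : set (set pointed_padic)).

Definition additive_haar (mu : {measure set borel -> \bar R}) : Prop :=
  (forall (a : K) (A : set borel), measurable A ->
     mu [set a + x | x in A : set K] = mu A) /\
  mu [set x : K | pabs x <= 1] = 1%E.

(* A Haar measure on K^*, seen as a measure on K which is only evaluated on
   subsets of K^*. *)
Definition multiplicative_haar (mu : {measure set borel -> \bar R}) : Prop :=
  (forall (a : K) (A : set borel), a != 0 -> measurable A -> ~ A (0 : K) ->
     mu [set a * x | x in A : set K] = mu A) /\
  mu [set x : K | pabs x = 1] = 1%E.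

End Haar.

Section ComplexIntegral.
Context d (T : measurableType d) (R : realType).
Variable mu : {measure set T -> \bar R}.

Definition cintegrable (D : set T) (f : T -> R[i]) : Prop :=
  mu.-integrable D (EFin \o (@complex.Re R \o f)) /\
  mu.-integrable D (EFin \o (@complex.Im R \o f)).

Definition cintegral (D : set T) (f : T -> R[i]) : R[i] :=
  (Rintegral mu D (@complex.Re R \o f) +i*
   Rintegral mu D (@complex.Im R \o f))%C.

End ComplexIntegral.

Section Groups.
Variable K : fieldType.

Record gl2 := GL2 { gl2_mx :> 'M[K]_2; _ : gl2_mx \in unitmx }.
HB.instance Definition _ := [isSub for gl2_mx].
HB.instance Definition _ := [Choice of gl2 by <:].

Lemma gl2_unit (g : gl2) : (g : 'M[K]_2) \in unitmx.
Proof. by case: g. Qed.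

Lemma gl2_one_subproof : (1%:M : 'M[K]_2) \in unitmx.
Proof. exact: unitmx1. Qed.
Lemma gl2_mul_subproof (g h : gl2) : (g : 'M[K]_2) *m h \in unitmx.
Proof. by rewrite unitmx_mul !gl2_unit. Qed.
Lemma gl2_inv_subproof (g : gl2) : invmx g \in unitmx.
Proof. by rewrite unitmx_inv gl2_unit. Qed.

Definition gl2_one := GL2 gl2_one_subproof.
Definition gl2_mul g h := GL2 (gl2_mul_subproof g h).
Definition gl2_inv g := GL2 (gl2_inv_subproof g).

Lemma gl2_mulA : associative gl2_mul.
Proof. by move=> x y z; apply: val_inj; rewrite /= mulmxA. Qed.
Lemma gl2_mul1g : left_id gl2_one gl2_mul.
Proof. by move=> x; apply: val_inj; rewrite /= mul1mx. Qed.
Lemma gl2_mulg1 : right_id gl2_one gl2_mul.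
Proof. by move=> x; apply: val_inj; rewrite /= mulmx1. Qed.
Lemma gl2_mulVg : left_inverse gl2_one gl2_inv gl2_mul.
Proof. by move=> x; apply: val_inj; rewrite /= mulVmx ?gl2_unit. Qed.
Lemma gl2_mulgV : right_inverse gl2_one gl2_inv gl2_mul.
Proof. by move=> x; apply: val_inj; rewrite /= mulmxV ?gl2_unit. Qed.

HB.instance Definition _ :=
  isGroup.Build gl2 gl2_mulA gl2_mul1g gl2_mulg1 gl2_mulVg gl2_mulgV.

Record hgrp := HGrp {
  hpair :> gl2 * gl2;
  _ : \det (hpair.1 : 'M[K]_2) == \det (hpair.2 : 'M[K]_2) }.
HB.instance Definition _ := [isSub for hpair].
HB.instance Definition _ := [Choice of hgrp by <:].

Lemma hgrp_det (h : hgrp) : \det (h.1 : 'M[K]_2) = \det (h.2 : 'M[K]_2).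
Proof. by case: h => h /= /eqP. Qed.

Lemma hgrp_one_subproof :
  \det ((1%g : gl2) : 'M[K]_2) == \det ((1%g : gl2) : 'M[K]_2).
Proof. by []. Qed.
Lemma hgrp_mul_subproof (g h : hgrp) :
  \det ((g.1 * h.1)%g : 'M[K]_2) == \det ((g.2 * h.2)%g : 'M[K]_2).
Proof. by rewrite !det_mulmx !hgrp_det. Qed.
Lemma hgrp_inv_subproof (h : hgrp) :
  \det ((h.1^-1)%g : 'M[K]_2) == \det ((h.2^-1)%g : 'M[K]_2).
Proof. by rewrite !det_inv hgrp_det. Qed.

Definition hgrp_one := @HGrp (1%g, 1%g) hgrp_one_subproof.
Definition hgrp_mul (g h : hgrp) :=
  @HGrp (g.1 * h.1, g.2 * h.2)%g (hgrp_mul_subproof g h).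
Definition hgrp_inv (h : hgrp) :=
  @HGrp (h.1^-1, h.2^-1)%g (hgrp_inv_subproof h).

Lemma hgrp_mulA : associative hgrp_mul.
Proof. by move=> x y z; apply: val_inj; rewrite /= !mulgA. Qed.
Lemma hgrp_mul1g : left_id hgrp_one hgrp_mul.
Proof. by move=> x; apply: val_inj; rewrite /= !mul1g; case: (hpair x). Qed.
Lemma hgrp_mulg1 : right_id hgrp_one hgrp_mul.
Proof. by move=> x; apply: val_inj; rewrite /= !mulg1; case: (hpair x). Qed.
Lemma hgrp_mulVg : left_inverse hgrp_one hgrp_inv hgrp_mul.
Proof. by move=> x; apply: val_inj; rewrite /= !mulVg. Qed.
Lemma hgrp_mulgV : right_inverse hgrp_one hgrp_inv hgrp_mul.
Proof. by move=> x; apply: val_inj; rewrite /= !mulgV. Qed.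

HB.instance Definition _ :=
  isGroup.Build hgrp hgrp_mulA hgrp_mul1g hgrp_mulg1 hgrp_mulVg hgrp_mulgV.

Definition Jmx : 'M[K]_4 := \matrix_(i, j)
  if (i + j == 3)%N then (if (i < 2)%N then 1 else -1) else 0.

Definition is_gsp4 (p : 'M[K]_4 * K) : bool :=
  [&& p.1 \in unitmx, p.2 != 0 & p.1^T *m Jmx *m p.1 == p.2 *: Jmx].

Record gsp4 := GSp4 { gsp4_pair :> 'M[K]_4 * K; _ : is_gsp4 gsp4_pair }.
HB.instance Definition _ := [isSub for gsp4_pair].
HB.instance Definition _ := [Choice of gsp4 by <:].

Definition gsp4_mx (g : gsp4) : 'M[K]_4 := g.1.
Definition simil (g : gsp4) : K := g.2.

Lemma gsp4P (g : gsp4) :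
  [/\ g.1 \in unitmx, g.2 != 0 & g.1^T *m Jmx *m g.1 = g.2 *: Jmx].
Proof. by case: g => g /= /and3P[? ? /eqP]. Qed.

Lemma gsp4_one_subproof : is_gsp4 (1%:M, 1).
Proof.
by rewrite /is_gsp4 /= unitmx1 oner_eq0 trmx1 mul1mx mulmx1 scale1r eqxx.
Qed.
Lemma gsp4_mul_subproof (g h : gsp4) : is_gsp4 (g.1 *m h.1, g.2 * h.2).
Proof.
have [ug mg Eg] := gsp4P g; have [uh mh Eh] := gsp4P h.
rewrite /is_gsp4 /= unitmx_mul ug uh mulf_neq0 //= trmx_mul.
rewrite -!mulmxA (mulmxA Jmx) (mulmxA g.1^T) (mulmxA g.1^T) Eg.
by rewrite -scalemxAl -scalemxAr mulmxA Eh scalerA.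
Qed.
Lemma gsp4_inv_subproof (g : gsp4) : is_gsp4 (invmx g.1, g.2^-1).
Proof.
have [ug mg Eg] := gsp4P g; rewrite /is_gsp4 /= unitmx_inv ug invr_neq0 //=.
apply/eqP; have EJ : Jmx = g.2^-1 *: (g.1^T *m Jmx *m g.1).
  by rewrite Eg scalerA mulVf // scale1r.
rewrite {1}EJ trmx_inv -scalemxAr -scalemxAl !mulmxA.
by rewrite mulVmx ?unitmx_tr // mul1mx mulmxK.
Qed.

Definition gsp4_one := GSp4 gsp4_one_subproof.
Definition gsp4_mul g h := GSp4 (gsp4_mul_subproof g h).
Definition gsp4_inv g := GSp4 (gsp4_inv_subproof g).

Lemma gsp4_mulA : associative gsp4_mul.
Proof. by move=> x y z; apply: val_inj; rewrite /= mulmxA mulrA. Qed.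
Lemma gsp4_mul1g : left_id gsp4_one gsp4_mul.
Proof.
by move=> x; apply: val_inj; rewrite /= mul1mx mul1r; case: (gsp4_pair x).
Qed.
Lemma gsp4_mulg1 : right_id gsp4_one gsp4_mul.
Proof.
by move=> x; apply: val_inj; rewrite /= mulmx1 mulr1; case: (gsp4_pair x).
Qed.
Lemma gsp4_mulVg : left_inverse gsp4_one gsp4_inv gsp4_mul.
Proof.
by move=> x; have [u m _] := gsp4P x; apply: val_inj; rewrite /= mulVmx ?mulVf.
Qed.
Lemma gsp4_mulgV : right_inverse gsp4_one gsp4_inv gsp4_mul.
Proof.
by move=> x; have [u m _] := gsp4P x; apply: val_inj; rewrite /= mulmxV ?mulfV.
Qed.

HB.instance Definition _ :=
  isGroup.Build gsp4 gsp4_mulA gsp4_mul1g gsp4_mulg1 gsp4_mulVg gsp4_mulgV.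

Definition mx4_of (rows : seq (seq K)) : 'M[K]_4 :=
  \matrix_(i, j) nth 0 (nth [::] rows i) j.

Definition emb_mx (h : hgrp) : 'M[K]_4 :=
  let g := (h.1 : 'M[K]_2) in let g' := (h.2 : 'M[K]_2) in
  mx4_of [:: [:: g 0 0;       0;        0; g 0 1];
             [::     0; g' 0 0 ; g' 0 1  ;     0];
             [::     0; g' 1 0 ; g' 1 1  ;     0];
             [:: g 1 0;       0;        0; g 1 1]].

Definition U_mx (a u v w : K) : 'M[K]_4 :=
  mx4_of [:: [:: a; 0; u; v];
             [:: 0; a; w; u];
             [:: 0; 0; 1; 0];
             [:: 0; 0; 0; 1]].

Lemma Jmx_sqr : Jmx *m Jmx = - 1%:M.
Proof.
apply/matrixP => i j; rewrite !mxE !big_ord_recl big_ord0 !mxE /=.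
by case: i => [[|[|[|[|]]]] ?] //; case: j => [[|[|[|[|]]]] ?] //=;
   rewrite ?(mulr0, mul0r, addr0, add0r, mulr1, mul1r, oppr0, mulN1r).
Qed.

Lemma is_gsp4_intro (g : 'M[K]_4) (m : K) :
  m != 0 -> g^T *m Jmx *m g = m *: Jmx -> is_gsp4 (g, m).
Proof.
move=> m0 E; rewrite /is_gsp4 /= m0 E eqxx !andbT.
suff /mulmx1_unit[] : (- m^-1 *: (Jmx *m g^T *m Jmx)) *m g = 1%:M by [].
rewrite -scalemxAl -!mulmxA mulmxA -[X in _ *: X]mulmxA !mulmxA.
rewrite -(mulmxA _ _ g) -(mulmxA Jmx) (mulmxA g^T) E -scalemxAr Jmx_sqr.
by rewrite scalerA scalerN mulNr mulVf // scaleN1r opprK.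
Qed.

Lemma det_mx2 (A : 'M[K]_2) : \det A = A 0 0 * A 1 1 - A 0 1 * A 1 0.
Proof.
rewrite (expand_det_row _ ord0) !big_ord_recl big_ord0 addr0 /cofactor /=.
rewrite !det_mx11 !mxE /= expr0 expr1 mul1r mulN1r mulrN.
by congr (A _ _ * A _ _ - A _ _ * A _ _); apply: val_inj.
Qed.

Lemma emb_subproof (h : hgrp) : is_gsp4 (emb_mx h, \det (h.1 : 'M[K]_2)).
Proof.
apply: is_gsp4_intro; first by have := gl2_unit h.1; rewrite unitmxE unitfE.
have := hgrp_det h; rewrite !det_mx2 => E.
apply/matrixP => i j; rewrite !mxE !big_ord_recl big_ord0 !mxE.
rewrite !big_ord_recl !big_ord0 !mxE /=.
case: i => [[|[|[|[|]]]] ?] //; case: j => [[|[|[|[|]]]] ?] //=;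
  first [ring | rewrite E; ring].
Qed.

Definition emb (h : hgrp) : gsp4 := GSp4 (emb_subproof h).

Lemma U_subproof (a u v w : K) : a != 0 -> is_gsp4 (U_mx a u v w, a).
Proof.
move=> a0; apply: is_gsp4_intro => //.
apply/matrixP => i j; rewrite !mxE !big_ord_recl big_ord0 !mxE.
rewrite !big_ord_recl !big_ord0 !mxE /=.
case: i => [[|[|[|[|]]]] ?] //; case: j => [[|[|[|[|]]]] ?] //=; ring.
Qed.

Definition U_elt (a u v w : K) (a0 : a != 0) : gsp4 :=
  GSp4 (U_subproof u v w a0).

End Groups.

Definition rtrans (G : groupType) (T : Type) (g : G) (f : G -> T) : G -> T :=
  fun x => f (x * g)%g.

Section Topology.
Variables (l : nat) (R : realType) (K : padicFieldType l R).

HB.instance Definition _ := Topological.copy (gl2 K)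
  (initial_topology (fun g : gl2 K => g : 'M[K]_2)).

HB.instance Definition _ := Topological.copy (gsp4 K)
  (initial_topology (fun g : gsp4 K => g : 'M[K]_4 * K)).

HB.instance Definition _ := isPointed.Build (gsp4 K) 1%g.

(* GSp_4(Z_l): an integral matrix lies in GL_4(Z_l) iff its determinant is a
   unit. *)
Definition gsp4_int : set (gsp4 K) := [set g |
  [/\ forall i j, pabs (gsp4_mx g i j) <= 1, pabs (\det (gsp4_mx g)) = 1 &
      pabs (simil g) = 1]].

Definition gsp4_center : set (gsp4 K) :=
  [set z | forall g : gsp4 K, (z * g = g * z)%g].

(* The Borel sigma-algebra of the quotient of GSp_4 by its centre Z, pulled
   back to GSp_4: a measure on this measurable space is a Borel measure on
   GSp_4 / Z. *)
Definition gsp4_modZ := g_sigma_algebraType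
  [set U : set (gsp4 K) | open U /\
    forall z g, gsp4_center z -> U g -> U (z * g)%g].

Definition modZ_haar (m : {measure set gsp4_modZ -> \bar R}) : Prop :=
  (forall (g : gsp4 K) (A : set gsp4_modZ), measurable A ->
     m [set (g * x)%g | x in A : set (gsp4 K)] = m A) /\
  m [set (zk.1 * zk.2)%g | zk in gsp4_center `*` gsp4_int] = 1%E.

End Topology.

(* Representations are given by a subspace W of the functions on GSp_4 and an
   action [act] of GSp_4 on functions that preserves W. *)

Section Representations.
Variables (l : nat) (R : realType) (K : padicFieldType l R).
Local Notation C := R[i].
Local Notation G := (gsp4 K).

Definition fsubspace (T : Type) (W : set (T -> C)) : Prop :=
  W (fun=> 0) /\
  forall (a : C) f f', W f -> W f' -> W (fun x => a * f x + f' x).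

Definition irreducible (W : set (G -> C)) (act : G -> (G -> C) -> (G -> C)) :=
  (exists2 f, W f & f <> (fun=> 0)) /\
  forall V : set (G -> C), fsubspace V -> V `<=` W ->
    (forall g f, V f -> V (act g f)) ->
    V = [set (fun=> 0)] \/ V = W.

(* Linear forms on W fixed by an open subgroup; their values outside W are
   irrelevant. *)
Definition smooth_dual (W : set (G -> C)) (act : G -> (G -> C) -> (G -> C))
    (lam : (G -> C) -> C) : Prop :=
  (forall (a : C) f f', W f -> W f' ->
     lam (fun x => a * f x + f' x) = a * lam f + lam f') /\
  \forall k \near (1%g : G), forall f, W f -> lam (act k f) = lam f.

(* As the centre acts by a unitary character, the absolute value of a matrix
   coefficient is a function on GSp_4 / Z; it has to lie in L^(2 + eps) of
   this quotient for its Haar measure, which is unique. *)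
Definition tempered (W : set (G -> C)) (act : G -> (G -> C) -> (G -> C)) :=
  (forall z, gsp4_center z -> exists2 w : C, `|w| = 1 &
     forall f, W f -> act z f = (fun x => w * f x)) /\
  exists2 m : {measure set (gsp4_modZ K) -> \bar R}, modZ_haar m &
    forall f lam (eps : R), W f -> smooth_dual W act lam -> 0 < eps ->
      m.-integrable setT
        (fun g => (complex.Re `|lam (act g f)| `^ (2 + eps))%:E).

Definition twist (chi : K -> C) (act : G -> (G -> C) -> (G -> C)) :
    G -> (G -> C) -> (G -> C) :=
  fun g f x => chi (simil g) * act g f x.

(* W is the twist by chi^-1 of the tempered representation [twist chi act]. *)
Definition essentially_tempered (W : set (G -> C))
    (act : G -> (G -> C) -> (G -> C)) : Prop :=
  exists2 chi : K -> C, smooth_char chi & tempered W (twist chi act).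

Definition upper_triangular n (A : 'M[K]_n) : Prop :=
  forall i j : 'I_n, (j < i)%N -> A i j = 0.

Definition principal_series (nu1 nu2 rho : K -> C) : set (G -> C) := [set f |
  (\forall k \near (1%g : G), rtrans k f = f) /\
  forall (b g : G) (x y z : K), upper_triangular (gsp4_mx b) ->
    (forall i : 'I_4, gsp4_mx b i i = nth 0 [:: x; y; z / y; z / x] i) ->
    f (b * g)%g = abspow 1 (x ^+ 2 * y) * abspow (- (3 / 2)) z
                  * nu1 x * nu2 y * rho z * f g].

Definition principal_series_cond (nu1 nu2 : K -> C) : Prop :=
  let regular chi :=
    ~ char_eq chi (abspow 1) /\ ~ char_eq chi (abspow (- 1)) in
  [/\ regular nu1, regular nu2, regular (nu1 \* nu2) &
      regular (fun x => nu1 x / nu2 x)].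

Lemma padic_prime_neq0 : (l%:R : K) != 0.
Proof.
rewrite -(pabs_eq0 (l%:R : K)) pabs_prime invr_eq0 pnatr_eq0 -lt0n.
exact/prime_gt0/(@padic_prime l R K).
Qed.

Definition U_op (f : G -> C) : G -> C := fun g =>
  \sum_(u < l) \sum_(v < l) \sum_(w < l)
    rtrans (U_elt u%:R v%:R w%:R padic_prime_neq0) f g.

End Representations.

Section Siegel.
Variables (l : nat) (R : realType) (K : padicFieldType l R).
Local Notation C := R[i].

Definition induced (chi psi : K -> C) : set (gl2 K -> C) := [set f |
  (\forall k \near (1%g : gl2 K), rtrans k f = f) /\
  forall b g : gl2 K, b 1 0 = 0 ->
    f (b * g)%g
    = chi (b 0 0) * psi (b 1 1) * abspow (2^-1) (b 0 0 / b 1 1) * f g].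

Definition tens (f1 f2 : gl2 K -> C) : hgrp K -> C :=
  fun h => f1 h.1 * f2 h.2.

Definition induced_H (chi psi : (K -> C) * (K -> C)) : set (hgrp K -> C) := [set F |
  exists (n : nat) (f1 f2 : 'I_n -> gl2 K -> C),
    [/\ forall i, induced chi.1 psi.1 (f1 i),
        forall i, induced chi.2 psi.2 (f2 i) &
        F = fun h => \sum_(i < n) tens (f1 i) (f2 i) h]].

Variables (dx dtx : {measure set (borel K) -> \bar R}) (e : K -> C).

Definition row2 (x y : K) : 'rV[K]_2 := \row_j (if j == 0 then x else y).

Definition fourier (phi : 'rV[K]_2 -> C) : 'rV[K]_2 -> C := fun z =>
  let x := z 0 0 in let y := z 0 1 in
  cintegral dx setT (fun u : borel K => cintegral dx setT (fun v : borel K =>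
    e (x * (v : K) - y * (u : K)) * phi (row2 u v))).

Section SiegelSection.
Variables (phi : 'rV[K]_2 -> C) (chi psi : K -> C).
Let chipsi : K -> C := fun x => chi x / psi x.
Let Kstar : set (borel K) := [set x : K | x != 0].

Definition siegel_integrand (g : gl2 K) (s : C) : borel K -> C := fun x : K =>
  phi (row2 0 x *m g) * chipsi x * abspow (2 * s + 1) x.

Definition siegel (g : gl2 K) (s : C) : C :=
  chi (\det (g : 'M[K]_2)) * abspow (s + 2^-1) (\det (g : 'M[K]_2))
  / Lchar chipsi (2 * s + 1) * cintegral dtx Kstar (siegel_integrand g s).

(* v is the value at s = 0 of the continuation of [siegel g], which is the
   Laurent polynomial P(X) / X^m in X = l^s. *)
Definition siegel_continuation (g : gl2 K) (v : C) : Prop :=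
  exists (P : {poly C}) (m : nat) (s0 : R),
    (forall s : C, s0 < complex.Re s ->
       cintegrable dtx Kstar (siegel_integrand g s) /\
       siegel g s = P.[cpow l%:R s] / cpow l%:R s ^+ m) /\
    v = P.[1].

Definition siegel_section : gl2 K -> C := fun g =>
  xget 0 [set v | siegel_continuation g v].

End SiegelSection.

Definition F_section (phi : ('rV[K]_2 -> C) * ('rV[K]_2 -> C))
    (chi psi : (K -> C) * (K -> C)) : hgrp K -> C :=
  tens (siegel_section (fourier phi.1) chi.1 psi.1)
       (siegel_section (fourier phi.2) chi.2 psi.2).

Definition phi_sph : 'rV[K]_2 -> C := fun z =>
  if (pabs (z 0 0) <= 1) && (pabs (z 0 1) <= 1) then 1 else 0.

Definition phi_lev (t : nat) : 'rV[K]_2 -> C := fun z =>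
  if (pabs (z 0 0) <= l%:R ^- t) && (pabs (z 0 1) == 1) then 1 else 0.

(* H-invariant bilinear forms on V x W, for subspaces V and W of the functions
   on H and GSp_4 on which these groups act by right translation; the values
   of [Z] outside V x W are irrelevant. *)
Definition H_invariant_bilinear (V : set (hgrp K -> C)) (W : set (gsp4 K -> C))
    (Z : (hgrp K -> C) -> (gsp4 K -> C) -> C) : Prop :=
  [/\ forall (a : C) F F' f, V F -> V F' -> W f ->
        Z (fun h => a * F h + F' h) f = a * Z F f + Z F' f,
      forall (a : C) F f f', V F -> W f -> W f' ->
        Z F (fun g => a * f g + f' g) = a * Z F f + Z F f' &
      forall h F f, V F -> W f -> Z (rtrans h F) (rtrans (emb h) f) = Z F f].

End Siegel.

(* Main.v *)
From HB Require Import structures.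
Require Import Defs.
From mathcomp Require Import all_boot all_order all_algebra.
From mathcomp Require Import all_classical all_reals all_analysis.
From mathcomp Require Import measurable_realfun complex ring lra zify.

Set Implicit Arguments.
Unset Strict Implicit.
Unset Printing Implicit Defensive.

Import Order.TTheory GRing.Theory Num.Theory.
Import numFieldNormedType.Exports.

Local Open Scope classical_set_scope.
Local Open Scope ring_scope.

(* Up to explicit constants the Siegel sections are combinations of the sections
   q_t(g) = A(det g) kappa(max(|c|, l^-t |d|)), where (c, d) is the bottom row of g
   and A, kappa are unramified; these satisfy linear relations under right
   translation, coming from the Hecke operator of GL_2 and from the change of level.
   Invariance of the form under H(Z_l) turns these relations into a recursion in t,
   which gives the first formula.

   For the second one, phi_0 is an eigenvector of the two Hecke operators attached
   to diag(1,1,l,l) and diag(1,l,l,l^2), with eigenvalues read off from coset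
   representatives by the Iwasawa decomposition.  Decomposing these representatives
   into H(Z_l)-orbits, each operator contributes a split part, in the torus of H, and
   a non-split part, supported on the orbit of one unipotent class eta.  The two
   eigenvalue equations therefore determine the values of the form on the translates
   of phi_0 by eta, and U(l) phi_0 involves only the split element and eta. *)

(** * The l-adic absolute value *)

Section AbsoluteValue.
Variables (l : nat) (R : realType) (K : padicFieldType l R).
Implicit Types x y : K.
Local Notation lR := (l%:R : R).

Lemma l_gt1 : (1 < l)%N.
Proof. exact/prime_gt1/(@padic_prime l R K). Qed.

Lemma lR_gt1 : 1 < lR. Proof. by rewrite (ltr_nat _ 1) l_gt1. Qed.

Lemma lR_gt0 : 0 < lR. Proof. exact: lt_trans lR_gt1. Qed.

Lemma lR_neq0 : lR != 0. Proof. exact/lt0r_neq0/lR_gt0. Qed.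

Lemma lRX_gt0 (n : int) : 0 < lR ^ n. Proof. exact/exprz_gt0/lR_gt0. Qed.

Lemma lRX_le (m n : int) : (lR ^ m <= lR ^ n) = (m <= n).
Proof. by rewrite ler_eXz2l // lR_gt1. Qed.

Lemma lRX_lt (m n : int) : (lR ^ m < lR ^ n) = (m < n).
Proof. by rewrite ltr_eXz2l // lR_gt1. Qed.

Lemma lRV_lt1 : lR^-1 < 1.
Proof. by rewrite invf_lt1 ?lR_gt0 ?lR_gt1. Qed.

Lemma pabs0 : pabs (0 : K) = 0.
Proof. by apply/eqP; rewrite pabs_eq0. Qed.

Lemma pabs_gt0 x : (0 < pabs x) = (x != 0).
Proof. by rewrite lt0r pabs_eq0 pabs_ge0 andbT. Qed.

Lemma pabs1 : pabs (1 : K) = 1.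
Proof.
have := pabsM (1 : K) 1; rewrite mulr1 => /eqP.
rewrite -subr_eq0 -{1}(mulr1 (pabs 1)) -mulrBr mulf_eq0 pabs_eq0 oner_eq0 /=.
by rewrite subr_eq0 => /eqP.
Qed.

Lemma pabsX x n : pabs (x ^+ n) = pabs x ^+ n.
Proof. by elim: n => [|n IH]; rewrite ?expr0 ?pabs1 // !exprS pabsM IH. Qed.

Lemma pabsV x : pabs x^-1 = (pabs x)^-1.
Proof.
have [->|x0] := eqVneq x 0; first by rewrite invr0 pabs0 invr0.
apply: (mulfI (x := pabs x)); first by rewrite pabs_eq0.
by rewrite -pabsM !mulfV ?pabs1 // pabs_eq0.
Qed.

Lemma pabsXz x (n : int) : pabs (x ^ n) = pabs x ^ n.
Proof. by case: n => n; rewrite ?NegzE -?exprnN -?exprnP ?pabsV pabsX. Qed.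

Lemma pabsN1 : pabs (-1 : K) = 1.
Proof.
have : pabs (-1 : K) ^+ 2 == 1 by rewrite -pabsX sqrrN expr1n pabs1.
by rewrite sqrf_eq1 => /orP[/eqP//|/eqP E]; have := pabs_ge0 (-1 : K);
  rewrite E lerNr oppr0 ler10.
Qed.

Lemma pabsN x : pabs (- x) = pabs x.
Proof. by rewrite -mulN1r pabsM pabsN1 mul1r. Qed.

Lemma pabsB x y : pabs (x - y) <= Num.max (pabs x) (pabs y).
Proof. by rewrite -(pabsN y) pabsD. Qed.

Lemma pabsBC x y : pabs (x - y) = pabs (y - x).
Proof. by rewrite -pabsN opprB. Qed.

Lemma pabsD_le x y r : pabs x <= r -> pabs y <= r -> pabs (x + y) <= r.
Proof. by move=> hx hy; apply: le_trans (pabsD _ _) _; rewrite ge_max hx. Qed.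

Lemma pabsB_le x y r : pabs x <= r -> pabs y <= r -> pabs (x - y) <= r.
Proof. by move=> hx hy; apply: pabsD_le; rewrite ?pabsN. Qed.

Lemma pabsM_le x y r s : pabs x <= r -> pabs y <= s -> pabs (x * y) <= r * s.
Proof. by move=> hx hy; rewrite pabsM ler_pM ?pabs_ge0. Qed.

Lemma pabsM_le1 x y : pabs x <= 1 -> pabs y <= 1 -> pabs (x * y) <= 1.
Proof. by move=> hx hy; rewrite -(mulr1 1) pabsM_le. Qed.

Lemma pabs_sum_le (I : finType) (F : I -> K) r : 0 <= r ->
  (forall i, pabs (F i) <= r) -> pabs (\sum_i F i) <= r.
Proof.
move=> r0 h; elim/big_ind: _ => // [|x y]; first by rewrite pabs0.
exact: pabsD_le.
Qed.

Lemma pabs_lt_add x y : pabs y < pabs x -> pabs (x + y) = pabs x.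
Proof.
move=> h; apply/eqP; rewrite eq_le; apply/andP; split.
  by apply: pabsD_le => //; apply: ltW.
rewrite leNgt; apply/negP => h'.
have := pabsB (x + y) y; rewrite addrK le_max !leNgt h' h //.
Qed.

Lemma pabs_near x y : pabs (x - y) < pabs x -> pabs y = pabs x.
Proof.
by rewrite -pabsN opprB => h; rewrite -(pabs_lt_add h) addrC subrK.
Qed.

Lemma pabs_nat_le1 n : pabs (n%:R : K) <= 1.
Proof.
elim: n => [|n IH]; first by rewrite pabs0.
by rewrite -natr1 pabsD_le // pabs1.
Qed.

Lemma pabs_int_le1 (n : int) : pabs (n%:~R : K) <= 1.
Proof.
by case: n => n; rewrite ?NegzE ?mulrNz ?pabsN -pmulrn pabs_nat_le1.
Qed.

Lemma pabs_l : pabs (l%:R : K) = lR^-1. Proof. exact: pabs_prime. Qed.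

Lemma l_neq0 : (l%:R : K) != 0. Proof. exact: padic_prime_neq0. Qed.

Lemma pabs_lX (n : int) : pabs ((l%:R : K) ^ n) = lR ^ (- n).
Proof. by rewrite pabsXz pabs_l exprz_inv. Qed.

Lemma pabs_coprime n : coprime l n -> pabs (n%:R : K) = 1.
Proof.
have [->|n0 co] := posnP n.
  by rewrite /coprime gcdn0 => /eqP h; move: l_gt1; rewrite [X in (_ < X)%N]h.
have [u v E _] := egcdnP l n0.
apply/eqP; rewrite eq_le pabs_nat_le1 leNgt /=; apply/negP => lt1.
have : (u * n)%:R - (v * l)%:R = 1 :> K.
  rewrite E gcdnC (eqP co) natrD addrAC subrr add0r //.
move=> /(congr1 (@pabs l R K)); rewrite pabs1 => h.
suff : (1 : R) < 1 by rewrite ltxx.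
rewrite -{1}h; apply: le_lt_trans (pabsB _ _) _; rewrite gt_max !natrM !pabsM.
rewrite !(le_lt_trans (ler_piMl (pabs_ge0 _) (pabs_nat_le1 _))) //.
by rewrite pabs_l lRV_lt1.
Qed.

Lemma pabs_nat n : (0 < n)%N -> pabs (n%:R : K) = lR ^- logn l n.
Proof.
move=> n0; have [m co E] := pfactor_coprime (@padic_prime l R K) n0.
rewrite {1}E natrM pabsM pabs_coprime // mul1r natrX pabsX pabs_l.
by rewrite exprVn.
Qed.

Lemma pabs_ord_eq (k : nat) (i j : nat) : (i < l ^ k)%N -> (j < l ^ k)%N ->
  pabs (i%:R - j%:R : K) <= lR ^- k -> i = j.
Proof.
wlog ij : i j / (i <= j)%N => [W|] hi hj h.
  have [|/ltnW] := leqP i j => ij; first exact: W.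
  by apply/esym/W => //; rewrite pabsBC.
apply/eqP; rewrite eqn_leq ij leqNgt /=; apply/negP => ji.
move: h; rewrite pabsBC -natrB // pabs_nat ?subn_gt0 //.
rewrite leNgt => /negP; apply; rewrite ltf_pV2 ?posrE ?exprn_gt0 ?lR_gt0 //.
rewrite ltr_eXn2l ?lR_gt1 // -(ltn_exp2l _ _ l_gt1).
apply: leq_ltn_trans (leq_ltn_trans (leq_subr i j) hj).
by rewrite dvdn_leq ?subn_gt0 // pfactor_dvdnn.
Qed.

Lemma pabs_unit_nat n : (0 < n < l)%N -> pabs (n%:R : K) = 1.
Proof.
move=> /andP[n0 nl]; apply: pabs_coprime.
by rewrite prime_coprime ?(@padic_prime l R K) // gtnNdvd.
Qed.

Lemma nbhs_pabs x (A : set K) :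
  nbhs x A <-> exists2 r : R, 0 < r & forall y, pabs (y - x) < r -> A y.
Proof.
rewrite -nbhs_entourageE padic_entourage; split.
  move=> [B [r r0 Br] BA]; exists r => // y yx.
  by apply: BA; rewrite /xsection /= inE; apply: Br; rewrite pabsBC.
move=> [r r0 rA]; exists [set p | pabs (p.1 - p.2) < r] => /=; first by exists r.
by move=> y; rewrite /xsection /= inE /= => yx; apply: rA; rewrite pabsBC.
Qed.

Lemma rat_dense x r : 0 < r -> exists q : rat, pabs (x - ratr q) < r.
Proof.
move=> r0; have := @padic_dense l R K.
have ox : open [set y | pabs (y - x) < r].
  rewrite openE => y /= yx; apply/nbhs_pabs; exists r => // y' yy'.
  rewrite /= -(subrKA y); apply: le_lt_trans (pabsD _ _) _; rewrite gt_max yy'.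
  exact: yx.
have nx : [set y : K | pabs (y - x) < r] !=set0.
  by exists x; rewrite /= subrr pabs0.
by move=> /(_ _ nx ox)[y [yx [q _ Eq]]]; exists q; rewrite pabsBC Eq; exact: yx.
Qed.

Lemma pabs_val x : x != 0 -> exists n : int, pabs x = lR ^ n.
Proof.
move=> x0; have [q /pabs_near] := @rat_dense x (pabs x) ltac:(by rewrite pabs_gt0).
have pint (m : int) : m != 0 -> exists n : int, pabs (m%:~R : K) = lR ^ n.
  move=> m0; exists (- (logn l `|m|%N)%:Z).
  have -> : pabs (m%:~R : K) = pabs (`|m|%N%:R : K).
    by case: (intP m) => // n; rewrite ?abszN ?mulrNz ?pabsN.
  by rewrite pabs_nat ?absz_gt0 // exprnN.
have [->|q0] := eqVneq q 0.
  by rewrite (_ : ratr 0 = 0) ?pabs0 /ratr ?mul0r // => E; move: x0; rewrite -(pabs_eq0 x) -E eqxx.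
rewrite /ratr pabsM pabsV.
have [m ->] := pint (numq q) ltac:(by rewrite numq_eq0).
have [n ->] := pint (denq q) ltac:(by rewrite denq_eq0).
by move=> <-; exists (m - n); rewrite invr_expz expfzDr ?lR_neq0.
Qed.

Lemma pabs_ltX x (n : int) : (pabs x < lR ^ n) = (pabs x <= lR ^ (n - 1)).
Proof.
have [->|/pabs_val[m ->]] := eqVneq x 0.
  by rewrite pabs0 lRX_gt0 ltW ?lRX_gt0.
by rewrite lRX_lt lRX_le lerBrDr -ltzD1 ltrD2r.
Qed.

Lemma pabs_lt1 x : (pabs x < 1) = (pabs x <= lR^-1).
Proof. by rewrite -(expr0z lR) pabs_ltX sub0r -exprN1. Qed.

Lemma pabs_residue1 x : pabs x <= 1 ->
  exists2 n, (n < l)%N & pabs (x - n%:R) <= lR^-1.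
Proof.
move=> x1; have [q] := rat_dense x ltr01; rewrite pabs_lt1 => xq.
have q1 : pabs (ratr q : K) <= 1.
  rewrite -(subKr x (ratr q)) pabsB_le //.
  by apply: le_trans xq _; rewrite ltW ?lRV_lt1.
have [d E] : exists d, denq q = d%:Z by exists `|denq q|%N; rewrite absz_denq.
have d0 : (0 < d)%N by rewrite -ltz_nat -E denq_gt0.
have co : coprime l d.
  rewrite prime_coprime ?(@padic_prime l R K) //; apply/negP => ld.
  have cn : coprime l `|numq q|.
    rewrite prime_coprime ?(@padic_prime l R K) //; apply/negP => ln.
    have := coprime_num_den q; rewrite /coprime => /eqP g1.
    have := l_gt1; suff : (l %| 1)%N by rewrite dvdn1 => /eqP ->.
    by rewrite -g1 dvdn_gcd ln E.
  move: q1; rewrite /ratr pabsM pabsV E.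
  have -> : pabs ((numq q)%:~R : K) = pabs (`|numq q|%N%:R : K).
    by case: (intP (numq q)) => // n; rewrite ?abszN ?mulrNz ?pabsN.
  rewrite pabs_coprime // mul1r -pmulrn.
  rewrite invf_le1 ?pabs_gt0; last first.
    by rewrite -(pabs_eq0 (d%:R : K)) pabs_nat // invr_eq0 expf_neq0 ?lR_neq0.
  rewrite leNgt => /negP; apply.
  rewrite -(divnK ld) natrM pabsM pabs_l.
  apply: le_lt_trans lRV_lt1; apply: ler_piMl (pabs_nat_le1 _).
  by rewrite invr_ge0 ltW ?lR_gt0.
have [u v Euv _] := egcdnP l d0.
pose a := numq q * u%:Z.
have [n En] : exists n, (a %% l)%Z = n%:Z.
  by exists `|(a %% l)%Z|%N; rewrite gez0_abs // modz_ge0 // -lt0n (ltnW l_gt1).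
exists n.
  by rewrite -ltz_nat -En ltz_pmod // ltz_nat (ltnW l_gt1).
rewrite -(subrKA (ratr q : K)); apply: pabsD_le => //.
rewrite -(subrKA (a%:~R : K)); apply: pabsD_le; last first.
  rewrite [a in a%:~R](divz_eq a l) En rmorphD rmorphM /= -!pmulrn addrK.
  rewrite pabsM pabs_l mulrC; apply: ler_piMr (pabs_int_le1 _).
  by rewrite invr_ge0 ltW ?lR_gt0.
have d0K : (d%:R : K) != 0.
  by rewrite -(pabs_eq0 (d%:R : K)) pabs_coprime // oner_eq0.
have -> : ratr q - a%:~R = (numq q)%:~R * - (v%:R * l%:R) / d%:R :> K.
  rewrite /ratr E /a rmorphM /= -!pmulrn.
  have : (u * d)%:R = (v * l + 1)%:R :> K by rewrite Euv gcdnC (eqP co).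
  rewrite natrM natrD natrM => Ed.
  apply: (mulIf d0K); rewrite mulrBl !divfK // -mulrA Ed; ring.
rewrite !pabsM pabsV pabs_coprime // invr1 mulr1 pabsN pabsM pabs_l mulrA.
apply: ler_piMl; first by rewrite invr_ge0 ltW ?lR_gt0.
by rewrite mulr_ile1 ?pabs_ge0 ?pabs_int_le1 ?pabs_nat_le1.
Qed.

Lemma pabs_residue k x : pabs x <= 1 ->
  exists2 n, (n < l ^ k)%N & pabs (x - n%:R) <= lR ^- k.
Proof.
elim: k => [|k IH] x1.
  by exists 0%N; rewrite // subr0 expr0 invr1.
have [n nk En] := IH x1; have lk0 : (l%:R : K) ^+ k != 0 by rewrite expf_neq0 ?l_neq0.
have [|m ml Em] := @pabs_residue1 ((x - n%:R) / l%:R ^+ k).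
  rewrite pabsM pabsV pabsX pabs_l exprVn invrK -ler_pdivlMr ?exprn_gt0 ?lR_gt0 //.
  by rewrite mul1r.
exists (n + m * l ^ k)%N.
  apply: (@leq_trans (l ^ k + m * l ^ k)%N); first by rewrite ltn_add2r.
  by rewrite -mulSn expnS leq_pmul2r // expn_gt0 (ltnW l_gt1).
have -> : x - (n + m * l ^ k)%:R = ((x - n%:R) / l%:R ^+ k - m%:R) * l%:R ^+ k.
  by rewrite mulrBl divfK // natrD natrM natrX; ring.
rewrite pabsM pabsX pabs_l exprS invfM exprVn; exact: ler_wpM2r.
Qed.

End AbsoluteValue.

(** * Complex integrals of locally constant functions *)

Section LocallyConstant.
Variables (l : nat) (R : realType) (K : padicFieldType l R).
Local Notation C := R[i].
Local Notation T := (borel K).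
Implicit Types (D : set K).

Definition locally_constant (U : Type) D (f : K -> U) :=
  forall x, D x -> exists2 r : R, 0 < r &
    forall y, pabs (y - x) < r -> D y /\ f y = f x.

Lemma open_measurable_padic (A : set K) : @open K A -> measurable (A : set T).
Proof. by move=> oA; apply: sub_sigma_algebra. Qed.

Lemma locally_constant_open (U : Type) D (f : K -> U) (B : set U) :
  locally_constant D f -> @open K (D `&` f @^-1` B).
Proof.
move=> lf; rewrite openE => x [Dx Bx]; apply/nbhs_pabs.
have [r r0 rf] := lf x Dx; exists r => // y /rf[Dy fy].
by split=> //=; rewrite /preimage /= fy.
Qed.

Lemma locally_constant_domain (U : Type) D (f : K -> U) :
  locally_constant D f -> measurable (D : set T).
Proof.
move=> lf; rewrite -(setIT D) -(preimage_setT f).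
exact: open_measurable_padic (locally_constant_open setT lf).
Qed.

Lemma locally_constant_measurable d (U : sigmaRingType d) D (f : K -> U) :
  locally_constant D f -> measurable_fun (D : set T) (f : T -> U).
Proof. by move=> lf _ B _; exact: open_measurable_padic (locally_constant_open B lf). Qed.

Lemma locally_constant_comp (U V : Type) D (f : K -> U) (h : U -> V) :
  locally_constant D f -> locally_constant D (h \o f).
Proof.
by move=> lf x /lf[r r0 rf]; exists r => // y /rf[Dy fy]; split=> //=; rewrite fy.
Qed.

Lemma locally_constant_op2 (U V W : Type) D (f : K -> U) (g : K -> V)
    (h : U -> V -> W) :
  locally_constant D f -> locally_constant D g ->
  locally_constant D (fun x => h (f x) (g x)).
Proof.
move=> lf lg x Dx; have [r r0 rf] := lf x Dx; have [s s0 sg] := lg x Dx.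
exists (Num.min r s); first by rewrite lt_min r0.
by move=> y; rewrite lt_min => /andP[/rf[Dy ->] /sg[_ ->]].
Qed.

Lemma locally_constant_ball (a : K) (r : R) : 0 < r ->
  locally_constant setT (fun x => pabs (x - a) <= r).
Proof.
move=> r0 x _; exists r => // y yx; split=> //.
apply/idP/idP => h.
  by rewrite -(subrKA y); apply: pabsD_le => //; rewrite pabsBC ltW.
by rewrite -(subrKA x); apply: pabsD_le => //; rewrite ltW.
Qed.

Lemma locally_constant_pabs :
  locally_constant [set x : K | x != 0] (@pabs l R K).
Proof.
move=> x /= x0; exists (pabs x); first by rewrite pabs_gt0.
by move=> y; rewrite pabsBC => /pabs_near E; rewrite -(pabs_gt0 y) E pabs_gt0.
Qed.

Lemma open_unit_group : @open K [set x : K | x != 0].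
Proof.
have := locally_constant_open setT locally_constant_pabs.
by rewrite preimage_setT setIT.
Qed.

Lemma ball_measurable (a : K) (r : R) : 0 < r ->
  measurable ([set x | pabs (x - a) <= r] : set T).
Proof.
move=> r0; have /locally_constant_open := locally_constant_ball a r0.
move=> /(_ [set true]); rewrite setTI => /open_measurable_padic.
by congr (measurable _); apply/seteqP; split=> x /=.
Qed.

Lemma normc_Re (x : C) : `|complex.Re x| <= complex.Re `|x|.
Proof. by have := normc_ge_Re x; rewrite normc_def lecR. Qed.

Lemma normc_Im (x : C) : `|complex.Im x| <= complex.Re `|x|.
Proof.
case: x => a b; rewrite normc_def /= -(@ler_pXn2r _ 2) ?nnegrE ?sqrtr_ge0 //.
rewrite sqr_sqrtr ?addr_ge0 ?sqr_ge0 // -normrX ger0_norm ?sqr_ge0 //.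
by rewrite lerDr sqr_ge0.
Qed.

Variable mu : {measure set T -> \bar R}.

Lemma cintegrable_dom D (f : K -> C) (g : K -> R) :
  locally_constant D f -> mu.-integrable D (EFin \o g) ->
  (forall x, D x -> complex.Re `|f x| <= g x) -> cintegrable mu D f.
Proof.
move=> lf ig fg; have mD := locally_constant_domain lf.
rewrite /cintegrable; split; apply: le_integrable ig => //.
- apply/measurable_EFinP.
  exact: (locally_constant_measurable (locally_constant_comp (@complex.Re R) lf)).
- move=> x Dx /=; rewrite lee_fin; apply: le_trans (normc_Re _) _.
  exact: le_trans (fg x Dx) (ler_norm _).
- apply/measurable_EFinP.
  exact: (locally_constant_measurable (locally_constant_comp (@complex.Im R) lf)).
- move=> x Dx /=; rewrite lee_fin; apply: le_trans (normc_Im _) _.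
  exact: le_trans (fg x Dx) (ler_norm _).
Qed.

Lemma integrable_ball (r M : R) : 0 < r ->
  (mu [set x : K | (pabs x <= r)%R] < +oo)%E ->
  mu.-integrable setT (EFin \o (fun x : K => if pabs x <= r then M else 0)).
Proof.
move=> r0 fin; have := ball_measurable 0 r0.
under [X in measurable X]eq_set do rewrite subr0.
move=> mB.
have -> : EFin \o (fun x : K => if pabs x <= r then M else 0) =
    (EFin \o cst M) \_ [set x : K | pabs x <= r].
  apply/funext => x; rewrite /patch /=; case: ifPn => h.
    by rewrite mem_set.
  by rewrite memNset //=; apply/negP.
apply/(integrable_mkcond (mu := mu) _ mB).
apply: measurable_bounded_integrable => //.
by exists `|M|; split; [exact: num_real|move=> y yM x _ /=; exact: ltW].
Qed.

Lemma continuous_measurable_padic (h : K -> K) :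
  (forall x (r : R), 0 < r -> exists2 s : R, 0 < s &
     forall y, pabs (y - x) < s -> pabs (h y - h x) < r) ->
  measurable_fun setT (h : T -> T).
Proof.
move=> ch; apply: (@measurability _ _ T T setT h (@open K : set (set (pointed_padic K)))).
  by [].
move=> _ [A oA <-]; rewrite setTI; apply: open_measurable_padic.
move: oA; rewrite !openE => oA x /oA /nbhs_pabs[r r0 rA].
have [s s0 sh] := ch x r r0; apply/nbhs_pabs; exists s => // y /sh.
exact: rA.
Qed.

End LocallyConstant.

Section ComplexIntegralTheory.
Context d (T : measurableType d) (R : realType).
Variable mu : {measure set T -> \bar R}.
Local Notation C := R[i].
Implicit Types (D : set T) (f g : T -> C) (c : C).

Lemma eq_cintegral D f g : {in D, f =1 g} -> cintegral mu D f = cintegral mu D g.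
Proof.
by move=> fg; rewrite /cintegral; congr (_ +i* _)%C; apply: eq_Rintegral => x xD /=;
  rewrite fg.
Qed.

Lemma eq_cintegrable D f g : measurable D -> {in D, f =1 g} ->
  cintegrable mu D f -> cintegrable mu D g.
Proof.
move=> mD fg [h1 h2]; split; [move: h1|move: h2]; apply: eq_integrable => //;
  by move=> x xD /=; rewrite fg.
Qed.

Lemma complex_ReM (x y : C) : complex.Re (x * y) =
  complex.Re x * complex.Re y - complex.Im x * complex.Im y.
Proof. by case: x y => a b [a' b']. Qed.

Lemma complex_ImM (x y : C) : complex.Im (x * y) =
  complex.Re x * complex.Im y + complex.Im x * complex.Re y.
Proof. by case: x y => a b [a' b'] /=; rewrite addrC. Qed.

Lemma complex_ReB (x y : C) : complex.Re (x - y) = complex.Re x - complex.Re y.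
Proof. by case: x y => a b [a' b']. Qed.

Lemma complex_ImB (x y : C) : complex.Im (x - y) = complex.Im x - complex.Im y.
Proof. by case: x y => a b [a' b']. Qed.

Lemma integrableZlE D (r : R) (f : T -> R) : measurable D ->
  mu.-integrable D (EFin \o f) -> mu.-integrable D (EFin \o (fun x => r * f x)).
Proof. by move=> mD h; exact: (integrableZl mD r h). Qed.

Lemma cintegrableZ D f c : measurable D -> cintegrable mu D f ->
  cintegrable mu D (fun x => c * f x).
Proof.
move=> mD [h1 h2]; split.
  rewrite (_ : _ \o _ = fun x => (complex.Re c * complex.Re (f x))%:E -
      (complex.Im c * complex.Im (f x))%:E)%E.
    by apply: integrableB => //; apply: integrableZlE.
  by apply/funext => x; rewrite /= complex_ReM.
rewrite (_ : _ \o _ = fun x => (complex.Re c * complex.Im (f x))%:E +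
      (complex.Im c * complex.Re (f x))%:E)%E.
  by apply: integrableD => //; apply: integrableZlE.
by apply/funext => x; rewrite /= complex_ImM.
Qed.

Lemma cintegralZ D f c : measurable D -> cintegrable mu D f ->
  cintegral mu D (fun x => c * f x) = c * cintegral mu D f.
Proof.
move=> mD [h1 h2]; rewrite /cintegral; apply/eqP; rewrite eq_complex complex_ReM complex_ImM /=.
rewrite -!RintegralZl // -RintegralB ?integrableZlE //.
rewrite -RintegralD ?integrableZlE //.
by apply/andP; split; apply/eqP/eq_Rintegral => x _; rewrite /= ?complex_ReM ?complex_ImM.
Qed.

Lemma cintegrableB D f g : measurable D -> cintegrable mu D f ->
  cintegrable mu D g -> cintegrable mu D (fun x => f x - g x).
Proof.
move=> mD [h1 h2] [h3 h4]; split.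
  rewrite (_ : _ \o _ = fun x => (complex.Re (f x))%:E - (complex.Re (g x))%:E)%E.
    exact: integrableB.
  by apply/funext => x; rewrite /= complex_ReB.
rewrite (_ : _ \o _ = fun x => (complex.Im (f x))%:E - (complex.Im (g x))%:E)%E.
  exact: integrableB.
by apply/funext => x; rewrite /= complex_ImB.
Qed.

Lemma cintegralB D f g : measurable D -> cintegrable mu D f ->
  cintegrable mu D g ->
  cintegral mu D (fun x => f x - g x) = cintegral mu D f - cintegral mu D g.
Proof.
move=> mD [h1 h2] [h3 h4]; rewrite /cintegral; apply/eqP.
rewrite eq_complex complex_ReB complex_ImB /= -!RintegralB //.
by apply/andP; split; apply/eqP/eq_Rintegral => x _; rewrite /= ?complex_ReB ?complex_ImB.
Qed.

Lemma cintegral_indic D (p : pred T) c (r : R) : measurable [set x | p x] ->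
  [set x | p x] `<=` D -> mu [set x | p x] = r%:E ->
  cintegral mu D (fun x => if p x then c else 0) = c * r%:C%C.
Proof.
move=> mp pD mur.
have E (h : C -> R) : h 0 = 0 ->
    Rintegral mu D (h \o (fun x => if p x then c else 0)) = h c * r.
  move=> h0; rewrite (_ : _ \o _ = cst (h c) \_ [set x | p x]); last first.
    apply/funext => x; rewrite /patch /=; case: ifPn => px.
      by rewrite mem_set.
    by rewrite memNset //=; apply/negP.
  by rewrite -Rintegral_mkcondr (setIidr pD) Rintegral_cst //= mur.
rewrite /cintegral !E //; apply/eqP.
by rewrite eq_complex complex_ReM complex_ImM /= !mulr0 subr0 add0r !eqxx.
Qed.

Lemma cintegral_transfer D (h : T -> T) f : measurable D ->
  measurable_fun setT h -> h @^-1` D = D ->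
  (forall A, measurable A -> A `<=` D -> mu (h @^-1` A) = mu A) ->
  cintegrable mu D (f \o h) ->
  measurable_fun D (@complex.Re R \o f) ->
  measurable_fun D (@complex.Im R \o f) ->
  cintegral mu D (f \o h) = cintegral mu D f.
Proof.
move=> mD mh hD muh [h1 h2] m1 m2.
have E (u : T -> R) : measurable_fun D u ->
    mu.-integrable D (EFin \o (u \o h)) ->
    Rintegral mu D (u \o h) = Rintegral mu D u.
  move=> mu_ iu; have hin x : (h x \in D) = (x \in D).
    by rewrite -[in RHS]hD; apply/idP/idP => /set_mem ?; apply/mem_set.
  have uD : {in D, u \o h =1 (u \_ D) \o h}.
    by move=> x xD; rewrite /= patchT // hin.
  rewrite (eq_Rintegral _ uD).
  rewrite (@eq_Rintegral _ _ _ mu D (u \_ D) u); last by move=> x xD; rewrite patchT.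
  rewrite /Rintegral; congr fine; rewrite -{1}hD.
  rewrite -(@integral_pushforward _ _ _ _ _ _ mh mu D (EFin \o (u \_ D))) //.
  - exact: eq_measure_integral.
  - by apply/measurable_EFinP; exact/(measurable_restrictT _ mD).
  - rewrite hD; apply: eq_integrable iu => // x xD.
    by rewrite /= -[u (h x)]/((u \o h) x) uD.
by rewrite /cintegral; congr (_ +i* _)%C; apply: E.
Qed.

End ComplexIntegralTheory.

(** * Additive characters and Fourier transforms *)

Section AdditiveHaar.
Variables (l : nat) (R : realType) (K : padicFieldType l R).
Variable dx : {measure set (borel K) -> \bar R}.
Hypothesis hdx : additive_haar dx.
Local Notation C := R[i].
Local Notation lR := (l%:R : R).

Lemma lXN_small (r : R) : 0 < r -> exists k : nat, lR ^- k < r.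
Proof.
move=> r0; have r0' : 0 <= r^-1 by rewrite invr_ge0 ltW.
have h := archi_boundP r0'.
set k := Num.bound _ in h; exists k.
rewrite invf_plt ?posrE ?exprn_gt0 ?(lR_gt0 K) //.
apply: lt_trans h _; rewrite -natrX ltr_nat; exact/ltn_expl/(l_gt1 K).
Qed.

Lemma haar_ball_step (n : int) :
  dx [set x : K | pabs x <= lR ^ (n + 1)] =
  (l%:R%:E * dx [set x : K | (pabs x <= lR ^ n)%R])%E.
Proof.
pose p : K := l%:R ^ (- (n + 1)).
have pE : pabs p = lR ^ (n + 1) by rewrite pabs_lX opprK.
have ln0 (m : int) : 0 < lR ^ m by exact: lRX_gt0.
have p0 : p != 0 by rewrite -pabs_gt0 pE.
pose F (j : nat) : set (borel K) :=
  if (j < l)%N then [set x : K | pabs (x - j%:R * p) <= lR ^ n] else set0.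
have mF j : measurable (F j).
  by rewrite /F; case: ifP => _ //; exact: ball_measurable.
have tF : trivIset setT F.
  apply/trivIsetP => i j _ _ ij; rewrite /F.
  case: ifP => il; last by rewrite set0I.
  case: ifP => jl; last by rewrite setI0.
  apply/seteqP; split=> // x /= [hi hj]; move/eqP: ij; apply.
  apply: (@pabs_ord_eq l R K 1); rewrite ?expn1 //.
  have -> : i%:R - j%:R = ((x - j%:R * p) - (x - i%:R * p)) / p :> K.
    by apply: (mulIf p0); rewrite divfK //; ring.
  rewrite pabsM pabsV pE ler_pdivrMr // -[_ ^- 1]/(lR ^ (-1)).
  have -> : lR ^ (-1) * lR ^ (n + 1) = lR ^ n.
    by rewrite -expfzDr ?(lR_neq0 K) // addrC addrK.
  exact: pabsB_le.
have -> : [set x : K | pabs x <= lR ^ (n + 1)] = \big[setU/set0]_(j < l) F j.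
  rewrite -bigcup_mkord; apply/seteqP; split=> x /=.
    move=> hx; have [|j jl hj] := @pabs_residue1 l R K (x / p).
      by rewrite pabsM pabsV pE ler_pdivrMr // mul1r.
    exists j => //; rewrite /F jl /=.
    have -> : x - j%:R * p = (x / p - j%:R) * p by rewrite mulrBl divfK.
    rewrite pabsM pE -ler_pdivlMr //; apply: le_trans hj _.
    by rewrite invr_expz -expfzDr ?(lR_neq0 K) // opprD addrA addrN add0r.
  move=> [j /= jl]; rewrite /F jl /= => h.
  rewrite -(subrK (j%:R * p) x); apply: pabsD_le.
    by apply: le_trans h _; rewrite (lRX_le K); lia.
  by rewrite -[leRHS]mul1r pabsM_le ?pE // pabs_nat_le1.
rewrite measure_bigsetU //.
rewrite (eq_bigr (fun=> dx [set x : K | pabs x <= lR ^ n])); last first.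
  move=> i _; rewrite /F ltn_ord -(hdx.1 (i%:R * p)); last first.
    have := ball_measurable (0 : K) (ln0 n).
    by under [X in measurable X -> _]eq_set do rewrite subr0.
  congr (dx _); apply/seteqP; split=> x /=.
    by move=> h; exists (x - i%:R * p) => //; rewrite addrC subrK.
  by move=> [y hy <-]; rewrite addrAC subrr add0r.
by rewrite sumr_const card_ord mule_natl.
Qed.

Lemma haar_ball (n : int) : dx [set x : K | pabs x <= lR ^ n] = (lR ^ n)%:E.
Proof.
elim/int_ind: n => [|n IH|n IH].
- by rewrite expr0z hdx.2.
- by rewrite -addn1 PoszD haar_ball_step IH -EFinM mulrC -[X in _ * X]expr1z -expfzDr ?(lR_neq0 K).
- have := haar_ball_step (- (n.+1)%:Z).
  rewrite -addn1 PoszD opprD subrK IH.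
  have lE : (0 < l%:R%:E :> \bar R)%E by rewrite lte_fin (lR_gt0 K).
  case: (dx _) => [r| |].
  + rewrite -EFinM => -[E]; congr (_%:E); apply: (mulfI (lR_neq0 K)).
    by rewrite -E -[X in X * _]expr1z -expfzDr ?(lR_neq0 K) // addrC subrK.
  + by rewrite gt0_muley.
  + by rewrite gt0_muleNy.
Qed.

Variable e : K -> C.
Hypothesis he : standard_additive_char e.

Lemma addchar0 : e 0 = 1.
Proof.
have [eD _ en] := he; have e1 : e 1 = 1.
  by have := en 0; rewrite expr0 invr1 divr1 mulr_natl cos2pi sin2pi.
by have := eD 0 1; rewrite add0r e1 mulr1.
Qed.

Lemma addchar_nat (n : nat) : e n%:R = 1.
Proof.
have [eD _ en] := he; have e1 : e 1 = 1.
  by have := en 0; rewrite expr0 invr1 divr1 mulr_natl cos2pi sin2pi.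
by elim: n => [|n IH]; rewrite ?addchar0 // -natr1 eD IH e1 mulr1.
Qed.

Lemma addchar_int (x : K) : pabs x <= 1 -> e x = 1.
Proof.
move=> x1; have [_ ce _] := he.
apply/eqP; rewrite -subr_eq0 -normr_eq0; apply/negP => /negP n0.
have /cvgrPdist_lt/(_ `|e x - 1|) := ce x.
rewrite lt0r n0 normr_ge0 => /(_ isT) /nbhs_pabs[r r0 hr].
have [k kr] := lXN_small r0; have [n _ nk] := pabs_residue k x1.
have := hr n%:R; rewrite pabsBC addchar_nat => /(_ (le_lt_trans nk kr)).
by rewrite ltxx.
Qed.

Lemma addchar_norm (x : K) : `|e x| = 1.
Proof.
have [eD _ _] := he.
have [k hk] : exists k : nat, pabs (l%:R ^+ k * x) <= 1.
  have [->|x0] := eqVneq x 0; first by exists 0%N; rewrite mulr0 pabs0.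
  have [k kx] := lXN_small (r := (pabs x)^-1) ltac:(by rewrite invr_gt0 pabs_gt0).
  exists k; rewrite pabsM pabsX pabs_l exprVn.
  by rewrite -ler_pdivlMr ?pabs_gt0 // mul1r ltW.
have eX (n : nat) : e (n%:R * x) = e x ^+ n.
  elim: n => [|n IH]; first by rewrite mul0r addchar0.
  by rewrite -natr1 mulrDl mul1r eD IH exprSr.
have /eqP := addchar_int hk; rewrite -natrX eX => /eqP/(congr1 Num.norm).
rewrite normr1 normrX => /eqP; rewrite pexpr_eq1 ?normr_ge0 //.
  by move/eqP.
by rewrite expn_gt0 (ltnW (l_gt1 K)).
Qed.

Lemma addchar_linv : e l%:R^-1 != 1.
Proof.
have [_ _ en] := he; have := en 1; rewrite expr1 => ->.
rewrite eq_complex negb_and /=; apply/orP; left.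
have -> : 2 * pi / lR ^+ 1 = (pi / lR) *+ 2.
  by rewrite expr1 mulr2n; lra.
rewrite cos_mulr2n cos2sin2.
suff : 0 < sin (pi / lR : R) by move=> h; rewrite mulrnBl; apply/eqP => E;
  have := exprn_gt0 2 h; lra.
have l2 : 2 <= lR by rewrite ler_nat (l_gt1 K).
have lp := lR_gt0 K; have pp := pi_gt0 R.
apply: sin_gt0_pi; rewrite divr_gt0 //= ltr_pdivrMr //.
by rewrite ltr_pMr //; apply: lt_le_trans l2; lra.
Qed.

Lemma addchar_locally_constant (x : K) :
  locally_constant setT (fun v : K => e (x * v)).
Proof.
have [eD _ _] := he.
have [->|x0] := eqVneq x 0.
  by move=> v _; exists 1 => // y _; rewrite !mul0r.
move=> v _; exists (pabs x)^-1; first by rewrite invr_gt0 pabs_gt0.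
move=> y yv; split=> //; rewrite -[x * y](subrK (x * v)) eD -mulrBr.
rewrite addchar_int ?mul1r // pabsM mulrC -ler_pdivlMr ?pabs_gt0 // mul1r.
exact: ltW.
Qed.

Let ball_ind (n : int) (v : K) : C := if pabs v <= lR ^ n then 1 else 0.

Lemma ball_ind_locally_constant n : locally_constant setT (ball_ind n).
Proof.
have := locally_constant_ball (0 : K) (lRX_gt0 K n).
under eq_fun do rewrite subr0; move=> h.
exact: (locally_constant_comp (fun b : bool => if b then 1 else 0 : C) h).
Qed.

Lemma addchar_ball_cintegrable (x : K) (n : int) :
  cintegrable dx setT (fun v : K => e (x * v) * ball_ind n v).
Proof.
apply: (@cintegrable_dom _ _ _ _ _ _ (fun v => if pabs v <= lR ^ n then 1 else 0)).
- apply: (locally_constant_op2 ( *%R )); first exact: addchar_locally_constant.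
  exact: ball_ind_locally_constant.
- apply: integrable_ball; first exact: lRX_gt0.
  by rewrite haar_ball ltry.
- move=> v _; rewrite /ball_ind normrM addchar_norm mul1r.
  by case: ifP; rewrite ?normr1 ?normr0.
Qed.

Lemma addchar_ball_cintegral (x : K) (n : int) :
  cintegral dx setT (fun v : K => e (x * v) * ball_ind n v) =
  if pabs x <= lR ^ (- n) then (lR ^ n)%:C%C else 0.
Proof.
have [eD _ _] := he; have ln0 := lRX_gt0 K n.
case: ifPn => [xn|]; last rewrite -ltNge => xn.
  rewrite (@eq_cintegral _ _ _ _ _ _ (fun v : borel K => if pabs (v : K) <= lR ^ n then 1 else 0)).
    have mb := ball_measurable (0 : K) ln0.
    rewrite (cintegral_indic _ (r := lR ^ n)) ?mul1r //; last exact: haar_ball.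
    by move: mb; under eq_set do rewrite subr0.
  move=> v _; rewrite /ball_ind; case: ifPn => vn; last by rewrite mulr0.
  rewrite mulr1 addchar_int //; apply: le_trans (pabsM_le xn vn) _.
  by rewrite -expfzDr ?(lR_neq0 K) // addNr.
have x0 : x != 0 by rewrite -pabs_gt0; apply: lt_trans xn; exact: lRX_gt0.
pose v0 : K := l%:R^-1 / x.
have v0n : pabs v0 <= lR ^ n.
  have h : lR ^ (1 - n) <= pabs x by rewrite leNgt pabs_ltX addrAC subrr add0r -ltNge.
  rewrite pabsM !pabsV pabs_l invrK ler_pdivrMr ?pabs_gt0 //.
  apply: le_trans (ler_wpM2l (ltW ln0) h).
  by rewrite -expfzDr ?(lR_neq0 K) // addrC subrK expr1z.
set I := cintegral _ _ _.
have E : I = e (x * v0) * I.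
  rewrite {2}/I -cintegralZ //; last exact: addchar_ball_cintegrable.
  pose f v := e (x * v) * ball_ind n v.
  have lf : locally_constant setT f.
    apply: (locally_constant_op2 ( *%R )); first exact: addchar_locally_constant.
    exact: ball_ind_locally_constant.
  have fh : (f \o (fun v : K => v + v0)) = (fun v => e (x * v0) * (e (x * v) * ball_ind n v)).
    apply/funext => v; rewrite /f /= mulrDr eD [e (x * v) * _]mulrC -mulrA; congr (_ * (_ * _)).
    rewrite /ball_ind; suff -> : (pabs (v + v0) <= lR ^ n) = (pabs v <= lR ^ n) by [].
    apply/idP/idP => h.
      by rewrite -(addrK v0 v); apply: pabsB_le.
    exact: pabsD_le.
  rewrite -fh; symmetry; apply: (@cintegral_transfer _ _ _ dx setT (fun v : borel K => (v : K) + v0)) => //.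
  - apply: continuous_measurable_padic => y r r0; exists r => // z.
    by rewrite opprD addrACA subrr addr0.
  - move=> A mA _; rewrite -(hdx.1 (- v0) A) //; congr (dx _).
    apply/seteqP; split=> y /=.
      by move=> Ay; exists (y + v0) => //; rewrite addrC addrK.
    by move=> [w Aw <-]; rewrite addrAC addNr add0r.
  - by rewrite fh; apply: cintegrableZ => //; exact: addchar_ball_cintegrable.
  - exact: locally_constant_measurable (locally_constant_comp (@complex.Re R) lf).
  - exact: locally_constant_measurable (locally_constant_comp (@complex.Im R) lf).
have : (1 - e (x * v0)) * I = 0 by rewrite mulrBl mul1r -E subrr.
move/eqP; rewrite mulf_eq0 subr_eq0 => /orP[/eqP h|/eqP //].
by have := addchar_linv; rewrite /v0 mulrCA divff // mulr1 in h; rewrite -h eqxx.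
Qed.

Lemma fourier_box (A : K -> C) (a : K -> C) (n : int) :
  (forall x : K, cintegral dx setT (fun v : K => e (x * v) * A v) = a x) ->
  (forall x : K, cintegrable dx setT (fun v : K => e (x * v) * A v)) ->
  forall z, fourier dx e (fun z => (ball_ind n (z 0 0)) * A (z 0 1)) z =
    a (z 0 0) * (if pabs (z 0 1) <= lR ^ (- n) then (lR ^ n)%:C%C else 0).
Proof.
move=> hA iA z; have [eD _ _] := he.
rewrite /fourier.
rewrite (@eq_cintegral _ _ _ _ _ _ (fun u : borel K => a (z 0 0) * (e (- z 0 1 * (u : K)) * ball_ind n u))).
  rewrite cintegralZ //; last exact: addchar_ball_cintegrable.
  by rewrite addchar_ball_cintegral pabsN.
move=> u _ /=; transitivity (e (- z 0 1 * (u : K)) * ball_ind n u * a (z 0 0)); last by rewrite mulrC.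
rewrite -hA -(cintegralZ _ _ (iA _)) //.
apply: eq_cintegral => v _; rewrite /row2 !mxE /= eD mulNr.
by rewrite [e (_ * _) * e _]mulrC -!mulrA; congr (_ * _); rewrite mulrCA.
Qed.

Lemma fourier_sph (z : 'rV[K]_2) : fourier dx e (@phi_sph l R K) z =
  if (pabs (z 0 0) <= 1) && (pabs (z 0 1) <= 1) then 1 else 0.
Proof.
have -> : @phi_sph l R K = (fun z => ball_ind 0 (z 0 0) * ball_ind 0 (z 0 1)).
  apply/funext => y; rewrite /phi_sph /ball_ind expr0z.
  by case: (_ <= _); case: (_ <= _); rewrite /= ?mul0r ?mulr0 ?mulr1.
rewrite (fourier_box 0 (fun x => addchar_ball_cintegral x 0)
  (fun x => addchar_ball_cintegrable x 0)).
rewrite oppr0 expr0z.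
by case: (_ <= _); case: (_ <= _); rewrite /= ?mul0r ?mulr0 ?mulr1.
Qed.

Lemma fourier_lev (t : nat) (z : 'rV[K]_2) : fourier dx e (phi_lev t) z =
  (if pabs (z 0 1) <= lR ^+ t then l%:R ^- t else 0) *
  ((if pabs (z 0 0) <= 1 then 1 else 0) -
   (if pabs (z 0 0) <= lR then l%:R^-1 else 0)).
Proof.
have -> : @phi_lev l R K t =
    (fun z => ball_ind (- t%:Z) (z 0 0) * (ball_ind 0 (z 0 1) - ball_ind (-1) (z 0 1))).
  apply/funext => y; rewrite /phi_lev /ball_ind expr0z exprN1 -exprnN.
  case: ifP => /andP.
    by move=> [-> /eqP->]; rewrite lexx leNgt (lRV_lt1 K) /= subr0 mul1r.
  move=> h; case: ifP => // h1; last by rewrite mul0r.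
  have ne : pabs (y 0 1) != 1 by apply/negP => E; apply: h.
  by rewrite -pabs_lt1 lt_neqAle ne subrr mulr0.
have hA x : cintegral dx setT (fun v : K => e (x * v) * (ball_ind 0 v - ball_ind (-1) v)) =
    (if pabs x <= 1 then 1 else 0) - (if pabs x <= lR then l%:R^-1 else 0).
  rewrite (@eq_cintegral _ _ _ _ _ _ (fun v : borel K => e (x * (v : K)) * ball_ind 0 v - e (x * v) * ball_ind (-1) v)); last first.
    by move=> v _; rewrite mulrBr.
  rewrite cintegralB // ?addchar_ball_cintegral; try exact: addchar_ball_cintegrable.
  rewrite oppr0 expr0z opprK expr1z; congr (_ - _).
  by case: ifP => // _; rewrite exprN1 rmorphV ?unitfE ?(lR_neq0 K) // rmorph_nat.
have iA x : cintegrable dx setT (fun v : K => e (x * v) * (ball_ind 0 v - ball_ind (-1) v)).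
  rewrite (_ : (fun v => _) = fun v => e (x * v) * ball_ind 0 v - e (x * v) * ball_ind (-1) v).
    by apply: cintegrableB => //; exact: addchar_ball_cintegrable.
  by apply/funext => v; rewrite mulrBr.
rewrite (fourier_box (- t%:Z) hA iA) opprK mulrC; congr (_ * _).
rewrite -exprnP; case: ifP => // _.
rewrite -exprnN rmorphV ?unitfE ?expf_neq0 ?(lR_neq0 K) //.
by rewrite rmorphXn rmorph_nat.
Qed.

End AdditiveHaar.

(** * Integrals of unramified characters *)

Section UnramifiedCharacters.
Variables (l : nat) (R : realType) (K : padicFieldType l R).
Local Notation C := R[i].
Local Notation lR := (l%:R : R).

Definition unramified_char (chi : K -> C) : Prop :=
  [/\ chi 1 = 1, (forall x y, x != 0 -> y != 0 -> chi (x * y) = chi x * chi y) &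
      forall u, pabs u = 1 -> chi u = 1].

Variable chi : K -> C.
Hypothesis hchi : unramified_char chi.

Lemma uchar_l_neq0 : chi l%:R != 0.
Proof.
have [c1 cM _] := hchi; apply/negP => /eqP h.
have := cM l%:R l%:R^-1; rewrite invr_neq0 ?(l_neq0 K) // divff ?(l_neq0 K) //.
by rewrite c1 h mul0r => /(_ isT isT)/eqP; rewrite oner_eq0.
Qed.

Lemma uchar_lX (n : int) : chi (l%:R ^ n) = chi l%:R ^ n.
Proof.
have [c1 cM _] := hchi; have l0 := l_neq0 K; have cl0 := uchar_l_neq0.
have cX (m : nat) : chi (l%:R ^+ m) = chi l%:R ^+ m.
  by elim: m => [|m IH]; rewrite ?expr0 // !exprS cM ?expf_neq0 ?IH.
case: n => m; first by rewrite -!exprnP.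
rewrite NegzE -!exprnN; apply: (mulIf (x := chi l%:R ^+ m.+1)).
  by rewrite expf_neq0.
rewrite mulVf ?expf_neq0 // -cX -cM ?invr_neq0 ?expf_neq0 //.
by rewrite mulVf ?expf_neq0.
Qed.

Lemma uchar_val (x : K) (n : int) : pabs x = lR ^ n -> chi x = chi l%:R ^ (- n).
Proof.
move=> xn; have [_ cM cu] := hchi; have l0 := l_neq0 K.
have -> : x = l%:R ^ (- n) * (x / l%:R ^ (- n)).
  by rewrite mulrC divfK // expfz_neq0.
rewrite cM ?expfz_neq0 //; last first.
  rewrite -pabs_gt0 pabsM pabsV pabs_lX opprK xn divff ?ltr01 //.
  by rewrite expfz_neq0 // (lR_neq0 K).
rewrite uchar_lX (cu (x / _)) ?mulr1 // pabsM pabsV pabs_lX opprK xn divff //.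
by rewrite expfz_neq0 // (lR_neq0 K).
Qed.

Lemma uchar_neq0 (x : K) : x != 0 -> chi x != 0.
Proof.
by move=> /pabs_val[n /uchar_val->]; rewrite expfz_neq0 // uchar_l_neq0.
Qed.

Lemma uchar_pabs (x y : K) : x != 0 -> pabs x = pabs y -> chi x = chi y.
Proof. by move=> /pabs_val[n xn] xy; rewrite (uchar_val xn) (@uchar_val y n) // -xy. Qed.

Lemma uchar_locally_constant : locally_constant [set x : K | x != 0] chi.
Proof.
move=> x /= x0; exists (pabs x); first by rewrite pabs_gt0.
move=> y; rewrite pabsBC => /pabs_near E.
have y0 : y != 0 by rewrite -pabs_gt0 E pabs_gt0.
by split=> //; apply: uchar_pabs.
Qed.

Variable dtx : {measure set (borel K) -> \bar R}.
Hypothesis hdtx : multiplicative_haar dtx.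
Let Kstar : set (borel K) := [set x : K | x != 0].
Let w : R := complex.Re `|chi l%:R|.
Hypothesis chi_lt1 : w < 1.

Let mKstar : measurable Kstar.
Proof. apply: open_measurable_padic; exact: open_unit_group. Qed.

Let wE : `|chi l%:R| = w%:C%C.
Proof. by rewrite /w; case: (chi _) => a b; rewrite normc_def. Qed.

Let w_gt0 : 0 < w.
Proof. by have := uchar_l_neq0; rewrite -normr_gt0 wE ltcR. Qed.

Let chi_abs (x : K) (n : int) : pabs x = lR ^ n -> complex.Re `|chi x| = w ^ (- n).
Proof.
move=> /uchar_val->; have E (m : nat) : `|chi l%:R ^+ m| = (w ^+ m)%:C%C.
  by rewrite normrX wE rmorphXn.
case: (- n) => m; first by rewrite -!exprnP E.
by rewrite NegzE -!exprnN normfV E -fmorphV.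
Qed.

Let shell (n : int) : set (borel K) := [set x : K | pabs x = lR ^ n].

Let shell_Kstar n : shell n `<=` Kstar.
Proof. by move=> x; rewrite /shell /Kstar /= => h; rewrite -pabs_gt0 h (lRX_gt0 K). Qed.

Let mshell n : measurable (shell n).
Proof.
have := locally_constant_open [set lR ^ n] (@locally_constant_pabs l R K).
move=> /open_measurable_padic; congr (measurable _); apply/seteqP.
by split=> [x []//|x h]; split=> //; apply: shell_Kstar h.
Qed.

Let shell_measure n : dtx (shell n) = 1%E.
Proof.
rewrite -hdtx.2; have l0 : (l%:R : K) ^ (- n) != 0 by rewrite expfz_neq0 ?l_neq0.
rewrite -(hdtx.1 (l%:R ^ (- n)) [set x : K | pabs x = 1]) //.
- congr (dtx _); apply/seteqP; split=> x /=.
    move=> h; exists (x / l%:R ^ (- n)); last by rewrite mulrC divfK.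
    by rewrite pabsM pabsV pabs_lX opprK h divff // expfz_neq0 // (lR_neq0 K).
  by move=> [y y1 <-]; rewrite /shell /= pabsM y1 mulr1 pabs_lX opprK.
- by have := mshell 0; rewrite /shell expr0z.
- by rewrite /= pabs0 => /eqP; rewrite eq_sym oner_eq0.
Qed.

Let disk (n : int) : set (borel K) := [set x : K | x != 0 /\ pabs x <= lR ^ n].

Let mdisk n : measurable (disk n).
Proof.
have := locally_constant_open [set r | r <= lR ^ n] (@locally_constant_pabs l R K).
by move=> /open_measurable_padic.
Qed.

Let disk_shells n : disk n = \bigcup_k shell (n - k%:Z).
Proof.
apply/seteqP; split=> x /=.
  move=> [/pabs_val[m xm]]; rewrite xm (lRX_le K) => mn.
  exists `|n - m|%N => //; rewrite /shell /= xm gez0_abs ?subr_ge0 //.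
  by rewrite opprB addrC subrK.
move=> [k _ xk]; split; first exact: shell_Kstar xk.
by rewrite xk (lRX_le K) gerBl.
Qed.

Let norm_integrable n :
  dtx.-integrable (disk n) (EFin \o (fun x : K => complex.Re `|chi x|)).
Proof.
have mf : measurable_fun Kstar (fun x : borel K => complex.Re `|chi (x : K)|).
  apply: locally_constant_measurable.
  exact: (locally_constant_comp (fun z : C => complex.Re `|z|) uchar_locally_constant).
have dK : disk n `<=` Kstar by move=> x [].
apply/integrableP; split.
  by apply/measurable_EFinP; exact: (measurable_funS mKstar dK mf).
rewrite disk_shells ge0_integral_bigcup; last first.
- apply/trivIsetP => i j _ _ ij; apply/seteqP; split=> // x [xi xj]; move/eqP: ij; apply.
  rewrite /shell /= in xi xj.
  have E : lR ^ (n - i%:Z) = lR ^ (n - j%:Z) by rewrite -xi -xj.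
  have : n - i%:Z = n - j%:Z by apply/le_anti; rewrite -!(lRX_le K) E lexx.
  by move/addrI/oppr_inj => [].
- by move=> x _; rewrite abse_ge0.
- rewrite -disk_shells; apply: measurableT_comp => //.
  by apply/measurable_EFinP; exact: (measurable_funS mKstar dK mf).
- by move=> k; exact: mshell.
have E k : (\int[dtx]_(x in shell (n - k%:Z)) `|(EFin \o (fun x : K => (complex.Re `|chi x|)%R)) x|
    = (w ^ (- n) * w ^+ k)%:E)%E.
  rewrite (eq_integral (cst (w ^ (- n) * w ^+ k)%:E)).
    by rewrite integral_cst // shell_measure mule1.
  move=> x /set_mem xs; rewrite [LHS](_ : _ = (`|complex.Re `|chi (x : K)| |)%:E) //.
  rewrite [RHS]/= (chi_abs xs) opprB addrC expfzDr ?lt0r_neq0 //.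
  by rewrite -exprnP ger0_norm // mulr_ge0 ?exprn_ge0 ?exprz_ge0 // ltW.
apply: (@le_lt_trans _ _ (w ^ (- n) / (1 - w))%:E); last by rewrite ltry.
apply: lime_le; first by apply: is_cvg_nneseries => k _ _; exact: integral_ge0.
apply: nearW => N /=.
under eq_bigr do rewrite E.
rewrite sumEFin lee_fin -mulr_sumr; apply: ler_wpM2l.
  by rewrite exprz_ge0 // ltW.
rewrite -[leRHS]mul1r ler_pdivlMr ?subr_gt0 // big_mkord mulrC -opprB mulNr -subrX1 opprB.
by rewrite gerBl exprn_ge0 // ltW.
Qed.

Let tail (n : int) (x : K) : C := if pabs x <= lR ^ n then chi x else 0.

Lemma uchar_tail_cintegrable n : cintegrable dtx Kstar (tail n).
Proof.
apply: (@cintegrable_dom _ _ _ dtx _ _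
  (fun x => if pabs x <= lR ^ n then complex.Re `|chi x| else 0)).
- apply: (locally_constant_op2 (fun b y => if b then y else 0 : C) (D := [set x : K | x != 0])
    (f := fun x => pabs x <= lR ^ n)).
    exact: (locally_constant_comp (fun r => r <= lR ^ n) (@locally_constant_pabs l R K)).
  exact: uchar_locally_constant.
- have := norm_integrable n.
  rewrite -(setIidr (_ : disk n `<=` Kstar)); last by move=> x [].
  move=> /(integrable_restrict dtx (mdisk n) mKstar _).
  apply: eq_integrable => // x /set_mem /= x0; rewrite /patch.
  by case: ifPn => [/set_mem[_ ->]//|/negP h]; case: ifP => // h'; case: h; apply/mem_set.
- by move=> x _; rewrite /tail; case: ifP; rewrite ?normr0.
Qed.

Lemma uchar_tail_cintegral n :
  cintegral dtx Kstar (tail n) = chi l%:R ^ (- n) / (1 - chi l%:R).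
Proof.
have c0 := uchar_l_neq0; have [_ cM _] := hchi; have l0 := l_neq0 K.
have c1 : 1 - chi l%:R != 0.
  rewrite subr_eq0; apply/eqP => E; move: chi_lt1.
  by rewrite /w -E normr1 ltxx.
have step m : cintegral dtx Kstar (tail m) - cintegral dtx Kstar (tail (m - 1)) =
    chi l%:R ^ (- m).
  rewrite -cintegralB //; try exact: uchar_tail_cintegrable.
  rewrite (@eq_cintegral _ _ _ _ _ _
    (fun x : borel K => if pabs (x : K) == lR ^ m then chi l%:R ^ (- m) else 0)).
    have sE : [set x : borel K | pabs (x : K) == lR ^ m] = shell m.
      by apply/seteqP; split=> x /eqP.
    rewrite (@cintegral_indic _ _ _ _ _ (fun x : borel K => pabs (x : K) == lR ^ m) _ 1) ?sE //.
    by rewrite mulr1.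
  move=> x _; rewrite /tail -pabs_ltX lt_neqAle.
  have [E|ne] := eqVneq (pabs x) (lR ^ m).
    by rewrite E lexx /= subr0 (uchar_val E).
  by rewrite /=; case: ifP => _; rewrite subrr.
have scale m : cintegral dtx Kstar (tail (m - 1)) = chi l%:R * cintegral dtx Kstar (tail m).
  rewrite -cintegralZ //; last exact: uchar_tail_cintegrable.
  have E : {in Kstar, (fun x => chi l%:R * tail m x) =1 tail (m - 1) \o (fun x : K => l%:R * x)}.
    move=> x /set_mem /= x0; rewrite /tail /= cM // pabsM pabs_l.
    have -> : (lR^-1 * pabs x <= lR ^ (m - 1)) = (pabs x <= lR ^ m).
      rewrite mulrC ler_pdivrMr ?(lR_gt0 K) // -[X in _ * X]expr1z.
      by rewrite -expfzDr ?(lR_neq0 K) // subrK.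
    by case: ifP => // _; rewrite mulr0.
  rewrite (eq_cintegral _ E); symmetry.
  apply: (@cintegral_transfer _ _ _ dtx Kstar (fun x : borel K => l%:R * (x : K))) => //.
  - apply: continuous_measurable_padic => y r r0; exists r => // z.
    rewrite -mulrBr pabsM pabs_l; apply: le_lt_trans.
    by rewrite ler_piMl ?pabs_ge0 // ltW // (lRV_lt1 K).
  - by apply/seteqP; split=> x; rewrite /preimage /Kstar /= mulf_eq0 (negbTE l0).
  - move=> A mA AK; rewrite -(hdtx.1 (l%:R^-1) A) ?invr_neq0 //; last first.
      by move=> /AK /=; rewrite /Kstar /= eqxx.
    congr (dtx _); apply/seteqP; split=> x /=.
      by move=> Ax; exists (l%:R * x) => //; rewrite mulKf.
    by move=> [y Ay <-]; rewrite /preimage /= mulVKf.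
  - apply: eq_cintegrable E _ => //.
    by apply: cintegrableZ => //; exact: uchar_tail_cintegrable.
  - by have [/(measurable_int dtx)/measurable_EFinP] := uchar_tail_cintegrable (m - 1).
  - by have [_ /(measurable_int dtx)/measurable_EFinP] := uchar_tail_cintegrable (m - 1).
apply: (mulIf c1); rewrite divfK // -step scale mulrBr mulr1 mulrC //.
Qed.

End UnramifiedCharacters.

(** * Siegel sections *)

Section ComplexPowers.
Variable R : realType.
Local Notation C := R[i].
Implicit Types (a b : R) (s t : C).

Lemma complex_ReD (x y : C) : complex.Re (x + y) = complex.Re x + complex.Re y.
Proof. by case: x y => ? ? []. Qed.

Lemma complex_ImD (x y : C) : complex.Im (x + y) = complex.Im x + complex.Im y.
Proof. by case: x y => ? ? []. Qed.

Lemma Re_nat (n : nat) : complex.Re (n%:R : C) = n%:R.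
Proof. by elim: n => // n IH; rewrite -natr1 complex_ReD IH -natr1. Qed.

Lemma cpowD a s t : cpow a (s + t) = cpow a s * cpow a t.
Proof.
rewrite /cpow complex_ReD complex_ImD !mulrDl expRD cosD sinD; apply/eqP.
by rewrite eq_complex complex_ReM complex_ImM /=; apply/andP; split; apply/eqP; ring.
Qed.

Lemma cpowMl a b s : 0 < a -> 0 < b -> cpow (a * b) s = cpow a s * cpow b s.
Proof.
move=> a0 b0; rewrite /cpow lnM ?posrE // !mulrDr expRD cosD sinD; apply/eqP.
by rewrite eq_complex complex_ReM complex_ImM /=; apply/andP; split; apply/eqP; ring.
Qed.

Lemma cpow_s0 a : cpow a 0 = 1.
Proof. by rewrite /cpow /= !mul0r expR0 cos0 sin0 mulr1 mulr0. Qed.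

Lemma cpow_1s s : cpow 1 s = 1.
Proof. by rewrite /cpow ln1 !mulr0 expR0 cos0 sin0 mulr1 mulr0. Qed.

Lemma cpow_neq0 a s : cpow a s != 0.
Proof.
apply/negP => /eqP h; have := cpowD a s (- s).
by rewrite subrr cpow_s0 h mul0r => /eqP; rewrite oner_eq0.
Qed.

Lemma cpowN a s : cpow a (- s) = (cpow a s)^-1.
Proof.
by apply: (mulfI (cpow_neq0 a s)); rewrite mulfV ?cpow_neq0 // -cpowD subrr cpow_s0.
Qed.

Lemma cpowV a s : 0 < a -> cpow a^-1 s = (cpow a s)^-1.
Proof.
move=> a0; apply: (mulfI (cpow_neq0 a s)).
by rewrite mulfV ?cpow_neq0 // -cpowMl ?invr_gt0 // divff ?lt0r_neq0 // cpow_1s.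
Qed.

Lemma cpow_s1 a : 0 < a -> cpow a 1 = a%:C%C.
Proof.
by move=> a0; rewrite /cpow /= mul1r mul0r cos0 sin0 mulr1 mulr0 lnK ?posrE.
Qed.

Lemma cpow_nat a n : 0 < a -> cpow a n%:R = (a ^+ n)%:C%C.
Proof.
move=> a0; elim: n => [|n IH]; first by rewrite cpow_s0 expr0.
by rewrite -natr1 cpowD IH cpow_s1 // exprSr rmorphM.
Qed.

Lemma cpowXz a (n : int) s : 0 < a -> cpow (a ^ n) s = cpow a s ^ n.
Proof.
move=> a0; have E (m : nat) : cpow (a ^+ m) s = cpow a s ^+ m.
  by elim: m => [|m IH]; rewrite ?expr0 ?cpow_1s // !exprS cpowMl ?exprn_gt0 // IH.
case: n => m; first by rewrite -!exprnP E.
by rewrite NegzE -!exprnN cpowV ?exprn_gt0 // E.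
Qed.

Lemma cpow_norm a s : `|cpow a s| = (expR (complex.Re s * ln a))%:C%C.
Proof.
rewrite normc_def /cpow /= !exprMn -mulrDr cos2Dsin2 mulr1.
by rewrite sqrtr_sqr ger0_norm // expR_ge0.
Qed.

End ComplexPowers.

Section SiegelSection.
Variables (l : nat) (R : realType) (K : padicFieldType l R).
Local Notation C := R[i].
Local Notation lR := (l%:R : R).

Lemma abspow_uchar (s : C) : unramified_char (abspow s : K -> C).
Proof.
split=> [|x y x0 y0|u u1]; rewrite /abspow; first by rewrite pabs1 cpow_1s.
  by rewrite pabsM cpowMl ?pabs_gt0.
by rewrite u1 cpow_1s.
Qed.

Lemma ucharM (f g : K -> C) : unramified_char f -> unramified_char g ->
  unramified_char (fun x => f x * g x).
Proof.
move=> [f1 fM fu] [g1 gM gu]; split=> [|x y x0 y0|u u1].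
- by rewrite f1 g1 mulr1.
- by rewrite fM // gM // mulrACA.
- by rewrite fu // gu // mulr1.
Qed.

Lemma ucharV (f : K -> C) : unramified_char f -> unramified_char (fun x => (f x)^-1).
Proof.
move=> [f1 fM fu]; split=> [|x y x0 y0|u u1].
- by rewrite f1 invr1.
- by rewrite fM // invfM.
- by rewrite fu // invr1.
Qed.

Lemma smooth_uchar (f : K -> C) : smooth_char f -> unramified f -> unramified_char f.
Proof. by move=> [f1 fM _] fu; split. Qed.

Lemma polynomial_eq_at_powers (P Q : {poly C}) (N : nat) :
  (forall n, (N <= n)%N -> P.[l%:R ^+ n] = Q.[l%:R ^+ n]) -> P = Q.
Proof.
move=> h; apply/eqP; rewrite -subr_eq0; apply/negPn/negP => nz.
pose rs := [seq (l%:R ^+ (N + i) : C) | i <- iota 0 (size (P - Q))].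
have := @max_poly_roots _ (P - Q) rs nz; rewrite size_map size_iota ltnn.
move=> F; suff : false by []. apply: F.
  apply/allP => _ /mapP[i _ ->]; rewrite /root !hornerE.
  by rewrite h ?leq_addr // subrr.
rewrite map_inj_uniq ?iota_uniq // => i j; rewrite -!natrX.
move=> /eqP; rewrite eqr_nat eqn_exp2l ?(l_gt1 K) // eqn_add2l.
by move/eqP.
Qed.

Variable dtx : {measure set (borel K) -> \bar R}.
Hypothesis hdtx : multiplicative_haar dtx.
Variables (phi : 'rV[K]_2 -> C) (chi psi : K -> C).
Hypotheses (hchi : unramified_char chi) (hpsi : unramified_char psi).
Let Om (s : C) (x : K) : C := chi x / psi x * abspow (2 * s + 1) x.
Hypothesis Om_lt1 : forall s : C, 0 < complex.Re s -> complex.Re `|Om s l%:R| < 1.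

Let Om_uchar s : unramified_char (Om s).
Proof. by apply: ucharM; [apply: ucharM => //; exact: ucharV|exact: abspow_uchar]. Qed.

Lemma siegel_continuation_unique (g : gl2 K) (v v' : C) :
  siegel_continuation dtx phi chi psi g v ->
  siegel_continuation dtx phi chi psi g v' -> v = v'.
Proof.
move=> [P [m [s0 [hP ->]]]] [P' [m' [s0' [hP' ->]]]].
have [N hN] : exists N : nat, s0 < N%:R /\ s0' < N%:R.
  exists (maxn (Num.bound `|s0|) (Num.bound `|s0'|)); split.
    apply: le_lt_trans (ler_norm _) _; apply: lt_le_trans (archi_boundP (normr_ge0 _)) _.
    by rewrite ler_nat leq_maxl.
  apply: le_lt_trans (ler_norm _) _; apply: lt_le_trans (archi_boundP (normr_ge0 _)) _.
  by rewrite ler_nat leq_maxr.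
have E : P * 'X^m' = P' * 'X^m.
  apply: (@polynomial_eq_at_powers _ _ N) => n Nn.
  have hn : s0 < complex.Re (n%:R : C).
    by rewrite Re_nat; apply: lt_le_trans hN.1 _; rewrite ler_nat.
  have hn' : s0' < complex.Re (n%:R : C).
    by rewrite Re_nat; apply: lt_le_trans hN.2 _; rewrite ler_nat.
  have [_ h] := hP _ hn; have [_ h'] := hP' _ hn'.
  have q0 : (l%:R : C) ^+ n != 0.
    by rewrite expf_neq0 // pnatr_eq0 -lt0n (ltnW (l_gt1 K)).
  have qE : cpow lR n%:R = l%:R ^+ n.
    by rewrite cpow_nat ?(lR_gt0 K) // rmorphXn rmorph_nat.
  move/eqP: h; rewrite h'.
  rewrite qE eqr_div ?(expf_neq0 _ q0) // => /eqP h.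
  by rewrite !hornerE /= ?hornerXn.
by have := congr1 (horner^~ 1) E; rewrite !hornerE /= ?hornerXn ?expr1n ?mulr1.
Qed.

(* For these phi the integral is a difference of two tails of a geometric series, and
   the L-factor cancels the denominators. *)
Lemma siegel_section_eval (g : gl2 K) (c1 c2 : C) (m1 m2 : int) :
  (forall x : K, x != 0 -> phi (row2 0 x *m g) =
     c1 * (if pabs x <= lR ^ m1 then 1 else 0) -
     c2 * (if pabs x <= lR ^ m2 then 1 else 0)) ->
  siegel_section dtx phi chi psi g =
  chi (\det (g : 'M[K]_2)) * abspow 2^-1 (\det (g : 'M[K]_2)) *
  (c1 * Om 0 l%:R ^ (- m1) - c2 * Om 0 l%:R ^ (- m2)).
Proof.
move=> hphi; set d := \det _.
have d0 : d != 0 by have := gl2_unit g; rewrite unitmxE unitfE.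
have [j dj] := pabs_val d0.
set Y := Om 0 l%:R; have Y0 : Y != 0 by exact/uchar_l_neq0.
set B := chi d * abspow 2^-1 d.
pose e1 := j + 2 * m1; pose e2 := j + 2 * m2.
pose N := (`|e1| + `|e2|)%N.
pose a1 := absz (e1 + N%:Z); pose a2 := absz (e2 + N%:Z).
pose P : {poly C} := (B * (c1 * Y ^ (- m1))) *: 'X^a1 - (B * (c2 * Y ^ (- m2))) *: 'X^a2.
have P1 : P.[1] = B * (c1 * Y ^ (- m1) - c2 * Y ^ (- m2)).
  by rewrite /P hornerD hornerN !hornerZ !hornerXn !expr1n; ring.
apply: xget_subset1; last by move=> v v'; exact: siegel_continuation_unique.
exists P, N, 0; split=> // s s0.
have mK : measurable ([set x : K | x != 0] : set (borel K)).
  by apply: open_measurable_padic; exact: open_unit_group.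
set Kstar := [set x : borel K | (x : K) != 0].
pose W := Om s l%:R; have W0 : W != 0 by exact/uchar_l_neq0.
have E : {in Kstar, (fun x : borel K => c1 * (if pabs (x : K) <= lR ^ m1 then Om s x else 0)
     - c2 * (if pabs (x : K) <= lR ^ m2 then Om s x else 0)) =1
    siegel_integrand phi chi psi g s}.
  move=> x /set_mem /= x0; rewrite /siegel_integrand hphi // -mulrA -/(Om s x).
  by rewrite mulrBl; congr (_ - _); rewrite -mulrA; congr (_ * _); case: ifP;
    rewrite ?mul1r ?mul0r.
have I1 m := uchar_tail_cintegrable (Om_uchar s) hdtx (Om_lt1 s0) m.
have I2 m := uchar_tail_cintegral (Om_uchar s) hdtx (Om_lt1 s0) m.
split.
  apply: eq_cintegrable E _ => //.
  by apply: cintegrableB => //; apply: cintegrableZ => //; exact: I1.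
rewrite /siegel -(eq_cintegral _ E) cintegralB //; try by apply: cintegrableZ => //; exact: I1.
rewrite !cintegralZ //; try exact: I1.
rewrite !I2 -/d -/W.
have -> : Lchar (fun x : K => chi x / psi x) (2 * s + 1) = (1 - W)^-1.
  rewrite /Lchar; case: asboolP => [_|[]].
    by rewrite /W /Om /abspow pabs_l cpowV ?(lR_gt0 K) // -cpowN.
  by have [_ _] := ucharM hchi (ucharV hpsi).
have W1 : 1 - W != 0.
  rewrite subr_eq0; apply/eqP => h; have := Om_lt1 s0.
  by rewrite -/W -h normr1 ltxx.
set q := cpow lR s; have q0 : q != 0 by exact: cpow_neq0.
have dE : abspow (s + 2^-1) d = q ^ j * abspow 2^-1 d.
  by rewrite /abspow cpowD dj cpowXz ?(lR_gt0 K).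
have WE : W = Y * q ^ (-2).
  rewrite /W /Y /Om /abspow pabs_l mulr0 add0r -[RHS]mulrA; congr (_ * _).
  rewrite cpowD mulrC; congr (_ * _).
  rewrite cpowV ?(lR_gt0 K) // -[2]/(1 + 1) mulrDl mul1r cpowD -/q.
  by rewrite -[q * q]/(q ^+ 2) exprnN.
have WX m : W ^ (- m) = Y ^ (- m) * q ^ (2 * m).
  by rewrite WE expfzMl exprz_exp mulrNN.
rewrite invrK dE !WX /P hornerD hornerN !hornerZ !hornerXn /a1 /a2.
have ex e : (0 <= e + N%:Z)%R -> q ^+ absz (e + N%:Z) = q ^ e * q ^+ N.
  by move=> h; rewrite -[q ^+ absz _]/(q ^ (absz _)%:Z) gez0_abs // expfzDr.
rewrite !ex; try by rewrite /N /e1 /e2; lia.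
rewrite -/B /B /e1 /e2 !expfzDr //.
by field; rewrite W1 expf_neq0.
Qed.

End SiegelSection.

Section GL2Matrices.
Variable K : fieldType.

Definition mx2 (a b c d : K) : 'M[K]_2 :=
  \matrix_(i, j) nth 0 (nth [::] [:: [:: a; b]; [:: c; d]] i) j.

(* Equal to 1 if the matrix is singular. *)
Definition gl2_of (a b c d : K) : gl2 K := insubd (1%g : gl2 K) (mx2 a b c d).

Lemma det_mx2_of (a b c d : K) : \det (mx2 a b c d) = a * d - b * c.
Proof. by rewrite det_mx2 !mxE. Qed.

Lemma gl2_ofE (a b c d : K) : a * d - b * c != 0 ->
  gl2_of a b c d = mx2 a b c d :> 'M[K]_2.
Proof. by move=> h; rewrite val_insubd unitmxE unitfE det_mx2_of h. Qed.

Lemma mulmx2E (A B : 'M[K]_2) i j : (A *m B) i j = A i 0 * B 0 j + A i 1 * B 1 j.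
Proof.
rewrite mxE !big_ord_recl big_ord0 addr0.
by congr (A i _ * B _ j + A i _ * B _ j); apply: val_inj.
Qed.

Lemma gl2_row1 (g : gl2 K) : (g 1 0 != 0) || (g 1 1 != 0).
Proof.
have := gl2_unit g; rewrite unitmxE unitfE det_mx2; apply: contraNT.
by rewrite negb_or !negbK => /andP[/eqP-> /eqP->]; rewrite !mulr0 subrr.
Qed.

Definition unip_lower (c : K) : gl2 K := gl2_of 1 0 c 1.
Definition unip_upper (b : K) : gl2 K := gl2_of 1 b 0 1.
Definition weyl2 : gl2 K := gl2_of 0 1 (-1) 0.
Definition diag2 (a d : K) : gl2 K := gl2_of a 0 0 d.

Lemma unip_lowerE (c : K) : unip_lower c = mx2 1 0 c 1 :> 'M[K]_2.
Proof. by rewrite gl2_ofE // mulr1 mul0r subr0 oner_eq0. Qed.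

Lemma weyl2E : weyl2 = mx2 0 1 (-1) 0 :> 'M[K]_2.
Proof. by rewrite gl2_ofE // mulr0 mul1r sub0r opprK oner_eq0. Qed.

Lemma diag2E (a d : K) : a != 0 -> d != 0 -> diag2 a d = mx2 a 0 0 d :> 'M[K]_2.
Proof. by move=> a0 d0; rewrite gl2_ofE // mulr0 subr0 mulf_neq0. Qed.

End GL2Matrices.

Arguments gl2_of {K} (a b c d)%_ring_scope.
Arguments unip_lower {K} c%_ring_scope.
Arguments unip_upper {K} b%_ring_scope.
Arguments diag2 {K} (a d)%_ring_scope.
Arguments weyl2 {K}.

Section SphericalSections.
Variables (l : nat) (R : realType) (K : padicFieldType l R).
Local Notation C := R[i].
Local Notation lR := (l%:R : R).
Local Notation lK := (l%:R : K).

(* The argument of larger absolute value: kap (dom a b) stands for the value of the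
   unramified character kap at max(|a|, |b|). *)
Definition dom (a b : K) : K := if pabs b <= pabs a then a else b.

Lemma pabs_dom a b : pabs (dom a b) = Num.max (pabs a) (pabs b).
Proof. by rewrite /dom; case: leP. Qed.

Lemma dom_neq0 a b : (dom a b != 0) = (a != 0) || (b != 0).
Proof. by rewrite -!pabs_gt0 pabs_dom lt_max. Qed.

Variables (A kap : K -> C).
Hypotheses (hA : unramified_char A) (hkap : unramified_char kap).
Let X := A l%:R.
Let y := kap l%:R.

Definition qsec (t : nat) (g : gl2 K) : C :=
  A (\det (g : 'M[K]_2)) * kap (dom (g 1 0) (l%:R ^+ t * g 1 1)).

Lemma kap_dom_eq a b a' b' :
  (a != 0) || (b != 0) -> Num.max (pabs a) (pabs b) = Num.max (pabs a') (pabs b') ->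
  kap (dom a b) = kap (dom a' b').
Proof. by move=> h e; apply: (uchar_pabs hkap); rewrite ?dom_neq0 ?pabs_dom. Qed.

Lemma kap_domr a b : b != 0 -> pabs a <= pabs b -> kap (dom a b) = kap b.
Proof.
move=> b0 ab; apply: (uchar_pabs hkap); first by rewrite dom_neq0 b0 orbT.
by rewrite pabs_dom; apply/max_idPr.
Qed.

Lemma kap_doml a b : pabs b <= pabs a -> kap (dom a b) = kap a.
Proof. by rewrite /dom => ->. Qed.

Lemma lKX_neq0 t : lK ^+ t != 0. Proof. by rewrite expf_neq0 // (l_neq0 K). Qed.

Lemma row1_lX (g : gl2 K) t : (g 1 0 != 0) || (l%:R ^+ t * g 1 1 != 0).
Proof. by rewrite mulf_eq0 (negbTE (lKX_neq0 t)) /= gl2_row1. Qed.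

Lemma kap_scale a b c : a != 0 -> (b != 0) || (c != 0) ->
  kap (dom (a * b) (a * c)) = kap a * kap (dom b c).
Proof.
move=> a0 bc; have [_ kM _] := hkap; rewrite -kM ?dom_neq0 //.
apply: (uchar_pabs hkap).
  by rewrite dom_neq0 !mulf_eq0 (negbTE a0).
by rewrite pabs_dom !pabsM pabs_dom maxr_pMr ?pabs_ge0.
Qed.

Lemma qsec_level t (g k : gl2 K) :
  (forall i j, pabs (k i j) <= 1) -> pabs (k 1 0) <= lR ^- t ->
  pabs (\det (k : 'M[K]_2)) = 1 -> qsec t (g * k)%g = qsec t g.
Proof.
move=> ki k10 kd; have [_ AM Au] := hA.
have gd := gl2_unit g; rewrite unitmxE unitfE in gd.
have kd0 : \det (k : 'M[K]_2) != 0 by rewrite -pabs_gt0 kd.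
rewrite /qsec /= det_mulmx AM // (Au _ kd) mulr1; congr (_ * _).
apply: kap_dom_eq; first exact: (row1_lX (g * k)%g).
have tl : pabs (lK ^+ t) = lR ^- t by rewrite pabsX pabs_l exprVn.
have lt0 : 0 <= lR ^- t by rewrite invr_ge0 exprn_ge0 // ler0n.
have lt1 : lR ^- t <= 1 by rewrite -tl -natrX pabs_nat_le1.
have le1 (u v : K) (r : R) : pabs u <= 1 -> pabs v <= r -> pabs (u * v) <= r.
  by move=> hu hv; rewrite pabsM; apply: le_trans hv; rewrite ler_piMl ?pabs_ge0.
have le2 (u v : K) (r : R) : pabs u <= lR ^- t -> pabs (l%:R ^+ t * v) <= r -> pabs (u * v) <= r.
  by move=> hu; rewrite !pabsM tl; apply: le_trans; rewrite ler_wpM2r ?pabs_ge0.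
set c := g 1 0; set d := g 1 1.
have step (c' d' a11 a12 a21 a22 : K) : pabs a11 <= 1 -> pabs a12 <= 1 ->
    pabs a21 <= lR ^- t -> pabs a22 <= 1 ->
    Num.max (pabs (a11 * c' + a21 * d')) (pabs (lK ^+ t * (a12 * c' + a22 * d'))) <=
    Num.max (pabs c') (pabs (lK ^+ t * d')).
  move=> h11 h12 h21 h22; rewrite ge_max; apply/andP; split.
    apply: pabsD_le; first by apply: (le1); rewrite // le_max lexx.
    by apply: (le2); rewrite // le_max lexx orbT.
  rewrite mulrDr; apply: pabsD_le.
    apply: (le1); first by rewrite tl.
    by apply: (le1); rewrite // le_max lexx.
  by rewrite mulrCA; apply: (le1); rewrite // le_max lexx orbT.
apply/le_anti/andP; split.
  rewrite !mulmx2E -/c -/d ![_ * k _ _]mulrC; exact: step.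
have inv (c' d' p q r s D : K) : D != 0 -> D = p * s - q * r ->
    c' = (s / D) * (c' * p + d' * r) + (- r / D) * (c' * q + d' * s) /\
    d' = (- q / D) * (c' * p + d' * r) + (p / D) * (c' * q + d' * s).
  by move=> D0 DE; split; apply: (mulfI D0); rewrite {1}DE; field; rewrite D0.
have [Ec Ed] := inv c d (k 0 0) (k 0 1) (k 1 0) (k 1 1) _ kd0 (det_mx2 _).
rewrite !mulmx2E -/c -/d; move: Ec Ed.
set c1 := c * _ + _; set d1 := c * _ + _ => -> ->.
by apply: (step); rewrite pabsM pabsV kd invr1 mulr1 ?pabsN.
Qed.

Lemma kap_residue_sum (c d : K) : d != 0 -> pabs c <= pabs d ->
  \sum_(j < l) kap (dom (c + j%:R * d) (l%:R * d)) = (y + l%:R - 1) * kap d.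
Proof.
move=> d0 cd; have [_ kM _] := hkap; have l0 := l_neq0 K.
have [|j0 j0l hj0] := @pabs_residue1 l R K (- c / d).
  by rewrite pabsM pabsN pabsV ler_pdivrMr ?pabs_gt0 // mul1r.
have E (j : nat) : c + j%:R * d = (j%:R - (- c / d)) * d.
  by rewrite mulrBl divfK // opprK addrC.
rewrite (bigD1 (Ordinal j0l)) //= kap_domr ?mulf_neq0 //; last first.
  by rewrite E !pabsM ler_wpM2r ?pabs_ge0 // pabsBC pabs_l.
rewrite kM // -/y.
rewrite (eq_bigr (fun=> kap d)); last first.
  move=> j jj0; have jd : pabs (c + j%:R * d) = pabs d.
    rewrite E pabsM; have -> : pabs (j%:R - - c / d) = 1; last by rewrite mul1r.
    have -> : j%:R - (- c / d) = (j%:R - j0%:R) + (j0%:R - (- c / d)) by ring.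
    have j1 : pabs (j%:R - j0%:R : K) = 1.
      apply/eqP; rewrite eq_le; apply/andP; split.
        by apply: pabsB_le; exact: pabs_nat_le1.
      rewrite leNgt pabs_lt1; apply/negP => h; move/eqP: jj0; apply; apply: val_inj => /=.
      by apply: (@pabs_ord_eq l R K 1); rewrite ?expn1 ?expr1.
    rewrite pabs_lt_add // j1 pabsBC; apply: le_lt_trans hj0 _; exact: lRV_lt1.
  rewrite kap_doml.
    by apply: (uchar_pabs hkap); rewrite // -pabs_gt0 jd pabs_gt0.
  by rewrite jd pabsM pabs_l ler_piMl ?pabs_ge0 // ltW // (lRV_lt1 K).
have -> : \sum_(i < l | i != Ordinal j0l) kap d = (l%:R - 1) * kap d.
  have H : \sum_(i < l) kap d = kap d + \sum_(i < l | i != Ordinal j0l) kap d.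
    by rewrite (bigD1 (Ordinal j0l)).
  by apply: (addrI (kap d)); rewrite -H sumr_const card_ord -mulr_natl; ring.
ring.
Qed.

Lemma kap_neg (x : K) : x != 0 -> kap (- x) = kap x.
Proof. by move=> x0; apply: (uchar_pabs hkap); rewrite ?oppr_eq0 // pabsN. Qed.

Lemma qsec_lower t (c : K) (g : gl2 K) : qsec t (g * unip_lower c)%g =
  A (\det (g : 'M[K]_2)) * kap (dom (g 1 0 + c * g 1 1) (l%:R ^+ t * g 1 1)).
Proof.
rewrite /qsec /= det_mulmx unip_lowerE det_mx2_of !mulmx2E !mxE /=.
by rewrite !mulr1 mul0r subr0 !mulr1 !mulr0 add0r (mulrC c).
Qed.

Lemma qsec_weyl t (g : gl2 K) : qsec t (g * weyl2)%g =
  A (\det (g : 'M[K]_2)) * kap (dom (- g 1 1) (l%:R ^+ t * g 1 0)).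
Proof.
rewrite /qsec /= det_mulmx weyl2E det_mx2_of !mulmx2E !mxE /=.
by rewrite !mulr0 mul1r sub0r opprK !mulr1 addr0 mulrN1 add0r.
Qed.

Lemma qsec_hecke (g : gl2 K) :
  \sum_(j < l) qsec 1 (g * unip_lower j%:R)%g + qsec 1 (g * weyl2)%g =
  (l%:R + y) * qsec 0 g.
Proof.
have l0 := l_neq0 K; have [_ kM _] := hkap.
under eq_bigr do rewrite qsec_lower.
rewrite qsec_weyl /qsec -mulr_sumr expr1 expr0 mul1r mulrCA -mulrDr; congr (_ * _).
set c := g 1 0; set d := g 1 1.
have [dc|cd] := ltP (pabs d) (pabs c).
  have c0 : c != 0 by rewrite -pabs_gt0; apply: le_lt_trans dc; exact: pabs_ge0.
  rewrite (eq_bigr (fun=> kap c)); last first.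
    move=> j _; have jd : pabs (j%:R * d) < pabs c.
      by rewrite pabsM; apply: le_lt_trans dc; rewrite ler_piMl ?pabs_ge0 ?pabs_nat_le1.
    rewrite kap_doml ?(pabs_lt_add jd).
      by apply: (uchar_pabs hkap); rewrite ?(pabs_lt_add jd) // -pabs_gt0 (pabs_lt_add jd) pabs_gt0.
    rewrite pabsM; apply: le_trans (ltW dc); rewrite ler_piMl ?pabs_ge0 //.
    exact: pabs_nat_le1.
  rewrite sumr_const card_ord kap_domr ?mulf_neq0 //; last first.
    rewrite pabsN pabsM pabs_l mulrC ler_pdivlMr ?(lR_gt0 K) // mulrC -ler_pdivlMl ?(lR_gt0 K) //.
    have [n cn] := pabs_val c0; move: dc; rewrite cn pabs_ltX => dn.
    by rewrite mulrC -[lR^-1]/(lR ^ (-1)) -expfzDr ?(lR_neq0 K).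
  by rewrite kM // -/y kap_doml ?ltW // mulrDl mulr_natl.
have d0 : d != 0.
  have := gl2_row1 g; rewrite -/c -/d; case: (eqVneq d 0) => // d0.
  by move: cd; rewrite d0 pabs0 le_eqVlt ltNge pabs_ge0 orbF pabs_eq0 => ->.
rewrite kap_residue_sum // kap_doml; last first.
  by rewrite pabsN pabsM; apply: le_trans cd; rewrite ler_piMl ?pabs_ge0 ?pabs_nat_le1.
by rewrite kap_neg // kap_domr //; ring.
Qed.

Lemma qsec_recursion (t : nat) (g : gl2 K) :
  \sum_(j < l) qsec t.+2 (g * unip_lower (j%:R * l%:R ^+ t.+1))%g =
  (y + l%:R) * qsec t.+1 g - y * qsec t g.
Proof.
have l0 := l_neq0 K; have [_ kM _] := hkap.
under eq_bigr do rewrite qsec_lower.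
rewrite /qsec -mulr_sumr.
set a := A _; set c := g 1 0; set d := g 1 1.
rewrite !(mulrCA _ a) -mulrBr; congr (_ * _).
have E1 : lK ^+ t.+2 * d = l%:R * (l%:R ^+ t.+1 * d) by rewrite exprS mulrA.
have E2 : lK ^+ t.+1 * d = l%:R * (l%:R ^+ t * d) by rewrite exprS mulrA.
under eq_bigr do rewrite -mulrA E1.
set d1 := lK ^+ t.+1 * d in E1 E2 *; set d2 := lK ^+ t * d in E2 *.
have [dc|cd] := ltP (pabs d1) (pabs c).
  have c0 : c != 0 by rewrite -pabs_gt0; apply: le_lt_trans dc; exact: pabs_ge0.
  rewrite (eq_bigr (fun=> kap c)); last first.
    move=> j _; have jd : pabs (j%:R * d1) < pabs c.
      by rewrite pabsM; apply: le_lt_trans dc; rewrite ler_piMl ?pabs_ge0 ?pabs_nat_le1.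
    rewrite kap_doml ?(pabs_lt_add jd).
      by apply: (uchar_pabs hkap); rewrite ?(pabs_lt_add jd) // -pabs_gt0 (pabs_lt_add jd) pabs_gt0.
    rewrite pabsM; apply: le_trans (ltW dc); rewrite ler_piMl ?pabs_ge0 //.
    exact: pabs_nat_le1.
  rewrite sumr_const card_ord !kap_doml ?(ltW dc) //; last first.
    have [n cn] := pabs_val c0; move: dc; rewrite E2 cn pabs_ltX pabsM pabs_l => dn.
    rewrite -[leRHS](mulVKf (lR_neq0 K)) -ler_pdivrMl ?(lR_gt0 K) //.
    have <- : lR ^ (n - 1) = lR^-1 * lR ^ n.
      by rewrite mulrC -[X in _ * X]/(lR ^ (-1)) -expfzDr ?(lR_neq0 K).
    by [].
  by rewrite -mulr_natl; ring.
have d10 : d1 != 0.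
  have := row1_lX g t.+1; rewrite -/c -/d -/d1; case: (eqVneq d1 0) => // d0.
  by move: cd; rewrite d0 pabs0 le_eqVlt ltNge pabs_ge0 orbF pabs_eq0 => ->.
have d20 : d2 != 0 by apply: contraNneq d10 => h; rewrite E2 h mulr0.
rewrite kap_residue_sum // !kap_domr //; last first.
  apply: le_trans cd _; rewrite E2 pabsM ler_piMl ?pabs_ge0 ?pabs_nat_le1 //.
by rewrite E2 kM // -/y; ring.
Qed.

Lemma qsec_diagl (t : nat) (g : gl2 K) :
  qsec t (g * diag2 l%:R^-1 1)%g = (X * y)^-1 * qsec t.+1 g.
Proof.
have l0 := l_neq0 K; have [_ AM _] := hA.
have gd := gl2_unit g; rewrite unitmxE unitfE in gd.
rewrite /qsec /= det_mulmx diag2E ?invr_neq0 ?oner_eq0 // det_mx2_of !mulmx2E !mxE /=.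
rewrite !mulr0 subr0 !mulr1 addr0 add0r AM ?invr_neq0 //.
have -> : lK ^+ t * g 1 1 = l%:R^-1 * (l%:R ^+ t.+1 * g 1 1).
  by rewrite exprS -mulrA mulKf.
rewrite (mulrC (g 1 0)) kap_scale ?invr_neq0 ?row1_lX //.
have := uchar_lX hA (-1); have := uchar_lX hkap (-1); rewrite -!invr_expz !expr1z => -> ->.
by rewrite invfM -/X -/y; ring.
Qed.

Lemma qsec_diagr (g : gl2 K) :
  qsec 0 (g * diag2 1 l%:R^-1)%g = (X * y)^-1 * qsec 1 (g * weyl2)%g.
Proof.
have l0 := l_neq0 K; have [_ AM _] := hA.
have gd := gl2_unit g; rewrite unitmxE unitfE in gd.
rewrite qsec_weyl /qsec /= det_mulmx diag2E ?invr_neq0 ?oner_eq0 // det_mx2_of !mulmx2E !mxE /=.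
rewrite !mulr0 subr0 !mul1r !mulr1 addr0 add0r AM ?invr_neq0 //.
have -> : kap (dom (g 1 0) (g 1 1 / l%:R)) = kap (dom (l%:R^-1 * - g 1 1) (l%:R^-1 * (l%:R * g 1 0))).
  apply: kap_dom_eq; last by rewrite mulKf // mulrN pabsN mulrC maxC.
  by rewrite mulf_eq0 invr_eq0 (negbTE l0) orbF gl2_row1.
rewrite kap_scale ?invr_neq0 //; last first.
  by rewrite oppr_eq0 mulf_eq0 (negbTE l0) orbC gl2_row1.
have := uchar_lX hA (-1); have := uchar_lX hkap (-1); rewrite -!invr_expz !expr1z => -> ->.
by rewrite invfM -/X -/y; ring.
Qed.

Lemma qsec_scalar (t : nat) (g : gl2 K) :
  qsec t (g * diag2 l%:R^-1 l%:R^-1)%g = (X ^+ 2 * y)^-1 * qsec t g.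
Proof.
have l0 := l_neq0 K; have [_ AM _] := hA.
have gd := gl2_unit g; rewrite unitmxE unitfE in gd.
rewrite /qsec /= det_mulmx diag2E ?invr_neq0 // det_mx2_of !mulmx2E !mxE /=.
rewrite !mulr0 subr0 addr0 add0r AM ?mulf_neq0 ?invr_neq0 // AM ?invr_neq0 //.
rewrite (mulrC (g 1 0)) (mulrA (lK ^+ t)) (mulrC (lK ^+ t * _)) kap_scale ?invr_neq0 ?row1_lX //.
have := uchar_lX hA (-1); have := uchar_lX hkap (-1); rewrite -!invr_expz !expr1z => -> ->.
by rewrite !invfM -/X -/y; ring.
Qed.

End SphericalSections.

Section SiegelValues.
Variables (l : nat) (R : realType) (K : padicFieldType l R).
Local Notation C := R[i].
Local Notation lR := (l%:R : R).
Variables (dx dtx : {measure set (borel K) -> \bar R}) (e : K -> C).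
Hypotheses (hdx : additive_haar dx) (hdtx : multiplicative_haar dtx).
Hypothesis he : standard_additive_char e.
Variables (k : nat) (tau : K -> C).
Hypotheses (htau : smooth_char tau) (ftau : finite_order tau).
Hypothesis utau : unramified tau.

Definition siegel_chi (x : K) : C := abspow (2^-1 + k%:R) x * tau x.
Definition siegel_psi : K -> C := abspow (- 2^-1).
Definition siegel_det (x : K) : C := abspow (1 + k%:R) x * tau x.
Definition siegel_row (x : K) : C := (abspow (2 + k%:R) x * tau x)^-1.

Let tau_uchar : unramified_char tau. Proof. exact: smooth_uchar. Qed.

Lemma siegel_det_uchar : unramified_char siegel_det.
Proof. by apply: ucharM => //; exact: abspow_uchar. Qed.

Lemma siegel_row_uchar : unramified_char siegel_row.
Proof. by apply: ucharV; apply: ucharM => //; exact: abspow_uchar. Qed.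

Lemma tau_norm (x : K) : x != 0 -> `|tau x| = 1.
Proof.
move=> x0; have [n n0 h] := ftau; have := h x x0 => /(congr1 Num.norm).
rewrite normrX normr1 => /eqP; rewrite pexpr_eq1 ?normr_ge0 //; by move/eqP.
Qed.

Lemma abspowD (s t : C) (x : K) : abspow (s + t) x = abspow s x * abspow t x.
Proof. exact: cpowD. Qed.

Lemma abspow_l (n : nat) : abspow n%:R (l%:R : K) = l%:R ^- n.
Proof.
rewrite /abspow pabs_l cpowV ?(lR_gt0 K) // cpow_nat ?(lR_gt0 K) //.
by rewrite rmorphXn rmorph_nat.
Qed.

Lemma lC_neq0 : (l%:R : C) != 0.
Proof. by rewrite pnatr_eq0 -lt0n (ltnW (l_gt1 K)). Qed.

Lemma siegel_det_l : siegel_det l%:R = tau l%:R / l%:R ^+ k.+1.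
Proof. by rewrite /siegel_det -[1 + _]/(1%:R + k%:R) -natrD abspow_l mulrC. Qed.

Lemma siegel_detM_row : siegel_det l%:R * siegel_row l%:R = l%:R.
Proof.
rewrite siegel_det_l /siegel_row -[2 + _]/(2%:R + k%:R) -natrD abspow_l.
have := uchar_l_neq0 tau_uchar; have := lC_neq0; have -> : (2 + k = k.+2)%N by [].
rewrite !exprS; move: (tau _) => t l0 t0.
by field; rewrite expf_neq0 // l0 t0.
Qed.

Let Om (s : C) (x : K) : C := siegel_chi x / siegel_psi x * abspow (2 * s + 1) x.

Lemma Om_siegel_row (s : C) (x : K) : Om s x = abspow (2 * s) x / siegel_row x.
Proof.
rewrite /Om /siegel_chi /siegel_psi /siegel_row invrK.
have -> : (abspow (- 2^-1) x)^-1 = abspow 2^-1 x.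
  by rewrite /abspow cpowN invrK.
have E : abspow (2^-1 + k%:R) x * abspow 2^-1 x * abspow (2 * s + 1) x =
    abspow (2 * s) x * abspow (2 + k%:R) x.
  rewrite -!abspowD (_ : 2^-1 + k%:R + 2^-1 + (2 * s + 1) = 2 * s + (2 + k%:R)) //.
  by field.
by rewrite mulrA -E; ring.
Qed.

Lemma Om_norm (s : C) : 0 < complex.Re s -> complex.Re `|Om s l%:R| < 1.
Proof.
move=> s0; rewrite Om_siegel_row /siegel_row invrK mulrA -abspowD normrM.
rewrite tau_norm ?(l_neq0 K) // mulr1 /abspow cpow_norm [complex.Re _]/=.
rewrite -expR0 ltr_expR pabs_l pmulr_rlt0.
  by rewrite ln_lt0 // invr_gt0 (lR_gt0 K) (lRV_lt1 K).
have E : 2 * s + (2 + k%:R) = s + s + (k.+2)%:R :> C.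
  by rewrite -addn2 natrD; ring.
rewrite E complex_ReD complex_ReD Re_nat.
by rewrite addr_gt0 ?addr_gt0 // ltr0n.
Qed.

Let chi_uchar : unramified_char siegel_chi.
Proof. by apply: ucharM => //; exact: abspow_uchar. Qed.

Let psi_uchar : unramified_char siegel_psi.
Proof. exact: abspow_uchar. Qed.

Lemma siegel_chi_det (x : K) : siegel_chi x * abspow 2^-1 x = siegel_det x.
Proof.
rewrite /siegel_chi /siegel_det mulrAC -abspowD.
by rewrite (_ : 2^-1 + k%:R + 2^-1 = 1 + k%:R) //; field.
Qed.

Lemma disk_dom (x a b : K) (n : int) : pabs (dom a b) = lR ^ n ->
  (pabs (x * a) <= 1) && (pabs (x * b) <= 1) = (pabs x <= lR ^ (- n)).
Proof.
move=> h; have -> : (pabs x <= lR ^ (- n)) = (pabs x * lR ^ n <= 1).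
  by rewrite -ler_pdivlMr ?(lRX_gt0 K) // div1r invr_expz.
by rewrite -h pabs_dom maxr_pMr ?pabs_ge0 // ge_max -!pabsM.
Qed.

Let Om_l : siegel_chi l%:R / siegel_psi (l%:R : K) * abspow (2 * 0 + 1) (l%:R : K) =
  (siegel_row l%:R)^-1.
Proof.
by rewrite -[LHS]/(Om 0 l%:R) Om_siegel_row mulr0 /abspow cpow_s0 mul1r.
Qed.

Lemma row2_mulmx (x : K) (A : 'M[K]_2) i j : (row2 0 x *m A) i j = x * A 1 j.
Proof.
rewrite mxE !big_ord_recl big_ord0 /row2 !mxE /= mul0r add0r addr0.
by congr (_ * A _ _); apply: val_inj.
Qed.

Lemma siegel_section_sph (g : gl2 K) :
  siegel_section dtx (fourier dx e (@phi_sph l R K)) siegel_chi siegel_psi g =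
  qsec siegel_det siegel_row 0 g.
Proof.
have dne : dom (g 1 0) (g 1 1) != 0 by rewrite dom_neq0 gl2_row1.
have [n hn] := pabs_val dne.
rewrite (@siegel_section_eval _ _ _ _ hdtx _ _ _ chi_uchar psi_uchar Om_norm g 1 0 (- n) 0).
  rewrite Om_l siegel_chi_det /qsec expr0 !mul1r mul0r subr0 opprK.
  by rewrite (uchar_val siegel_row_uchar hn) exprz_inv.
move=> x x0; rewrite (fourier_sph hdx he) !row2_mulmx.
by rewrite (disk_dom x hn) mul0r subr0 mul1r.
Qed.

Lemma siegel_section_lev (t : nat) (g : gl2 K) :
  siegel_section dtx (fourier dx e (@phi_lev l R K t.+1)) siegel_chi siegel_psi g =
  l%:R ^- t.+1 * (qsec siegel_det siegel_row t.+1 g -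
    (siegel_det l%:R)^-1 * qsec siegel_det siegel_row t g).
Proof.
have l0 := l_neq0 K; have lC0 := lC_neq0.
have r0 := uchar_l_neq0 siegel_row_uchar; have d0 := uchar_l_neq0 siegel_det_uchar.
pose y1 := dom (g 1 0) (l%:R ^+ t.+1 * g 1 1).
pose y2 := dom (g 1 0) (l%:R ^+ t * g 1 1).
have y1ne : y1 != 0 by rewrite dom_neq0 row1_lX.
have y2ne : y2 != 0 by rewrite dom_neq0 row1_lX.
have [n1 hn1] := pabs_val y1ne; have [n2 hn2] := pabs_val y2ne.
rewrite (@siegel_section_eval _ _ _ _ hdtx _ _ _ chi_uchar psi_uchar Om_norm g
  (l%:R ^- t.+1) (l%:R ^- t.+1 / l%:R) (- n1) (1 - n2)).
  rewrite Om_l siegel_chi_det /qsec -/y1 -/y2.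
  have E n : (siegel_row l%:R)^-1 ^ (- n) = siegel_row l%:R ^ n.
    by rewrite exprz_inv opprK.
  rewrite !E expfzDr // expr1z.
  rewrite (uchar_val siegel_row_uchar hn1) (uchar_val siegel_row_uchar hn2).
  have -> : l%:R = siegel_det l%:R * siegel_row l%:R by rewrite siegel_detM_row.
  move: (siegel_row l%:R) (siegel_det l%:R) r0 d0 => a b a0 b0.
  move: (a ^ (- n1)) (a ^ (- n2)) ((b * a) ^- t.+1) => u v w.
  by field; rewrite a0 b0.
move=> x x0; rewrite (fourier_lev hdx he) !row2_mulmx.
have e1 : (pabs (x * g 1 1) <= lR ^+ t.+1) = (pabs (x * (l%:R ^+ t.+1 * g 1 1)) <= 1).
  have -> : x * (l%:R ^+ t.+1 * g 1 1) = (x * g 1 1) * l%:R ^+ t.+1 by ring.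
  rewrite [pabs (_ * _ ^+ _)]pabsM pabsX pabs_l exprVn ler_pdivrMr ?mul1r //.
  by rewrite exprn_gt0 // (lR_gt0 K).
have e2 : (pabs (x * g 1 0) <= lR) = (pabs (x * l%:R * g 1 0) <= 1).
  have -> : x * l%:R * g 1 0 = (x * g 1 0) * l%:R by ring.
  by rewrite [pabs (_ * _%:R)]pabsM pabs_l ler_pdivrMr ?mul1r // (lR_gt0 K).
have e3 : (pabs x <= lR ^ (1 - n2)) = (pabs (x * l%:R) <= lR ^ (- n2)).
  rewrite [pabs (_ * _%:R)]pabsM pabs_l ler_pdivrMr ?(lR_gt0 K) // -[X in _ * X]expr1z.
  by rewrite -expfzDr ?(lR_neq0 K) // addrC.
rewrite e3 -(disk_dom x hn1) -(disk_dom (x * l%:R) hn2) e1 e2.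
have -> : x * l%:R * (l%:R ^+ t * g 1 1) = x * (l%:R ^+ t.+1 * g 1 1).
  by rewrite exprS; ring.
move: (l%:R ^- t.+1) (l%:R^-1) => u v.
by case: (_ <= 1); case: (_ <= 1); case: (_ <= 1); rewrite /=; ring.
Qed.

End SiegelValues.

(** * Integral points and the Iwasawa decomposition of GSp_4 *)

Section Matrices4.
Variable K : fieldType.

Definition o0 : 'I_4 := @Ordinal 4 0 isT.
Definition o1 : 'I_4 := @Ordinal 4 1 isT.
Definition o2 : 'I_4 := @Ordinal 4 2 isT.
Definition o3 : 'I_4 := @Ordinal 4 3 isT.

Lemma ord4P (P : 'I_4 -> Prop) : P o0 -> P o1 -> P o2 -> P o3 -> forall i, P i.
Proof.
move=> h0 h1 h2 h3 [[|[|[|[|i]]]] hi] //.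
- by rewrite (_ : Ordinal hi = o0) //; apply: val_inj.
- by rewrite (_ : Ordinal hi = o1) //; apply: val_inj.
- by rewrite (_ : Ordinal hi = o2) //; apply: val_inj.
- by rewrite (_ : Ordinal hi = o3) //; apply: val_inj.
Qed.

Lemma ord44P (P : 'I_4 -> 'I_4 -> Prop) :
  P o0 o0 -> P o0 o1 -> P o0 o2 -> P o0 o3 -> P o1 o0 -> P o1 o1 -> P o1 o2 -> P o1 o3 ->
  P o2 o0 -> P o2 o1 -> P o2 o2 -> P o2 o3 -> P o3 o0 -> P o3 o1 -> P o3 o2 -> P o3 o3 ->
  forall i j, P i j.
Proof.
do 16! move=> ?; move=> i j; move: i j; apply: (@ord4P (fun i => forall j, P i j)); [apply: (@ord4P (P o0))|apply: (@ord4P (P o1))|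
  apply: (@ord4P (P o2))|apply: (@ord4P (P o3))] => //.
Qed.

Lemma sum4 (V : nmodType) (F : 'I_4 -> V) : \sum_i F i = F o0 + F o1 + F o2 + F o3.
Proof.
rewrite !big_ord_recl big_ord0 addr0 !addrA.
by congr (F _ + F _ + F _ + F _); apply: val_inj.
Qed.

Definition m4 (a00 a01 a02 a03 a10 a11 a12 a13 a20 a21 a22 a23 a30 a31 a32 a33 : K) :=
  mx4_of [:: [:: a00; a01; a02; a03]; [:: a10; a11; a12; a13];
             [:: a20; a21; a22; a23]; [:: a30; a31; a32; a33]].

Lemma m4_mul a00 a01 a02 a03 a10 a11 a12 a13 a20 a21 a22 a23 a30 a31 a32 a33
    b00 b01 b02 b03 b10 b11 b12 b13 b20 b21 b22 b23 b30 b31 b32 b33 :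
  m4 a00 a01 a02 a03 a10 a11 a12 a13 a20 a21 a22 a23 a30 a31 a32 a33 *m
  m4 b00 b01 b02 b03 b10 b11 b12 b13 b20 b21 b22 b23 b30 b31 b32 b33 =
  m4 (a00 * b00 + a01 * b10 + a02 * b20 + a03 * b30)
     (a00 * b01 + a01 * b11 + a02 * b21 + a03 * b31)
     (a00 * b02 + a01 * b12 + a02 * b22 + a03 * b32)
     (a00 * b03 + a01 * b13 + a02 * b23 + a03 * b33)
     (a10 * b00 + a11 * b10 + a12 * b20 + a13 * b30)
     (a10 * b01 + a11 * b11 + a12 * b21 + a13 * b31)
     (a10 * b02 + a11 * b12 + a12 * b22 + a13 * b32)
     (a10 * b03 + a11 * b13 + a12 * b23 + a13 * b33)
     (a20 * b00 + a21 * b10 + a22 * b20 + a23 * b30)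
     (a20 * b01 + a21 * b11 + a22 * b21 + a23 * b31)
     (a20 * b02 + a21 * b12 + a22 * b22 + a23 * b32)
     (a20 * b03 + a21 * b13 + a22 * b23 + a23 * b33)
     (a30 * b00 + a31 * b10 + a32 * b20 + a33 * b30)
     (a30 * b01 + a31 * b11 + a32 * b21 + a33 * b31)
     (a30 * b02 + a31 * b12 + a32 * b22 + a33 * b32)
     (a30 * b03 + a31 * b13 + a32 * b23 + a33 * b33).
Proof.
by apply/matrixP; apply: ord4P; apply: ord4P; rewrite mxE sum4 !mxE.
Qed.

Lemma m4_eta (A : 'M[K]_4) : A =
  m4 (A o0 o0) (A o0 o1) (A o0 o2) (A o0 o3) (A o1 o0) (A o1 o1) (A o1 o2) (A o1 o3)
     (A o2 o0) (A o2 o1) (A o2 o2) (A o2 o3) (A o3 o0) (A o3 o1) (A o3 o2) (A o3 o3).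
Proof. by apply/matrixP; apply: ord4P; apply: ord4P; rewrite !mxE. Qed.

Lemma m4_forall (P : K -> Prop) a00 a01 a02 a03 a10 a11 a12 a13 a20 a21 a22 a23 a30 a31 a32 a33 :
  P a00 -> P a01 -> P a02 -> P a03 -> P a10 -> P a11 -> P a12 -> P a13 ->
  P a20 -> P a21 -> P a22 -> P a23 -> P a30 -> P a31 -> P a32 -> P a33 ->
  forall i j, P (m4 a00 a01 a02 a03 a10 a11 a12 a13 a20 a21 a22 a23 a30 a31 a32 a33 i j).
Proof. by do 16! move=> ?; apply: ord44P; rewrite mxE.
Qed.

(* The alternating form u^T J v on columns. *)
Definition jform (A : 'M[K]_4) (i j : 'I_4) : K :=
  A o0 i * A o3 j + A o1 i * A o2 j - A o2 i * A o1 j - A o3 i * A o0 j.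

Lemma jformE (A : 'M[K]_4) i j : (A^T *m Jmx K *m A) i j = jform A i j.
Proof. by rewrite mxE sum4 !mxE !sum4 !mxE /= /jform; ring. Qed.

Lemma Jmx_m4 : Jmx K = m4 0 0 0 1 0 0 1 0 0 (-1) 0 0 (-1) 0 0 0.
Proof. by apply/matrixP; apply: ord4P; apply: ord4P; rewrite !mxE. Qed.

(* Equal to 1 if A is not a symplectic similitude of multiplier m. *)
Definition gs (A : 'M[K]_4) (m : K) : gsp4 K := insubd (1%g : gsp4 K) (A, m).

Lemma gsE (A : 'M[K]_4) (m : K) : is_gsp4 (A, m) ->
  gsp4_mx (gs A m) = A /\ simil (gs A m) = m.
Proof. by move=> h; rewrite /gsp4_mx /simil /gs val_insubd h. Qed.

Lemma gsp4_mxM (g h : gsp4 K) : gsp4_mx (g * h)%g = gsp4_mx g *m gsp4_mx h.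
Proof. by []. Qed.

Lemma similM (g h : gsp4 K) : simil (g * h)%g = simil g * simil h.
Proof. by []. Qed.

Lemma simil_neq0 (g : gsp4 K) : simil g != 0.
Proof. by have [] := gsp4P g. Qed.

Lemma gsp4_unit (g : gsp4 K) : gsp4_mx g \in unitmx.
Proof. by have [] := gsp4P g. Qed.

Lemma gsp4_jform (g : gsp4 K) i j : jform (gsp4_mx g) i j = simil g * Jmx K i j.
Proof. by rewrite -jformE; have [_ _ ->] := gsp4P g; rewrite mxE. Qed.

Lemma gsp4_invE (g : gsp4 K) :
  gsp4_mx g^-1%g = - (simil g)^-1 *: (Jmx K *m (gsp4_mx g)^T *m Jmx K).
Proof.
have [u m0 E] := gsp4P g; rewrite -[LHS]mul1mx.
have -> : 1%:M = - (simil g)^-1 *: (Jmx K *m (gsp4_mx g)^T *m Jmx K) *m gsp4_mx g.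
  rewrite -scalemxAl -!mulmxA (mulmxA _ (Jmx K)) E -scalemxAr Jmx_sqr.
  by rewrite scalerA scalerN mulNr mulVf // scaleN1r opprK.
by rewrite -[LHS]mulmxA -(gsp4_mxM g) mulgV mulmx1.
Qed.

Lemma is_gsp4_jform (A : 'M[K]_4) (m : K) : m != 0 ->
  jform A o0 o3 = m -> jform A o1 o2 = m -> jform A o0 o1 = 0 ->
  jform A o0 o2 = 0 -> jform A o1 o3 = 0 -> jform A o2 o3 = 0 -> is_gsp4 (A, m).
Proof.
move=> m0 h03 h12 h01 h02 h13 h23; apply: is_gsp4_intro => //.
have anti i j : jform A i j = - jform A j i by rewrite /jform; ring.
have diag i : jform A i i = 0 by rewrite /jform; ring.
apply/matrixP => i j; rewrite jformE !mxE; move: i j.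
by apply: ord44P; rewrite /= ?diag ?mulr0 ?mulr1 //; rewrite anti ?h03 ?h12 ?h01 ?h02 ?h13 ?h23 ?mulrN1 ?oppr0.
Qed.

Lemma gsp4_rows (g : gsp4 K) i j :
  let A := gsp4_mx g in
  A i o0 * A j o3 + A i o1 * A j o2 - A i o2 * A j o1 - A i o3 * A j o0
  = simil g * Jmx K i j.
Proof.
move=> A; have := gsp4_mxM g g^-1%g; rewrite mulgV gsp4_invE -/A.
rewrite -scalemxAr => E.
have {}E : A *m Jmx K *m A^T = simil g *: Jmx K.
  have -> : A *m Jmx K *m A^T = - (A *m (Jmx K *m A^T *m Jmx K)) *m Jmx K.
    by rewrite mulNmx -!mulmxA Jmx_sqr !mulmxN mulmx1 opprK.
  have -> : A *m (Jmx K *m A^T *m Jmx K) = - simil g *: 1%:M.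
    rewrite -[1%:M]/(gsp4_mx 1%g) E scalerA mulrNN mulfV ?simil_neq0 //.
    by rewrite scale1r.
  by rewrite scaleNr opprK -scalemxAl mul1mx.
have /matrixP/(_ i j) := E; rewrite mxE sum4 !mxE !sum4 !mxE /= => <-.
by ring.
Qed.

Lemma gsp4_det2 (g : gsp4 K) : \det (gsp4_mx g) ^+ 2 = simil g ^+ 4.
Proof.
have [_ _ /(congr1 determinant)] := gsp4P g.
rewrite !det_mulmx det_tr detZ => E.
have J0 : \det (Jmx K) != 0.
  have := congr1 determinant (Jmx_sqr K); rewrite det_mulmx -scaleN1r detZ det1.
  rewrite mulr1 -signr_odd /= expr0 => h; apply/negP => /eqP h0.
  by move/eqP: h; rewrite h0 mul0r eq_sym oner_eq0.
by apply: (mulfI J0); rewrite [RHS]mulrC -E; rewrite /gsp4_mx; ring.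
Qed.

(* Equal to 1 if the determinants differ. *)
Definition hp (g1 g2 : gl2 K) : hgrp K := insubd (1%g : hgrp K) (g1, g2).

Lemma hpE (g1 g2 : gl2 K) : \det (g1 : 'M[K]_2) = \det (g2 : 'M[K]_2) ->
  hpair (hp g1 g2) = (g1, g2).
Proof. by move=> /eqP h; rewrite val_insubd h. Qed.

Lemma emb_mxE (h : hgrp K) : gsp4_mx (emb h) =
  let g := (h.1 : 'M[K]_2) in let g' := (h.2 : 'M[K]_2) in
  m4 (g 0 0) 0 0 (g 0 1) 0 (g' 0 0) (g' 0 1) 0 0 (g' 1 0) (g' 1 1) 0 (g 1 0) 0 0 (g 1 1).
Proof. by []. Qed.

End Matrices4.

Ltac m4_eq := rewrite /m4;
  congr (mx4_of [:: [:: _; _; _; _]; [:: _; _; _; _]; [:: _; _; _; _]; [:: _; _; _; _]]).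

Section IntegralGroup.
Variables (l : nat) (R : realType) (K : padicFieldType l R).
Local Notation C := R[i].
Local Notation lR := (l%:R : R).
Local Notation G := (gsp4 K).

Definition close_to_one n (A : 'M[K]_n) (r : R) : Prop :=
  forall i j, pabs (A i j - (1%:M : 'M[K]_n) i j) < r.

Lemma conj_close n (M N : 'M[K]_n) (s : R) : 0 < s -> N *m M = 1%:M ->
  exists2 r : R, 0 < r &
    forall k : 'M[K]_n, close_to_one k r -> close_to_one (N *m k *m M) s.
Proof.
move=> s0 NM; pose B : R := 1 + \sum_i \sum_j (pabs (N i j) + pabs (M i j)).
have nn i : 0 <= \sum_j (pabs (N i j) + pabs (M i j)).
  by apply: sumr_ge0 => j _; rewrite addr_ge0 ?pabs_ge0.
have B1 : 1 <= B by rewrite lerDl sumr_ge0.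
have B0 : 0 < B by apply: lt_le_trans B1.
have Bb i j : pabs (N i j) + pabs (M i j) <= B.
  rewrite /B (bigD1 i) //= (bigD1 j) //=.
  have := nn; have h1 : 0 <= \sum_(j0 | j0 != j) (pabs (N i j0) + pabs (M i j0)).
    by apply: sumr_ge0 => *; rewrite addr_ge0 ?pabs_ge0.
  have h2 : 0 <= \sum_(i0 | i0 != i) \sum_j0 (pabs (N i0 j0) + pabs (M i0 j0)).
    by apply: sumr_ge0.
  by lra.
have BN i j : pabs (N i j) <= B by have := Bb i j; have := pabs_ge0 (M i j); lra.
have BM i j : pabs (M i j) <= B by have := Bb i j; have := pabs_ge0 (N i j); lra.
exists (s / 2 / B ^+ 2); first by rewrite !divr_gt0 ?exprn_gt0.
move=> k hk i j.
have -> : (N *m k *m M) i j - (1%:M : 'M[K]_n) i j = (N *m (k - 1%:M) *m M) i j.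
  rewrite mulmxBr mulmx1 mulmxBl NM [RHS]mxE; congr (_ + _); by rewrite [RHS]mxE.
apply: (@le_lt_trans _ _ (s / 2)); last by lra.
have s20 : 0 <= s / 2 by rewrite divr_ge0 // ltW.
rewrite mxE; apply: pabs_sum_le => // a; rewrite mxE pabsM.
have : pabs (\sum_j0 N i j0 * (k - 1%:M) j0 a) <= s / 2 / B.
  apply: pabs_sum_le => [|b]; first by rewrite divr_ge0 // ltW.
  have -> : s / 2 / B = B * (s / 2 / B ^+ 2) by field; rewrite lt0r_neq0.
  apply: pabsM_le; first exact: BN.
  by rewrite !mxE; have := hk b a; rewrite !mxE => /ltW.
move=> h; have -> : s / 2 = s / 2 / B * B by rewrite divfK // lt0r_neq0.
by rewrite ler_pM ?pabs_ge0.
Qed.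

Lemma mx_close_nbhs n (r : R) : 0 < r ->
  nbhs (1%:M : 'M[K]_n) [set A | close_to_one A r].
Proof.
move=> r0; exists (fun i j => [set x | pabs (x - (1%:M : 'M[K]_n) i j) < r]).
  by move=> i j; apply/nbhs_pabs; exists r.
by move=> A hA i j; exact: hA.
Qed.

Lemma gl2_near1 (r : R) : 0 < r ->
  \forall k \near (1%g : gl2 K), close_to_one (gl2_mx k) r.
Proof.
move=> r0; have := @initial_continuous _ _ (fun g : gl2 K => g : 'M[K]_2) (1%g : gl2 K).
by move=> /(_ _ (mx_close_nbhs 2 r0)).
Qed.

Lemma gsp4_near1 (r : R) : 0 < r ->
  \forall k \near (1%g : G), close_to_one (gsp4_mx k) r /\ pabs (simil k - 1) < r.
Proof.
move=> r0; have := @initial_continuous _ _ (fun g : G => g : 'M[K]_4 * K) (1%g : G).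
have h : nbhs ((1%:M, 1) : 'M[K]_4 * K)
    [set p | close_to_one p.1 r /\ pabs (p.2 - 1) < r].
  exists ([set A | close_to_one A r], [set x | pabs (x - 1) < r]) => /=.
    split; first exact: mx_close_nbhs.
    by apply/nbhs_pabs; exists r.
  by move=> [A x] [].
by move=> /(_ _ h).
Qed.

Lemma pabs_det_simil (g : G) : pabs (simil g) = 1 -> pabs (\det (gsp4_mx g)) = 1.
Proof.
move=> h; have := congr1 (@pabs l R K) (gsp4_det2 g).
rewrite !pabsX h expr1n => /eqP; rewrite sqrf_eq1 => /orP[/eqP//|/eqP E].
by have := pabs_ge0 (\det (gsp4_mx g)); rewrite E lerNr oppr0 ler10.
Qed.

Lemma gsp4_intP (g : G) : gsp4_int g <->
  (forall i j, pabs (gsp4_mx g i j) <= 1) /\ pabs (simil g) = 1.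
Proof.
split=> [[? _ ?]//|[h1 h2]]; split=> //; exact: pabs_det_simil.
Qed.

Lemma gsp4_int_near1 (g : G) : close_to_one (gsp4_mx g) 1 ->
  pabs (simil g - 1) < 1 -> gsp4_int g.
Proof.
move=> h1 h2; apply/gsp4_intP; split=> [i j|].
  rewrite -(subrK ((1%:M : 'M[K]_4) i j) (gsp4_mx g i j)).
  by apply: pabsD_le; [exact/ltW/h1|rewrite mxE; case: eqP; rewrite ?pabs1 ?pabs0].
by rewrite -(@pabs1 l R K); apply: pabs_near; rewrite pabs1 pabsBC.
Qed.

Lemma gsp4_int1 : gsp4_int (1%g : G).
Proof.
apply/gsp4_intP; split=> [i j|]; last exact: pabs1.
by rewrite mxE; case: eqP; rewrite ?pabs1 ?pabs0.
Qed.

Lemma gsp4_intM (g h : G) : gsp4_int g -> gsp4_int h -> gsp4_int (g * h)%g.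
Proof.
move=> /gsp4_intP[g1 g2] /gsp4_intP[h1 h2]; apply/gsp4_intP; split=> [i j|].
  rewrite gsp4_mxM mxE; apply: pabs_sum_le => // a; exact: pabsM_le1.
by rewrite similM pabsM g2 h2 mulr1.
Qed.

Lemma Jmx_int i j : pabs (Jmx K i j) <= 1.
Proof.
rewrite mxE; case: (_ == _); last by rewrite pabs0.
by case: (_ < _)%N; rewrite ?pabsN pabs1.
Qed.

Lemma gsp4_intV (g : G) : gsp4_int g -> gsp4_int (g^-1)%g.
Proof.
move=> /gsp4_intP[g1 g2]; apply/gsp4_intP; split=> [i j|]; last first.
  by rewrite /simil /= pabsV g2 invr1.
rewrite gsp4_invE mxE pabsM pabsN pabsV g2 invr1 mul1r mxE.
apply: pabs_sum_le => // a; apply: pabsM_le1 (Jmx_int _ _).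
rewrite mxE; apply: pabs_sum_le => // b; apply: pabsM_le1 (Jmx_int _ _) _.
by rewrite mxE.
Qed.

Definition gl2_int (g : gl2 K) : Prop :=
  (forall i j, pabs (g i j) <= 1) /\ pabs (\det (g : 'M[K]_2)) = 1.

Lemma emb_int (h : hgrp K) : gl2_int h.1 -> gl2_int h.2 -> gsp4_int (emb h).
Proof.
move=> [h1 d1] [h2 d2]; apply/gsp4_intP; split; last exact: d1.
by rewrite emb_mxE; apply: (m4_forall (P := fun x => pabs x <= 1)); rewrite ?pabs0.
Qed.

(* A matrix X with g X = g' is automatically the matrix of g^-1 g', so only its
   integrality has to be checked. *)
Lemma coset_of_mx (g g' : G) (X : 'M[K]_4) : gsp4_mx g *m X = gsp4_mx g' ->
  (forall i j, pabs (X i j) <= 1) -> pabs (simil g) = pabs (simil g') ->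
  gsp4_int (g^-1 * g')%g.
Proof.
move=> E iX es; apply/gsp4_intP; split=> [i j|].
  have -> : gsp4_mx (g^-1 * g')%g = X.
    by rewrite gsp4_mxM -E /gsp4_mx /= mulKmx // gsp4_unit.
  exact: iX.
rewrite similM /simil /= pabsM pabsV -/(simil g) -/(simil g') es mulVf //.
by rewrite pabs_eq0 simil_neq0.
Qed.

Lemma gl2_row_int (c d : K) : (c != 0) || (d != 0) -> exists h : gl2 K,
  [/\ gl2_int h, \det (h : 'M[K]_2) = 1 & c * h 0 0 + d * h 1 0 = 0].
Proof.
move=> cd; have [dc|dc] := leP (pabs c) (pabs d).
  have d0 : d != 0.
    case: (eqVneq d 0) cd dc => // ->; rewrite orbF pabs0 le_eqVlt ltNge pabs_ge0 orbF.
    by rewrite pabs_eq0 => /negbTE ->.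
  have D : 1 * 1 - 0 * (- c / d) = 1 by rewrite mul0r subr0 mulr1.
  exists (gl2_of 1 0 (- c / d) 1); rewrite /gl2_int !gl2_ofE ?D ?oner_eq0 //.
  rewrite det_mx2_of D !mxE /=; split=> //; last by field.
  split; last exact: pabs1.
  move=> i j; rewrite mxE; case: i => [[|[|?]] ?] //; case: j => [[|[|?]] ?] //=;
    rewrite ?pabs0 ?pabs1 // pabsM pabsN pabsV ler_pdivrMr ?pabs_gt0 ?mul1r //.
have c0 : c != 0 by rewrite -pabs_gt0; apply: le_lt_trans dc; exact: pabs_ge0.
have D : (- d / c) * 0 - (-1) * 1 = 1 :> K by rewrite mulr0 sub0r mulN1r opprK.
exists (gl2_of (- d / c) (-1) 1 0); rewrite /gl2_int !gl2_ofE ?D ?oner_eq0 //.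
rewrite det_mx2_of D !mxE /=; split=> //; last by field.
split; last exact: pabs1.
move=> i j; rewrite mxE; case: i => [[|[|?]] ?] //; case: j => [[|[|?]] ?] //=;
  rewrite ?pabs0 ?pabsN ?pabs1 // pabsM pabsN pabsV ler_pdivrMr ?pabs_gt0 ?mul1r // ltW //.
Qed.

Lemma gsp4_bottom_row (g : G) : exists i, gsp4_mx g o3 i != 0.
Proof.
apply/existsP; apply: contraT; rewrite negb_exists => /forallP h.
have := gsp4_rows g o0 o3; rewrite /= mxE /= mulr1.
have z i : gsp4_mx g o3 i = 0 by apply/eqP; have := h i; rewrite negbK.
by rewrite !z !mulr0 !subr0 addr0 => /eqP; rewrite eq_sym (negbTE (simil_neq0 g)).
Qed.

Definition levi_swap : 'M[K]_4 := m4 0 1 0 0 1 0 0 0 0 0 0 1 0 0 1 0.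

Lemma levi_swap_gsp4 : is_gsp4 (levi_swap, 1).
Proof. by apply: is_gsp4_jform; rewrite ?oner_eq0 // /jform !mxE /=; ring. Qed.

Lemma levi_swap_int : gsp4_int (gs levi_swap 1).
Proof.
have [e1 e2] := gsE levi_swap_gsp4; apply/gsp4_intP; rewrite e1 e2 pabs1; split=> //.
rewrite /levi_swap.
by apply: (m4_forall (P := fun x => pabs x <= 1)); rewrite ?pabs0 ?pabs1.
Qed.

Lemma weyl2_int : gl2_int weyl2.
Proof.
rewrite /gl2_int weyl2E det_mx2_of mulr0 mul1r sub0r opprK pabs1; split=> // i j.
by rewrite mxE; case: i => [[|[|?]] ?] //; case: j => [[|[|?]] ?] //=;
  rewrite ?pabs0 ?pabsN ?pabs1.
Qed.

Lemma gl2_int1 : gl2_int 1%g.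
Proof.
split; last by rewrite det1 pabs1.
by move=> i j; rewrite mxE; case: eqP; rewrite ?pabs0 ?pabs1.
Qed.

Lemma bottom_row_permute (g : G) (j : 'I_4) : exists k : G, gsp4_int k /\
  [/\ pabs (gsp4_mx (g * k)%g o3 o3) = pabs (gsp4_mx g o3 j) &
      forall i, exists i', pabs (gsp4_mx (g * k)%g o3 i) = pabs (gsp4_mx g o3 i')].
Proof.
have w1 : \det (weyl2 : 'M[K]_2) = \det ((1%g : gl2 K) : 'M[K]_2).
  by rewrite weyl2E det_mx2_of det1 mulr0 mul1r sub0r opprK.
have [L _] := gsE levi_swap_gsp4.
have e1 : gsp4_mx (emb (hp weyl2 (1%g : gl2 K))) = m4 0 0 0 1 0 1 0 0 0 0 1 0 (-1) 0 0 0.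
  by rewrite emb_mxE /= hpE //= weyl2E !mxE.
have e2 : gsp4_mx (emb (hp (1%g : gl2 K) weyl2)) = m4 1 0 0 0 0 0 1 0 0 (-1) 0 0 0 0 0 1.
  by rewrite emb_mxE /= hpE //= weyl2E !mxE.
have i1 : gsp4_int (emb (hp weyl2 (1%g : gl2 K))).
  by apply: emb_int; rewrite hpE //; [exact: weyl2_int|exact: gl2_int1].
have i2 : gsp4_int (emb (hp (1%g : gl2 K) weyl2)).
  by apply: emb_int; rewrite hpE //; [exact: gl2_int1|exact: weyl2_int].
have il := levi_swap_int.
move: j; apply: ord4P.
- exists (emb (hp weyl2 (1%g : gl2 K))); split=> //; split.
    by rewrite gsp4_mxM e1 mxE sum4 !mxE /= !mulr0 mulr1 !addr0.
  apply: ord4P; rewrite gsp4_mxM e1 mxE sum4 !mxE /= !mulr0 ?mulr1 ?add0r ?addr0.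
  + by exists o3; rewrite mulrN1 pabsN.
  + by exists o1.
  + by exists o2.
  + by exists o0.
- exists (emb (hp (1%g : gl2 K) weyl2) * gs levi_swap 1)%g; split; first exact: gsp4_intM.
  rewrite !gsp4_mxM e2 L /levi_swap m4_mul; split.
    by rewrite mxE sum4 !mxE /= !(mulr0, mul0r, mulr1, mul1r, addr0, add0r).
  apply: ord4P; rewrite mxE sum4 !mxE /= !(mulr0, mul0r, mulr1, mul1r, addr0, add0r).
  + by exists o2; rewrite mulrN1 pabsN.
  + by exists o0.
  + by exists o3.
  + by exists o1.
- exists (gs levi_swap 1); split=> //; rewrite gsp4_mxM L; split.
    by rewrite mxE sum4 !mxE /= !(mulr0, mul0r, mulr1, mul1r, addr0, add0r).
  apply: ord4P; rewrite mxE sum4 !mxE /= !(mulr0, mul0r, mulr1, mul1r, addr0, add0r).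
  + by exists o1.
  + by exists o0.
  + by exists o3.
  + by exists o2.
- exists 1%g; split; first exact: gsp4_int1.
  by rewrite mulg1; split=> // i; exists i.
Qed.

Lemma iwasawa (g : G) : exists2 k : G, gsp4_int k & upper_triangular (gsp4_mx (g * k)%g).
Proof.
pose j := [arg max_(i > o0) pabs (gsp4_mx g o3 i)]%O.
have jmax i : pabs (gsp4_mx g o3 i) <= pabs (gsp4_mx g o3 j).
  by rewrite /j; case: Order.TotalTheory.arg_maxP => // a _; apply.
have [k1 [ik1 [E33 Eperm]]] := bottom_row_permute g j.
set g1 := (g * k1)%g in E33 Eperm.
have max3 i : pabs (gsp4_mx g1 o3 i) <= pabs (gsp4_mx g1 o3 o3).
  by have [i' ->] := Eperm i; rewrite E33 jmax.
pose r (i : 'I_4) : K := gsp4_mx g1 o3 i.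
have r3 : r o3 != 0.
  have [i hi] := gsp4_bottom_row g1; apply: contraNneq hi => h; rewrite -pabs_eq0.
  by have := max3 i; rewrite -/(r o3) h pabs0 le_eqVlt ltNge pabs_ge0 orbF.
pose A2 := m4 1 0 0 0 (r o2 / r o3) 1 0 0 (- r o1 / r o3) 0 1 0
  (- r o0 / r o3) (- r o1 / r o3) (- r o2 / r o3) 1.
have hA2 : is_gsp4 (A2, 1).
  by apply: is_gsp4_jform; rewrite ?oner_eq0 // /jform !mxE /=; ring.
have [e2 s2] := gsE hA2.
have ir i : pabs (r i / r o3) <= 1.
  by rewrite pabsM pabsV ler_pdivrMr ?pabs_gt0 // mul1r max3.
have ik2 : gsp4_int (gs A2 1).
  apply/gsp4_intP; rewrite e2 s2 pabs1; split=> //.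
  by rewrite /A2; apply: (m4_forall (P := fun x => pabs x <= 1)); rewrite ?pabs0 ?pabs1 ?mulNr ?pabsN.
set g2 := (g1 * gs A2 1)%g.
have row3 : [/\ gsp4_mx g2 o3 o0 = 0, gsp4_mx g2 o3 o1 = 0, gsp4_mx g2 o3 o2 = 0 &
    gsp4_mx g2 o3 o3 = r o3].
  have rE i : gsp4_mx g1 o3 i = r i by [].
  rewrite gsp4_mxM e2 (m4_eta (gsp4_mx g1)) /A2 m4_mul !rE.
  by split; rewrite mxE /=; field.
have [z0 z1 z2 z3] := row3; set B := gsp4_mx g2 in z0 z1 z2 z3.
have rows a b : B a o0 * B b o3 + B a o1 * B b o2 - B a o2 * B b o1 - B a o3 * B b o0
    = simil g2 * Jmx K a b by exact: gsp4_rows.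
have B20 : B o2 o0 = 0.
  have := rows o2 o3; rewrite z0 z1 z2 z3 !mulr0 !subr0 addr0 Jmx_m4 [X in _ = _ * X]mxE mulr0.
  by move/eqP; rewrite mulf_eq0 (negbTE r3) orbF => /eqP.
have B10 : B o1 o0 = 0.
  have := rows o1 o3; rewrite z0 z1 z2 z3 !mulr0 !subr0 addr0 Jmx_m4 [X in _ = _ * X]mxE mulr0.
  by move/eqP; rewrite mulf_eq0 (negbTE r3) orbF => /eqP.
have B2 : (B o2 o1 != 0) || (B o2 o2 != 0).
  rewrite -negb_and; apply/negP => /andP[/eqP h1 /eqP h2].
  have := rows o1 o2; rewrite B20 B10 h1 h2 !mulr0 mul0r !subr0 addr0 Jmx_m4 [X in _ = _ * X]mxE mulr1.
  by move=> /eqP; rewrite eq_sym (negbTE (simil_neq0 g2)).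
have [h [ih dh hh]] := gl2_row_int B2.
have dh1 : \det ((1%g : gl2 K) : 'M[K]_2) = \det (h : 'M[K]_2) by rewrite dh det1.
pose k3 := emb (hp (1%g : gl2 K) h).
have ik3 : gsp4_int k3 by apply: emb_int; rewrite hpE //; exact: gl2_int1.
exists (k1 * (gs A2 1 * k3))%g; first by do 2 apply: gsp4_intM => //.
rewrite !mulgA -/g1 -/g2 gsp4_mxM -/B emb_mxE hpE //= => i i'.
move: i i'; rewrite (m4_eta B) z0 z1 z2 B20 B10 m4_mul.
have I10 : (1%:M : 'M[K]_2) 1 0 = 0 by rewrite mxE.
rewrite I10 !(mulr0, mul0r, addr0, add0r) hh.
by apply: ord44P => // _; rewrite mxE.
Qed.

Lemma upper_form (b : G) : upper_triangular (gsp4_mx b) ->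
  exists x p b02 b03 y b12 b13 c q d : K,
  [/\ gsp4_mx b = m4 x p b02 b03 0 y b12 b13 0 0 c q 0 0 0 d,
      simil b = x * d, x * d = y * c, p * d + y * q = 0 &
      b02 * d + b12 * q = c * b13].
Proof.
move=> ub; set A := gsp4_mx b.
exists (A o0 o0), (A o0 o1), (A o0 o2), (A o0 o3), (A o1 o1), (A o1 o2), (A o1 o3),
  (A o2 o2), (A o2 o3), (A o3 o3).
have z : ((A o1 o0 = 0) * (A o2 o0 = 0) * (A o3 o0 = 0)) *
    ((A o2 o1 = 0) * (A o3 o1 = 0) * (A o3 o2 = 0)).
  by do !split; exact: ub.
have J i j := gsp4_jform b i j.
have h03 := J o0 o3; have h12 := J o1 o2; have h13 := J o1 o3; have h23 := J o2 o3.
rewrite /jform -/A !mxE /= in h03 h12 h13 h23.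
split.
- by rewrite [LHS](m4_eta A) !z.
- by rewrite -[LHS]mulr1 -h03 !z; ring.
- by rewrite !z in h03 h12; transitivity (simil b * 1); [rewrite -h03|rewrite -h12]; ring.
- by rewrite !z mulr0 in h13; rewrite -h13; ring.
- by rewrite !z mulr0 in h23; apply/eqP; rewrite -subr_eq0 -h23; apply/eqP; ring.
Qed.

End IntegralGroup.

Section IntegralArith.
Variables (l : nat) (R : realType) (K : padicFieldType l R).
Local Notation lR := (l%:R : R).
Local Notation lK := (l%:R : K).
Implicit Types x y : K.

Lemma int_X x n : pabs x <= 1 -> pabs (x ^+ n) <= 1.
Proof. by move=> h; rewrite pabsX exprn_ile1 ?pabs_ge0. Qed.

Lemma int_N x : pabs x <= 1 -> pabs (- x) <= 1.
Proof. by rewrite pabsN. Qed.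

Lemma int_V x : pabs x = 1 -> pabs x^-1 <= 1.
Proof. by move=> h; rewrite pabsV h invr1. Qed.

Lemma int_unit x : pabs x = 1 -> pabs x <= 1.
Proof. by move->. Qed.

Lemma int_0 : pabs (0 : K) <= 1. Proof. by rewrite pabs0. Qed.
Lemma int_1 : pabs (1 : K) <= 1. Proof. by rewrite pabs1. Qed.

Lemma unit_neq0 x : pabs x = 1 -> x != 0.
Proof. by move=> h; rewrite -pabs_gt0 h. Qed.

Lemma pabs_lexp n : pabs (lK ^+ n) = lR ^- n.
Proof. by rewrite pabsX pabs_l exprVn. Qed.

Lemma pabs_lexp_gt0 n : 0 < lR ^- n.
Proof. by rewrite invr_gt0 exprn_gt0 // (lR_gt0 K). Qed.

Lemma pabs_divl n x : pabs x <= lR ^- n -> exists2 x', pabs x' <= 1 & x = lK ^+ n * x'.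
Proof.
move=> h; have ln0 : lK ^+ n != 0 by rewrite expf_neq0 // l_neq0.
exists (x / lK ^+ n); last by rewrite mulrC divfK.
by rewrite pabsM pabsV pabs_lexp ler_pdivrMr ?pabs_lexp_gt0 // mul1r.
Qed.

Lemma pabs_divl1 x : pabs x <= lR^-1 -> exists2 x', pabs x' <= 1 & x = lK * x'.
Proof. by move=> h; have := @pabs_divl 1 x; rewrite !expr1; apply. Qed.

Lemma residue_ord k x : pabs x <= 1 ->
  exists (i : 'I_(l ^ k)) (x' : K), pabs x' <= 1 /\ x = i%:R + lK ^+ k * x'.
Proof.
move=> /(pabs_residue k)[n nk /pabs_divl[x' x'1 E]].
by exists (Ordinal nk), x'; split=> //=; rewrite -E addrC subrK.
Qed.

Lemma residue_ord1 x : pabs x <= 1 ->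
  exists (i : 'I_l) (x' : K), pabs x' <= 1 /\ x = i%:R + lK * x'.
Proof.
move=> /pabs_residue1[n nk /pabs_divl1[x' x'1 E]].
by exists (Ordinal nk), x'; split=> //=; rewrite -E addrC subrK.
Qed.

Lemma ord_of_lK k (i j : 'I_(l ^ k)) x :
  lK ^+ k * x + i%:R = j%:R -> pabs x <= 1 -> i = j.
Proof.
move=> E x1; apply: val_inj; apply: (@pabs_ord_eq l R K k) => //=.
rewrite -E opprD addrCA subrr addr0 pabsN pabsM pabs_lexp.
by rewrite ler_piMr // ltW // pabs_lexp_gt0.
Qed.

Lemma ord_of_lK1 (i j : 'I_l) x : lK * x + i%:R = j%:R -> pabs x <= 1 -> i = j.
Proof.
move=> E x1; apply: val_inj; apply: (@pabs_ord_eq l R K 1); rewrite ?expn1 //= expr1.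
rewrite -E opprD addrCA subrr addr0 pabsN pabsM pabs_l.
by rewrite ler_piMr // invr_ge0 ler0n.
Qed.

Lemma unit_or_div x : pabs x <= 1 -> pabs x = 1 \/ exists2 x', pabs x' <= 1 & x = lK * x'.
Proof.
rewrite le_eqVlt => /orP[/eqP->|]; first by left.
by rewrite pabs_lt1 => /pabs_divl1; right.
Qed.

Lemma pabs_lK_eq1 x : pabs x <= 1 -> pabs (lK * x) <> 1.
Proof.
move=> x1 h; have : pabs (lK * x) < 1; last by rewrite h ltxx.
by rewrite pabs_lt1 pabsM pabs_l ler_piMr // invr_ge0 ler0n.
Qed.

Lemma unit_of_mul x y : pabs x <= 1 -> pabs y <= 1 -> pabs (x * y) = 1 ->
  pabs x = 1 /\ pabs y = 1.
Proof.
rewrite pabsM => x1 y1 xy; have := pabs_ge0 x; have := pabs_ge0 y => *.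
by split; nra.
Qed.

Lemma residue_unit k c x : pabs c = 1 -> pabs x <= 1 ->
  exists (i : 'I_(l ^ k)) (t : K), pabs t <= 1 /\ x = c * (i%:R + lK ^+ k * t).
Proof.
move=> c1 x1; have xc : pabs (x / c) <= 1 by rewrite pabsM pabsV c1 invr1 mulr1.
have [i [t [t1 E]]] := residue_ord k xc; exists i, t; split=> //.
by rewrite -E mulrC divfK // unit_neq0.
Qed.

Lemma residue_unit1 c x : pabs c = 1 -> pabs x <= 1 ->
  exists (i : 'I_l) (t : K), pabs t <= 1 /\ x = c * (i%:R + lK * t).
Proof.
move=> c1 x1; have xc : pabs (x / c) <= 1 by rewrite pabsM pabsV c1 invr1 mulr1.
have [i [t [t1 E]]] := residue_ord1 xc; exists i, t; split=> //.
by rewrite -E mulrC divfK // unit_neq0.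
Qed.

End IntegralArith.

Ltac intg := repeat first
  [ assumption | exact: int_0 | exact: int_1 | exact: pabs_nat_le1
  | apply: pabsM_le1 | apply: pabsD_le | apply: int_N | apply: int_X
  | (apply: int_V; assumption) | (apply: int_unit; assumption) ].

Section UpperTriangular.
Variable K : fieldType.

Definition upm (x p b02 b03 y b12 b13 c q d : K) : 'M[K]_4 :=
  m4 x p b02 b03 0 y b12 b13 0 0 c q 0 0 0 d.

Lemma upm_gsp4 x p b02 b03 y b12 b13 c q d m : m != 0 -> x * d = m -> y * c = m ->
  p * d + y * q = 0 -> b02 * d + b12 * q = c * b13 ->
  is_gsp4 (upm x p b02 b03 y b12 b13 c q d, m).
Proof.
move=> m0 xd yc pq bq.
apply: is_gsp4_jform; rewrite // /jform !mxE /=; rewrite ?(mulr0, mul0r, subr0, addr0) //; try ring.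
- by rewrite add0r.
- by rewrite bq subrr.
Qed.

Lemma upm_upper x p b02 b03 y b12 b13 c q d (i j : 'I_4) :
  (j < i)%N -> upm x p b02 b03 y b12 b13 c q d i j = 0.
Proof. by move: i j; apply: ord44P => // _; rewrite mxE. Qed.

Lemma upm_mul x p b02 b03 y b12 b13 c q d x' p' b02' b03' y' b12' b13' c' q' d' :
  upm x p b02 b03 y b12 b13 c q d *m upm x' p' b02' b03' y' b12' b13' c' q' d' =
  upm (x * x') (x * p' + p * y') (x * b02' + p * b12' + b02 * c')
      (x * b03' + p * b13' + b02 * q' + b03 * d') (y * y') (y * b12' + b12 * c')
      (y * b13' + b12 * q' + b13 * d') (c * c') (c * q' + q * d') (d * d').
Proof. by rewrite /upm m4_mul; m4_eq; ring. Qed.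

End UpperTriangular.

Section UpperCosets.
Variables (l : nat) (R : realType) (K : padicFieldType l R).
Local Notation G := (gsp4 K).

Lemma upm_int x p b02 b03 y b12 b13 c q d : pabs x <= 1 -> pabs p <= 1 ->
  pabs b02 <= 1 -> pabs b03 <= 1 -> pabs y <= 1 -> pabs b12 <= 1 ->
  pabs b13 <= 1 -> pabs c <= 1 -> pabs q <= 1 -> pabs d <= 1 ->
  forall i j, pabs (upm x p b02 b03 y b12 b13 c q d i j : K) <= 1.
Proof.
move=> *; rewrite /upm; apply: (m4_forall (P := fun x => pabs x <= 1)) => //;
exact: int_0.
Qed.

Lemma coset_mx (g g' : G) : gsp4_int (g^-1 * g')%g -> exists2 X : 'M[K]_4,
  (forall i j, pabs (X i j) <= 1) & gsp4_mx g *m X = gsp4_mx g'.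
Proof.
move=> /gsp4_intP[iX _]; exists (gsp4_mx (g^-1 * g')%g) => //.
by rewrite -gsp4_mxM mulgA mulgV mul1g.
Qed.

Lemma upm_coset_le (g g' : G) x p b02 b03 y b12 b13 c q d
    x' p' b02' b03' y' b12' b13' c' q' d' :
  gsp4_mx g = upm x p b02 b03 y b12 b13 c q d ->
  gsp4_mx g' = upm x' p' b02' b03' y' b12' b13' c' q' d' ->
  d != 0 -> gsp4_int (g^-1 * g')%g -> pabs c' <= pabs c /\ pabs d' <= pabs d.
Proof.
move=> E E' d0 /coset_mx[X iX]; rewrite E E' (m4_eta X) /upm m4_mul => /matrixP H.
have := H o3 o3; have := H o3 o2; have := H o2 o2; rewrite !mxE /= !mul0r !add0r.
move=> h22 /eqP; rewrite mulf_eq0 (negbTE d0) /= => /eqP h32 h33.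
rewrite -h22 -h33 h32 mulr0 addr0 !pabsM.
by split; rewrite ler_piMr ?pabs_ge0.
Qed.

Lemma upm_coset_diag (g g' : G) x p b02 b03 y b12 b13 c q d
    x' p' b02' b03' y' b12' b13' c' q' d' :
  gsp4_mx g = upm x p b02 b03 y b12 b13 c q d ->
  gsp4_mx g' = upm x' p' b02' b03' y' b12' b13' c' q' d' ->
  d != 0 -> d' != 0 -> gsp4_int (g^-1 * g')%g -> pabs c = pabs c' /\ pabs d = pabs d'.
Proof.
move=> E E' d0 d0' h; have [h1 h2] := upm_coset_le E E' d0 h.
have h' : gsp4_int (g'^-1 * g)%g by have := gsp4_intV h; rewrite invgM invgK.
have [h3 h4] := upm_coset_le E' E d0' h'.
by split; apply/le_anti; rewrite ?h1 ?h2 ?h3 ?h4.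
Qed.

Lemma upm_coset_eq (g g' : G) x p b02 b03 y b12 b13 c q d p' b02' b03' b12' b13' q' :
  gsp4_mx g = upm x p b02 b03 y b12 b13 c q d ->
  gsp4_mx g' = upm x p' b02' b03' y b12' b13' c q' d ->
  [&& x != 0, y != 0, c != 0 & d != 0] -> gsp4_int (g^-1 * g')%g ->
  exists X01 X02 X03 X12 X13 X23 : K,
  [/\ [/\ pabs X01 <= 1, pabs X02 <= 1, pabs X03 <= 1, pabs X12 <= 1 &
          pabs X13 <= 1 /\ pabs X23 <= 1],
      x * X01 + p = p', x * X02 + p * X12 + b02 = b02',
      x * X03 + p * X13 + b02 * X23 + b03 = b03' &
      [/\ y * X12 + b12 = b12', y * X13 + b12 * X23 + b13 = b13' & c * X23 + q = q']].
Proof.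
move=> E E' /and4P[x0 y0 c0 d0] /coset_mx[X iX]; rewrite E E' (m4_eta X) /upm m4_mul.
move=> /matrixP H.
have := H o3 o3; have := H o3 o2; have := H o3 o1; rewrite !mxE /= !mul0r !add0r.
move=> /eqP; rewrite mulf_eq0 (negbTE d0) /= => /eqP h31.
move=> /eqP; rewrite mulf_eq0 (negbTE d0) /= => /eqP h32.
rewrite -[RHS]mulr1 => /(mulfI d0) h33.
have := H o2 o3; have := H o2 o2; have := H o2 o1.
rewrite !mxE /= !mul0r !add0r h31 h32 h33 !mulr0 !addr0 mulr1.
move=> /eqP; rewrite mulf_eq0 (negbTE c0) /= => /eqP h21.
rewrite -[RHS]mulr1 => /(mulfI c0) h22 h23.
have := H o1 o3; have := H o1 o2; have := H o1 o1.
rewrite !mxE /= !mul0r !add0r h31 h32 h33 h21 h22 !mulr0 !addr0 !mulr1.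
rewrite -[RHS]mulr1 => /(mulfI y0) h11 h12 h13.
have := H o0 o3; have := H o0 o2; have := H o0 o1.
rewrite !mxE /= h31 h32 h33 h21 h22 h11 !mulr0 !addr0 !mulr1 => h01 h02 h03.
by exists (X o0 o1), (X o0 o2), (X o0 o3), (X o1 o2), (X o1 o3), (X o2 o3); split.
Qed.

Lemma upper_solved (b : G) : upper_triangular (gsp4_mx b) ->
  exists x p b02 b03 y b12 b13 c q d : K,
  [/\ gsp4_mx b = upm x p b02 b03 y b12 b13 c q d,
      x * d = simil b /\ y * c = simil b,
      [&& x != 0, y != 0, c != 0 & d != 0],
      p = - (y * q) / d /\ q = - (p * d) / y &
      b13 = (b02 * d + b12 * q) / c /\ b02 = (c * b13 - b12 * q) / d].
Proof.
move=> ub; have [x [p [b02 [b03 [y [b12 [b13 [c [q [d [E sE xd pq bq]]]]]]]]]]] := upper_form ub.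
have s0 := simil_neq0 b; have s0' := s0; rewrite {1}sE mulf_eq0 negb_or in s0.
rewrite sE xd mulf_eq0 negb_or in s0'; case/andP: s0 => x0 d0; case/andP: s0' => y0 c0.
exists x, p, b02, b03, y, b12, b13, c, q, d; split=> //.
- by rewrite sE -xd.
- by apply/and4P.
- split; first by apply: (mulIf d0); rewrite divfK //; apply/eqP; rewrite -addr_eq0 pq.
  by apply: (mulIf y0); rewrite divfK // mulrC; apply/eqP; rewrite -addr_eq0 addrC pq.
- by split; [rewrite bq mulrC mulKf|rewrite -bq addrK mulfK].
Qed.

End UpperCosets.

(** * Hecke operators *)

Section HeckeOperators.
Variables (l : nat) (R : realType) (K : padicFieldType l R).
Local Notation C := R[i].
Local Notation G := (gsp4 K).
Variables (nu1 nu2 rho : K -> C) (phi0 : G -> C).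
Hypothesis hphi0 : principal_series nu1 nu2 rho phi0.
Hypothesis phi0_neq0 : phi0 <> (fun=> 0).
Hypothesis phi0_inv : forall k, gsp4_int k -> rtrans k phi0 = phi0.

Lemma phi0K (g k : G) : gsp4_int k -> phi0 (g * k)%g = phi0 g.
Proof. by move=> /phi0_inv/(congr1 (fun f => f g)). Qed.

Lemma phi0_coset (g g' : G) : gsp4_int (g^-1 * g')%g -> forall x, phi0 (x * g')%g = phi0 (x * g)%g.
Proof. by move=> h x; rewrite -(phi0K (x * g)%g h) -!mulgA mulVKg. Qed.

Definition ps_char (x y z : K) : C :=
  abspow 1 (x ^+ 2 * y) * abspow (- (3 / 2)) z * nu1 x * nu2 y * rho z.

Lemma phi0_borel (b g : G) x p b02 b03 y b12 b13 c q d :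
  gsp4_mx b = upm x p b02 b03 y b12 b13 c q d -> x * d = simil b -> y * c = simil b ->
  phi0 (b * g)%g = ps_char x y (simil b) * phi0 g.
Proof.
move=> E xd yc; have s0 := simil_neq0 b.
have [x0 y0] : x != 0 /\ y != 0.
  by split; [move: s0; rewrite -xd|move: s0; rewrite -yc]; rewrite mulf_eq0 negb_or => /andP[].
case: hphi0 => _; apply.
  by move=> i j; rewrite E; apply: upm_upper.
rewrite E; apply: ord4P; rewrite mxE //=.
- by rewrite -yc mulrC mulKf.
- by rewrite -xd mulrC mulKf.
Qed.

Lemma phi0_at1 : phi0 1%g != 0.
Proof.
apply/negP => /eqP h; apply: phi0_neq0; apply: funext => g.
have [k ik ub] := iwasawa g.
have [x [p [b02 [b03 [y [b12 [b13 [c [q [d [E sE xdyc _ _]]]]]]]]]]] := upper_form ub.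
have -> : g = (g * k * k^-1)%g by rewrite mulgK.
rewrite (phi0_borel k^-1%g E) -?xdyc //.
by rewrite -(mul1g k^-1%g) phi0K ?h ?mulr0 //; exact: gsp4_intV.
Qed.

(* Left multiplication by GSp_4(Z_l) permutes the cosets of the representatives, so the
   sum is again spherical, hence proportional to phi0 by the Iwasawa decomposition. *)
Lemma hecke_eigen (I : finType) (g : I -> G) (S : set G) :
  (forall i, S (g i)) ->
  (forall k s, gsp4_int k -> S s -> S (k * s)%g) ->
  (forall k s, gsp4_int k -> S s -> S (s * k)%g) ->
  (forall b, S b -> upper_triangular (gsp4_mx b) -> exists i, gsp4_int ((g i)^-1 * b)%g) ->
  (forall i j, gsp4_int ((g i)^-1 * g j)%g -> i = j) ->
  forall x, \sum_i phi0 (x * g i)%g = (\sum_i phi0 (g i)) / phi0 1%g * phi0 x.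
Proof.
move=> Sg SKl SKr Sred Sinj.
have Sred' s : S s -> exists i, gsp4_int ((g i)^-1 * s)%g.
  move=> Ss; have [k ik ub] := iwasawa s.
  have [i hi] := Sred _ (SKr _ _ ik Ss) ub; exists i.
  by rewrite -(mulgK k s) mulgA; apply: gsp4_intM => //; exact: gsp4_intV.
pose psi x := \sum_i phi0 (x * g i)%g.
have psiK x k : gsp4_int k -> psi (x * k)%g = psi x.
  move=> ik; have H i : {j | gsp4_int ((g j)^-1 * (k * g i))%g}.
    by apply: cid; apply: Sred'; exact: SKl.
  pose f i := sval (H i); have hf i : gsp4_int ((g (f i))^-1 * (k * g i))%g by exact: svalP (H i).
  have f_inj : injective f.
    move=> i j fij; apply: Sinj; have := gsp4_intM (gsp4_intV (hf i)) (hf j).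
    by rewrite fij !invgM invgK !mulgA mulgK mulgVK.
  rewrite /psi [RHS](reindex_inj f_inj) /=; apply: eq_bigr => i _.
  by rewrite -(phi0_coset (hf i)) mulgA.
move=> x; rewrite -/(psi x).
have [k ik ub] := iwasawa x.
have [a [p [b02 [b03 [y [b12 [b13 [c [q [d [E sE xdyc _ _]]]]]]]]]]] := upper_form ub.
have -> : x = (x * k * k^-1)%g by rewrite mulgK.
have step v : phi0 (x * k * v)%g = ps_char a y (simil (x * k)%g) * phi0 v.
  by apply: (phi0_borel v E); rewrite -?xdyc.
rewrite step /psi; under eq_bigr do rewrite -mulgA step.
rewrite -mulr_sumr -/(psi k^-1%g) -(mul1g k^-1%g) psiK; last exact: gsp4_intV.
rewrite phi0K; last exact: gsp4_intV.
rewrite /psi; under eq_bigr do rewrite mul1g.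
by rewrite mulrCA divfK // phi0_at1.
Qed.

End HeckeOperators.

Section HeckeT.
Variables (l : nat) (R : realType) (K : padicFieldType l R).
Local Notation C := R[i].
Local Notation G := (gsp4 K).
Local Notation lR := (l%:R : R).
Local Notation lK := (l%:R : K).

Definition T_idx := (('I_l * 'I_l * 'I_l + 'I_l * 'I_l) + ('I_l + unit))%type.

(* Representatives of K diag(1,1,l,l) K / K, with K = GSp_4(Z_l). *)
Definition T_mx (i : T_idx) : 'M[K]_4 :=
  match i with
  | inl (inl (u, v, w)) => upm lK 0 u%:R v%:R lK w%:R u%:R 1 0 1
  | inl (inr (p, v)) => upm lK p%:R 0 v%:R 1 0 0 lK (- p%:R) 1
  | inr (inl w) => upm 1 0 0 0 lK w%:R 0 1 0 lK
  | inr (inr _) => upm 1 0 0 0 1 0 0 lK 0 lK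
  end.

Definition T_rep (i : T_idx) : G := gs (T_mx i) lK.

Lemma T_repE i : gsp4_mx (T_rep i) = T_mx i /\ simil (T_rep i) = lK.
Proof.
apply: gsE; case: i => [[[[u v] w]|[p v]]|[w|[]]] /=;
  by apply: upm_gsp4; rewrite ?(l_neq0 K) //; ring.
Qed.

Definition T_set : set G := [set s |
  (forall i j, pabs (gsp4_mx s i j) <= 1) /\ pabs (simil s) = lR^-1].

Lemma T_set_rep i : T_set (T_rep i).
Proof.
rewrite /T_set /=; have [-> ->] := T_repE i; split; last exact: pabs_l.
case: i => [[[[u v] w]|[p v]]|[w|[]]] /=; by apply: upm_int; intg.
Qed.

Lemma T_set_Kl k s : gsp4_int k -> T_set s -> T_set (k * s)%g.
Proof.
move=> /gsp4_intP[k1 k2] [s1 s2]; split; last by rewrite similM pabsM k2 mul1r.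
by move=> i j; rewrite gsp4_mxM mxE; apply: pabs_sum_le => // a; exact: pabsM_le1.
Qed.

Lemma T_set_Kr k s : gsp4_int k -> T_set s -> T_set (s * k)%g.
Proof.
move=> /gsp4_intP[k1 k2] [s1 s2]; split; last by rewrite similM pabsM k2 mulr1.
by move=> i j; rewrite gsp4_mxM mxE; apply: pabs_sum_le => // a; exact: pabsM_le1.
Qed.

Lemma T_reduce b : T_set b -> upper_triangular (gsp4_mx b) ->
  exists i, gsp4_int ((T_rep i)^-1 * b)%g.
Proof.
move=> [ib sb] /upper_solved[x [p [b02 [b03 [y [b12 [b13 [c [q [d]]]]]]]]]].
move=> [E [xd yc] /and4P[x0 y0 c0 d0] [Ep Eq] [E13 E02]].
have [ix ip] : pabs x <= 1 /\ pabs p <= 1.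
  by split; [have := ib o0 o0|have := ib o0 o1]; rewrite E mxE.
have [i02 i03] : pabs b02 <= 1 /\ pabs b03 <= 1.
  by split; [have := ib o0 o2|have := ib o0 o3]; rewrite E mxE.
have [iy i12] : pabs y <= 1 /\ pabs b12 <= 1.
  by split; [have := ib o1 o1|have := ib o1 o2]; rewrite E mxE.
have [i13 ic] : pabs b13 <= 1 /\ pabs c <= 1.
  by split; [have := ib o1 o3|have := ib o2 o2]; rewrite E mxE.
have [iq id] : pabs q <= 1 /\ pabs d <= 1.
  by split; [have := ib o2 o3|have := ib o3 o3]; rewrite E mxE.
have axd : pabs x * pabs d = lR^-1 by rewrite -pabsM xd.
have ayc : pabs y * pabs c = lR^-1 by rewrite -pabsM yc.
have unitl (a a' : K) : pabs a <= 1 -> pabs a' <= 1 -> pabs a * pabs (lK * a') = lR^-1 ->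
    pabs a = 1 /\ pabs a' = 1.
  move=> a1 a1' h; apply: unit_of_mul => //; rewrite pabsM.
  by apply: (mulfI (x := lR^-1)); rewrite ?invr_neq0 ?(lR_neq0 K) // mulr1 -{2}h pabsM pabs_l; ring.
have divl (a a' : K) : pabs a * pabs a' = lR^-1 -> pabs a' = 1 ->
    exists2 a1, pabs a1 <= 1 & a = lK * a1.
  by move=> h h'; apply: pabs_divl1; rewrite h' mulr1 in h; rewrite h.
have done i X : gsp4_mx (T_rep i) *m X = gsp4_mx b -> (forall i j, pabs (X i j) <= 1) ->
    exists i, gsp4_int ((T_rep i)^-1 * b)%g.
  move=> h iX; exists i; apply: coset_of_mx h iX _.
  by have [_ ->] := T_repE i; rewrite sb pabs_l.
have [uc|[c' ic' Ec]] := unit_or_div ic; have [ud|[d' id' Ed]] := unit_or_div id.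
- have [x' ix' Ex] := divl _ _ axd ud; have [y' iy' Ey] := divl _ _ ayc uc.
  have [u [t1 [it1 Eu]]] := residue_unit1 uc i02.
  have [w [t2 [it2 Ew]]] := residue_unit1 uc i12.
  have iv : pabs (b03 - u%:R * q) <= 1 by intg.
  have [v [t3 [it3 Ev]]] := residue_unit1 ud iv.
  apply: (done (inl (inl (u, v, w)))
    (upm x' (- (y' * q) / d) (c * t1) (d * t3) y' (c * t2) (t1 * d + t2 * q) c q d)).
    have [-> _] := T_repE (inl (inl (u, v, w))); rewrite E upm_mul.
    have -> : b03 = u%:R * q + d * (v%:R + lK * t3) by rewrite -Ev; ring.
    rewrite E13 Ep Ex Ey Eu Ew; congr upm; try ring.
    by field.
  by apply: upm_int; intg.
- have [ux ud'] : pabs x = 1 /\ pabs d' = 1 by apply: unitl; rewrite -?Ed.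
  have [y' iy' Ey] := divl _ _ ayc uc.
  have d0' := unit_neq0 ud'.
  have [w [t1 [it1 Ew]]] := residue_unit1 uc i12.
  apply: (done (inr (inl w))
    (upm x p b02 b03 y' (c * t1) (b02 * d' / c + t1 * q) c q d')).
    have [-> _] := T_repE (inr (inl w)); rewrite E upm_mul.
    rewrite E13 Ey Ew Ed; congr upm; try ring.
    by field.
  by apply: upm_int; intg.
- have [uy uc'] : pabs y = 1 /\ pabs c' = 1 by apply: unitl; rewrite -?Ec.
  have [x' ix' Ex] := divl _ _ axd ud.
  have [P [t1 [it1 EP]]] := residue_unit1 uy ip.
  have iv : pabs (b03 - P%:R * b13) <= 1 by intg.
  have [v [t3 [it3 Ev]]] := residue_unit1 ud iv.
  apply: (done (inl (inr (P, v)))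
    (upm x' (y * t1) (b12 * t1 + c' * b13 / d) (d * t3) y b12 b13 c' (- t1 * d) d)).
    have [-> _] := T_repE (inl (inr (P, v))); rewrite E upm_mul.
    have -> : b03 = P%:R * b13 + d * (v%:R + lK * t3) by rewrite -Ev; ring.
    rewrite E02 Eq EP Ex Ec; congr upm; try ring; by field; rewrite ?y0 ?d0.
  by apply: upm_int; intg.
have [ux ud'] : pabs x = 1 /\ pabs d' = 1 by apply: unitl; rewrite -?Ed.
have [uy uc'] : pabs y = 1 /\ pabs c' = 1 by apply: unitl; rewrite -?Ec.
apply: (done (inr (inr tt)) (upm x p b02 b03 y b12 b13 c' (- (p * d') / y) d')).
  have [-> _] := T_repE (inr (inr tt)); rewrite E upm_mul.
  rewrite Eq Ec Ed; congr upm; try ring.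
by apply: upm_int; intg.
Qed.

Lemma l1_absurd : pabs lK = pabs (1 : K) -> False.
Proof. by rewrite pabs_l pabs1 => h; have := lRV_lt1 K; rewrite h ltxx. Qed.

Lemma T_inj i j : gsp4_int ((T_rep i)^-1 * T_rep j)%g -> i = j.
Proof.
have [Ei _] := T_repE i; have [Ej _] := T_repE j.
have l0 := l_neq0 K; have n1 := oner_neq0 K.
move: Ei Ej; case: i => [[[[u v] w]|[p v]]|[w|[]]]; case: j => [[[[u' v'] w']|[p' v']]|[w'|[]]];
  move=> /= Ei Ej h; have [] := upm_coset_diag Ei Ej _ _ h; rewrite ?l0 ?n1 //;
  try (by move=> A B; exfalso; first [exact: l1_absurd A|exact: l1_absurd B|
    exact: l1_absurd (esym A)|exact: l1_absurd (esym B)]); move=> _ _.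
- have [X01 [X02 [X03 [X12 [X13 [X23]]]]]] := upm_coset_eq Ei Ej ltac:(by rewrite l0 n1) h.
  move=> [[i01 i02 i03 i12 [i13 i23]] _ e02 e03 [e12 e13 e23]].
  rewrite !addr0 mul1r in e23; subst X23; rewrite !mul0r !mulr0 !addr0 in e02 e03.
  by rewrite (ord_of_lK1 e02 i02) (ord_of_lK1 e03 i03) (ord_of_lK1 e12 i12).
- have [X01 [X02 [X03 [X12 [X13 [X23]]]]]] := upm_coset_eq Ei Ej ltac:(by rewrite l0 n1) h.
  move=> [[i01 i02 i03 i12 [i13 i23]] e01 e02 e03 [e12 e13 e23]].
  rewrite !mul1r !mul0r !addr0 in e12 e13; subst X12 X13.
  rewrite !mul0r !mulr0 !addr0 in e03.
  by rewrite (ord_of_lK1 e01 i01) (ord_of_lK1 e03 i03).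
- have [X01 [X02 [X03 [X12 [X13 [X23]]]]]] := upm_coset_eq Ei Ej ltac:(by rewrite l0 n1) h.
  move=> [[i01 i02 i03 i12 [i13 i23]] e01 e02 e03 [e12 e13 e23]].
  by rewrite (ord_of_lK1 e12 i12).
Qed.

Section Eigenvalue.
Variables (nu1 nu2 rho : K -> C) (phi0 : G -> C).
Hypotheses (unu1 : unramified_char nu1) (unu2 : unramified_char nu2)
  (urho : unramified_char rho).
Hypothesis hphi0 : principal_series nu1 nu2 rho phi0.
Hypothesis phi0_neq0 : phi0 <> (fun=> 0).
Hypothesis phi0_inv : forall k, gsp4_int k -> rtrans k phi0 = phi0.

Definition sqrtl : C := cpow lR 2^-1.

Lemma sqrtl2 : sqrtl ^+ 2 = l%:R.
Proof.
rewrite expr2 -cpowD; have -> : 2^-1 + 2^-1 = 1 :> C by field; rewrite ?pnatr_eq0.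
by rewrite cpow_s1 ?(lR_gt0 K) // rmorph_nat.
Qed.

Lemma ps_char_lX (a b c : nat) : ps_char nu1 nu2 rho (lK ^+ a) (lK ^+ b) (lK ^+ c) =
  l%:R ^- (2 * a + b) * (l%:R * sqrtl) ^+ c * nu1 l%:R ^+ a * nu2 l%:R ^+ b * rho l%:R ^+ c.
Proof.
have vX chi n : unramified_char chi -> chi (lK ^+ n) = chi l%:R ^+ n.
  by move=> hchi; have := uchar_lX hchi n%:Z.
rewrite /ps_char (vX _ _ unu1) (vX _ _ unu2) (vX _ _ urho); congr (_ * _ * _ * _ * _).
  rewrite -exprM -exprD mulnC vX; last exact: abspow_uchar.
  by rewrite (abspow_l K 1) expr1 exprVn.
rewrite vX; last exact: abspow_uchar.
congr (_ ^+ _); rewrite /abspow pabs_l cpowV ?(lR_gt0 K) // cpowN invrK.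
have -> : 3 / 2 = 1 + 2^-1 :> C by field; rewrite ?pnatr_eq0.
by rewrite cpowD cpow_s1 ?(lR_gt0 K) // rmorph_nat.
Qed.

Lemma phi0_upm (g : G) x p b02 b03 y b12 b13 c q d :
  gsp4_mx g = upm x p b02 b03 y b12 b13 c q d -> x * d = simil g -> y * c = simil g ->
  phi0 g = ps_char nu1 nu2 rho x y (simil g) * phi0 1%g.
Proof. by move=> E xd yc; rewrite -(phi0_borel hphi0 1%g E) // mulg1. Qed.

Lemma T_eigen x : \sum_i phi0 (x * T_rep i)%g =
  l%:R * sqrtl * rho l%:R * (1 + nu1 l%:R) * (1 + nu2 l%:R) * phi0 x.
Proof.
rewrite (hecke_eigen hphi0 phi0_neq0 phi0_inv T_set_rep T_set_Kl T_set_Kr T_reduce T_inj).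
congr (_ * _); apply: (mulIf (phi0_at1 hphi0 phi0_neq0 phi0_inv)).
rewrite divfK; last exact: (phi0_at1 hphi0 phi0_neq0 phi0_inv).
have lC0 := lC_neq0 K.
have sc (I : finType) (a : C) : \sum_(i : I) a = #|I|%:R * a by rewrite sumr_const mulr_natl.
have v i : phi0 (T_rep i) = match i with
  | inl (inl _) => ps_char nu1 nu2 rho (lK ^+ 1) (lK ^+ 1) (lK ^+ 1)
  | inl (inr _) => ps_char nu1 nu2 rho (lK ^+ 1) (lK ^+ 0) (lK ^+ 1)
  | inr (inl _) => ps_char nu1 nu2 rho (lK ^+ 0) (lK ^+ 1) (lK ^+ 1)
  | inr (inr _) => ps_char nu1 nu2 rho (lK ^+ 0) (lK ^+ 0) (lK ^+ 1)
  end * phi0 1%g.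
  have := T_repE i; case: i => [[[[u v] w]|[p v]]|[w|[]]] [E sE];
    by rewrite (phi0_upm E) ?sE ?expr0 ?expr1 //; ring.
rewrite (eq_bigr _ (fun i _ => v i)) -mulr_suml !big_sumType /= !sc !ps_char_lX.
rewrite !card_prod !card_ord card_unit !natrM !expr0 !expr1 !mulr1.
congr (_ * _); field; exact: lC0.
Qed.

End Eigenvalue.
End HeckeT.

Section HeckeT1.
Variables (l : nat) (R : realType) (K : padicFieldType l R).
Local Notation C := R[i].
Local Notation G := (gsp4 K).
Local Notation lR := (l%:R : R).
Local Notation lK := (l%:R : K).

Definition T1_idx := (((unit + 'I_l) + ('I_l * 'I_(l ^ 2) + 'I_l * 'I_l * 'I_(l ^ 2)))
  + ('I_l.-1 * 'I_l + 'I_l.-1))%type.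

(* Representatives of K diag(1,l,l,l^2) K / K, with K = GSp_4(Z_l). *)
Definition T1_mx (i : T1_idx) : 'M[K]_4 :=
  match i with
  | inl (inl (inl _)) => upm 1 0 0 0 lK 0 0 lK 0 (lK ^+ 2)
  | inl (inl (inr p)) => upm lK p%:R 0 0 1 0 0 (lK ^+ 2) (- (p%:R * lK)) lK
  | inl (inr (inl (u, w))) => upm lK 0 u%:R 0 (lK ^+ 2) w%:R (lK * u%:R) 1 0 lK
  | inl (inr (inr (p, u, v))) =>
      upm (lK ^+ 2) (lK * p%:R) (lK * u%:R) v%:R lK 0 u%:R lK (- p%:R) 1
  | inr (inl (s, a)) => let s := s.+1%:R in let a := a%:R in
      upm lK 0 (s * a) (s * a * a) lK s (s * a) lK 0 lK
  | inr (inr s) => upm lK 0 0 s.+1%:R lK 0 0 lK 0 lK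
  end.

Definition T1_rep (i : T1_idx) : G := gs (T1_mx i) (lK ^+ 2).

Lemma T1_repE i : gsp4_mx (T1_rep i) = T1_mx i /\ simil (T1_rep i) = lK ^+ 2.
Proof.
have l20 : lK ^+ 2 != 0 by rewrite expf_neq0 // l_neq0.
apply: gsE; case: i => [[[[]|p]|[[u w]|[[p u] v]]]|[[s a]|s]] /=;
  by apply: upm_gsp4 => //; ring.
Qed.

Definition int_mx m n (A : 'M[K]_(m, n)) : Prop := forall i j, pabs (A i j) <= 1.

Lemma int_mulmx m n p (A : 'M[K]_(m, n)) (B : 'M[K]_(n, p)) :
  int_mx A -> int_mx B -> int_mx (A *m B).
Proof. by move=> hA hB i j; rewrite mxE; apply: pabs_sum_le => // a; exact: pabsM_le1. Qed.

(* The integral matrices of multiplier l^2 (up to units) whose reduction mod l has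
   rank exactly one. *)
Definition T1_set : set G := [set s |
  [/\ exists (u : 'cV[K]_4) (v : 'rV[K]_4) (A : 'M[K]_4),
        [/\ int_mx u, int_mx v, int_mx A & gsp4_mx s = u *m v + lK *: A],
      pabs (simil s) = lR ^- 2 &
      ~ forall i j, pabs (gsp4_mx s i j) <= lR^-1]].

Definition col4 (a b c d : K) : 'cV[K]_4 := \col_i [:: a; b; c; d]`_i.

Lemma int_col4 a b c d : pabs a <= 1 -> pabs b <= 1 -> pabs c <= 1 -> pabs d <= 1 ->
  int_mx (col4 a b c d).
Proof.
by move=> *; move=> i j; rewrite mxE; move: i; apply: ord4P.
Qed.

Lemma succ_ord_lt (s : 'I_l.-1) : (s.+1 < l)%N.
Proof. by have := ltn_ord s; have := l_gt1 K; lia. Qed.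

Lemma pabs_succ_ord (s : 'I_l.-1) : pabs (s.+1%:R : K) = 1.
Proof. by apply: pabs_unit_nat; rewrite succ_ord_lt. Qed.

Lemma T1_set_rep i : T1_set (T1_rep i).
Proof.
rewrite /T1_set /=; have [-> ->] := T1_repE i; split; last 2 first.
- by rewrite pabs_lexp.
- have lt1 : lR^-1 < 1 := lRV_lt1 K.
  have no a : pabs a = 1 :> R -> ~ (pabs (a : K) <= lR^-1) by move=> -> ; apply/negP; rewrite -ltNge.
  case: i => [[[[]|p]|[[u w]|[[p u] v]]]|[[s a]|s]] /= h.
  + by move: (h o0 o0); rewrite mxE /=; apply: no; exact: pabs1.
  + by move: (h o1 o1); rewrite mxE /=; apply: no; exact: pabs1.
  + by move: (h o2 o2); rewrite mxE /=; apply: no; exact: pabs1.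
  + by move: (h o3 o3); rewrite mxE /=; apply: no; exact: pabs1.
  + by move: (h o1 o2); rewrite mxE /=; apply: no; exact: pabs_succ_ord.
  + by move: (h o0 o3); rewrite mxE /=; apply: no; exact: pabs_succ_ord.
have done u0 u1 u2 u3 v0 v1 v2 v3 (A B : 'M[K]_4) :
    int_mx (col4 u0 u1 u2 u3) -> int_mx (col4 v0 v1 v2 v3) -> int_mx A ->
    (forall i j, B i j = [:: u0; u1; u2; u3]`_i * [:: v0; v1; v2; v3]`_j + lK * A i j) ->
    exists (u : 'cV[K]_4) (v : 'rV[K]_4) (A : 'M[K]_4),
        [/\ int_mx u, int_mx v, int_mx A & B = u *m v + lK *: A].
  move=> iu iv iA h; exists (col4 u0 u1 u2 u3), (col4 v0 v1 v2 v3)^T, A; split=> //.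
    by move=> i' j; rewrite mxE; exact: iv.
  by apply/matrixP => a b; rewrite h !mxE big_ord1 !mxE.
case: i => [[[[]|p]|[[u w]|[[p u] v]]]|[[s a]|s]] /=.
- apply: (done 1 0 0 0 1 0 0 0 (upm 0 0 0 0 1 0 0 1 0 lK));
    [apply: int_col4; intg|apply: int_col4; intg|apply: upm_int; intg|].
  by apply: ord44P; rewrite !mxE /=; ring.
- apply: (done p%:R 1 0 0 0 1 0 0 (upm 1 0 0 0 0 0 0 lK (- p%:R) 1));
    [apply: int_col4; intg|apply: int_col4; intg|apply: upm_int; intg|].
  by apply: ord44P; rewrite !mxE /=; ring.
- apply: (done u%:R w%:R 1 0 0 0 1 0 (upm 1 0 0 0 lK 0 u%:R 0 0 1));
    [apply: int_col4; intg|apply: int_col4; intg|apply: upm_int; intg|].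
  by apply: ord44P; rewrite !mxE /=; ring.
- apply: (done v%:R u%:R (- p%:R) 1 0 0 0 1 (upm lK p%:R u%:R 0 1 0 0 1 0 0));
    [apply: int_col4; intg|apply: int_col4; intg|apply: upm_int; intg|].
  by apply: ord44P; rewrite !mxE /=; ring.
- apply: (done a%:R 1 0 0 0 0 s.+1%:R (s.+1%:R * a%:R) (upm 1 0 0 0 1 0 0 1 0 1));
    [apply: int_col4; intg|apply: int_col4; intg|apply: upm_int; intg|].
  by apply: ord44P; rewrite !mxE /=; ring.
- apply: (done 1 0 0 0 0 0 0 s.+1%:R (upm 1 0 0 0 1 0 0 1 0 1));
    [apply: int_col4; intg|apply: int_col4; intg|apply: upm_int; intg|].
  by apply: ord44P; rewrite !mxE /=; ring.
Qed.

Lemma lV_ge0 : 0 <= lR^-1.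
Proof. by rewrite invr_ge0 ler0n. Qed.

Lemma T1_set_Kl k s : gsp4_int k -> T1_set s -> T1_set (k * s)%g.
Proof.
move=> ik [[u [v [A [iu iv iA E]]]] ss ns]; have /gsp4_intP[k1 k2] := ik.
split; last 2 first.
- by rewrite similM pabsM k2 mul1r.
- move=> h; apply: ns => i j.
  have -> : s = (k^-1 * (k * s))%g by rewrite mulKg.
  have /gsp4_intP[kV _] := gsp4_intV ik.
  rewrite gsp4_mxM mxE; apply: pabs_sum_le => [|a]; first exact: lV_ge0.
  by rewrite -[leRHS]mul1r; apply: pabsM_le.
exists (gsp4_mx k *m u), v, (gsp4_mx k *m A); split=> //; try exact: int_mulmx.
by rewrite gsp4_mxM E mulmxDr mulmxA -scalemxAr.
Qed.

Lemma T1_set_Kr k s : gsp4_int k -> T1_set s -> T1_set (s * k)%g.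
Proof.
move=> ik [[u [v [A [iu iv iA E]]]] ss ns]; have /gsp4_intP[k1 k2] := ik.
split; last 2 first.
- by rewrite similM pabsM k2 mulr1.
- move=> h; apply: ns => i j.
  have -> : s = (s * k * k^-1)%g by rewrite mulgK.
  have /gsp4_intP[kV _] := gsp4_intV ik.
  rewrite gsp4_mxM mxE; apply: pabs_sum_le => [|a]; first exact: lV_ge0.
  by rewrite -[leRHS]mulr1; apply: pabsM_le.
exists u, (v *m gsp4_mx k), (A *m gsp4_mx k); split=> //; try exact: int_mulmx.
by rewrite gsp4_mxM E mulmxDl mulmxA -scalemxAl.
Qed.

Lemma T1_minor s i i' j j' : T1_set s -> let A := gsp4_mx s in
  exists2 m, pabs m <= 1 & A i j * A i' j' - A i j' * A i' j = lK * m.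
Proof.
move=> [[u [v [B [iu iv iB E]]]] _ _] A.
have AE a b : A a b = u a 0 * v 0 b + lK * B a b.
  by rewrite /A E !mxE big_ord1.
exists (u i 0 * v 0 j * B i' j' + B i j * u i' 0 * v 0 j' + lK * B i j * B i' j'
  - u i 0 * v 0 j' * B i' j - B i j' * u i' 0 * v 0 j - lK * B i j' * B i' j).
  by intg; [exact: iu|exact: iv|exact: iB|exact: iB|exact: iu|exact: iv|exact: iB|exact: iB|
            exact: iu|exact: iv|exact: iB|exact: iB|exact: iu|exact: iv|exact: iB|exact: iB].
by rewrite !AE; ring.
Qed.

Lemma valuation2 y c : pabs y <= 1 -> pabs c <= 1 -> pabs (y * c) = lR ^- 2 ->
  [\/ pabs c = 1 /\ (exists2 y', pabs y' = 1 & y = lK ^+ 2 * y'),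
      exists y' c', [/\ pabs y' = 1, pabs c' = 1, y = lK * y' & c = lK * c'] |
      pabs y = 1 /\ (exists2 c', pabs c' = 1 & c = lK ^+ 2 * c')].
Proof.
move=> iy ic yc; have lV0 : lR^-1 != 0 by rewrite invr_neq0 ?(lR_neq0 K).
have E2 : lR ^- 2 = lR^-1 * lR^-1 by rewrite -exprVn expr2.
have [uc|[c1 ic1 Ec]] := unit_or_div ic.
  apply: Or31; split=> //; have : pabs y <= lR ^- 2 by rewrite -yc pabsM uc mulr1.
  move=> /pabs_divl[y' iy' Ey]; exists y' => //.
  apply: (mulfI (mulf_neq0 lV0 lV0)).
  by rewrite mulr1 -E2 -[RHS]yc pabsM uc mulr1 Ey pabsM pabs_lexp.
have yc1 : pabs y * pabs c1 = lR^-1.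
  by apply: (mulfI lV0); rewrite -E2 -yc Ec !pabsM pabs_l; ring.
have [uc1|[c2 ic2 Ec1]] := unit_or_div ic1.
  apply: Or32; have : pabs y <= lR^-1 by rewrite -yc1 uc1 mulr1.
  move=> /pabs_divl1[y' iy' Ey]; exists y', c1; split=> //.
  by apply: (mulfI lV0); rewrite mulr1 -[RHS]yc1 Ey pabsM uc1 mulr1 pabs_l.
apply: Or33; have [uy uc2] : pabs y = 1 /\ pabs c2 = 1.
  apply: unit_of_mul => //; rewrite pabsM; apply: (mulfI lV0).
  by rewrite mulr1 -{2}yc1 Ec1 pabsM pabs_l; ring.
by split=> //; exists c2; rewrite // Ec Ec1 expr2 mulrA.
Qed.

Lemma div_solve (a b e : K) : a != 0 -> a * b = e -> b = e / a.
Proof. by move=> a0 <-; rewrite mulrC mulKf. Qed.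

Lemma residue_unit_pos c x : pabs c = 1 -> pabs x = 1 ->
  exists (s : 'I_l.-1) (t : K), pabs t <= 1 /\ x = c * (s.+1%:R + lK * t).
Proof.
move=> uc ux; have [s [t [it E]]] := residue_unit1 uc (int_unit ux).
have s0 : (0 < s)%N.
  rewrite lt0n; apply/negP => /eqP s0; apply: (@pabs_lK_eq1 l R K t it).
  by move: ux; rewrite E s0 add0r pabsM uc mul1r.
have sl : (s.-1 < l.-1)%N by have := ltn_ord s; lia.
by exists (Ordinal sl), t; rewrite /= prednK.
Qed.

Lemma T1_reduce b : T1_set b -> upper_triangular (gsp4_mx b) ->
  exists i, gsp4_int ((T1_rep i)^-1 * b)%g.
Proof.
move=> Sb /upper_solved[x [p [b02 [b03 [y [b12 [b13 [c [q [d]]]]]]]]]].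
move=> [E [xd yc] /and4P[x0 y0 c0 d0] [Ep Eq] [E13 E02]].
have minor i i' j j' := @T1_minor b i i' j j' Sb.
have [[u [v [A [iu iv iA EA]]]] sb nb] := Sb.
have ib i j : pabs (gsp4_mx b i j) <= 1.
  by rewrite EA mxE mxE big_ord1 mxE; intg; [exact: iu|exact: iv|exact: iA].
have [ix ip] : pabs x <= 1 /\ pabs p <= 1.
  by split; [have := ib o0 o0|have := ib o0 o1]; rewrite E mxE.
have [i02 i03] : pabs b02 <= 1 /\ pabs b03 <= 1.
  by split; [have := ib o0 o2|have := ib o0 o3]; rewrite E mxE.
have [iy i12] : pabs y <= 1 /\ pabs b12 <= 1.
  by split; [have := ib o1 o1|have := ib o1 o2]; rewrite E mxE.
have [i13 ic] : pabs b13 <= 1 /\ pabs c <= 1.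
  by split; [have := ib o1 o3|have := ib o2 o2]; rewrite E mxE.
have [iq id] : pabs q <= 1 /\ pabs d <= 1.
  by split; [have := ib o2 o3|have := ib o3 o3]; rewrite E mxE.
have l0 := l_neq0 K.
have done i X : gsp4_mx (T1_rep i) *m X = gsp4_mx b -> (forall i j, pabs (X i j) <= 1) ->
    exists i, gsp4_int ((T1_rep i)^-1 * b)%g.
  move=> h iX; exists i; apply: coset_of_mx h iX _.
  by have [_ ->] := T1_repE i; rewrite sb pabs_lexp.
have two (a a' : K) i i' j j' : pabs a = 1 -> pabs a' = 1 ->
    gsp4_mx b i j = a -> gsp4_mx b i' j' = a' -> gsp4_mx b i' j = 0 -> False.
  move=> ua ua' e1 e2 e3; have [m im] := minor i i' j j'; rewrite e1 e2 e3 mulr0 subr0.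
  by move=> h; apply: (@pabs_lK_eq1 l R K m im); rewrite -h pabsM ua ua' mulr1.
have [|[uc [y' uy' Ey]]|[y' [c' [uy' uc' Ey Ec]]]|[uy [c' uc' Ec]]] :=
    @valuation2 y c iy ic; first by rewrite yc.
- have [|[ud _]|[x' [d' [ux' ud' Ex Ed]]]|[ux _]] := @valuation2 x d ix id.
  + by rewrite xd.
  + by exfalso; apply: (two c d o2 o3 o2 o3); rewrite ?E ?mxE.
  + have d0' := unit_neq0 ud'; have x0' := unit_neq0 ux'.
    have [U [t1 [it1 EU]]] := residue_unit1 uc i02.
    have [W [t2 [it2 EW]]] := residue_unit 2 uc i12.
    have [m im] := minor o0 o2 o2 o3; rewrite E !mxE /= => Em.
    have E03 : b03 = (U%:R + lK * t1) * q - lK * m / c.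
      by rewrite -Em EU; field; rewrite c0.
    apply: (done (inl (inr (inl (U, W))))
      (upm x' (- (y' * q) / d') (c * t1) (t1 * q - m / c) y' (c * t2) (t1 * d' + t2 * q) c q d')).
      have [-> _] := T1_repE (inl (inr (inl (U, W)))); rewrite E upm_mul.
      rewrite E13 E03 Ep Ex Ey Ed EU EW; congr upm; try ring; by field; rewrite ?d0' ?c0 ?l0.
    by apply: upm_int; intg.
  + by exfalso; apply: (two x c o0 o2 o0 o2); rewrite ?E ?mxE.
- have y0' := unit_neq0 uy'; have c0' := unit_neq0 uc'.
  have [|[ud [x' ux' Ex]]|[x' [d' [ux' ud' Ex Ed]]]|[ux [d' ud' Ed]]] := @valuation2 x d ix id.
  + by rewrite xd.
  + have iNq : pabs (- q) <= 1 by rewrite pabsN.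
    have [P [t1 [it1 EP]]] := residue_unit1 ud iNq.
    have [U [t2 [it2 EU]]] := residue_unit1 ud i13.
    have [m im] := minor o1 o3 o2 o3; rewrite E !mxE /= mulr0 subr0 => Em.
    have E12 : b12 = lK * m / d by rewrite -Em mulfK.
    have Eq' : q = - (d * (P%:R + lK * t1)) by rewrite -EP opprK.
    have iv3 : pabs (b03 - P%:R * (b13 - U%:R * d) - U%:R * (q + P%:R * d)) <= 1.
      by intg.
    have [V [t3 [it3 EV]]] := residue_unit 2 ud iv3.
    have E03 : b03 = P%:R * (b13 - U%:R * d) + U%:R * (q + P%:R * d)
        + d * (V%:R + lK ^+ 2 * t3) by rewrite -EV; ring.
    apply: (done (inl (inr (inr (P, U, V))))
      (upm x' (y' * t1) (c' * t2 + m / d * t1) (d * t3) y' (m / d) (d * t2) c' (- (d * t1)) d)).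
      have [-> _] := T1_repE (inl (inr (inr (P, U, V)))); rewrite E upm_mul.
      rewrite E03 E02 Ep Ex Ey Ec E12 EU Eq'; congr upm; try ring; by field; rewrite ?d0.
    by apply: upm_int; intg.
  + have x0' := unit_neq0 ux'; have d0' := unit_neq0 ud'.
    have [m im] := minor o0 o2 o1 o3; rewrite E !mxE /= mulr0 subr0 => Em.
    have Epq : p = - (y' * q) / d' by rewrite Ep Ey Ed; field; rewrite d0' l0.
    have [uq|[q' iq' Eq']] := unit_or_div iq.
      exfalso; apply: (@pabs_lK_eq1 l R K m im); rewrite -Em Epq !pabsM pabsN pabsM pabsV.
      by rewrite uy' uq ud' invr1 !mulr1.
    have [m' im'] := minor o0 o1 o2 o3; rewrite E !mxE /= => Em'.
    have E13' : b13 = (b02 * d' + b12 * q') / c'.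
      by rewrite E13 Ec Ed Eq'; field; rewrite c0' l0.
    pose p' := - (y' * q') / d'; have ip' : pabs p' <= 1 by rewrite /p'; intg.
    have Ep' : p = lK * p' by rewrite Epq Eq' /p'; field; rewrite d0'.
    have [u12|[b12' i12' E12']] := unit_or_div i12.
      have n12 := unit_neq0 u12.
      have [s [t1 [it1 Es]]] := residue_unit_pos uc' u12.
      have [a [t2 [it2 Ea]]] := residue_unit1 u12 i02.
      pose X13 := s.+1%:R * t2 * d' + t1 * ((a%:R + lK * t2) * d' + q').
      have E13'' : b13 = s.+1%:R * q' + s.+1%:R * a%:R * d' + lK * X13.
        by rewrite E13' Ea Es /X13; field; rewrite c0'.
      have E03 : b03 = (a%:R + lK * t2) * b13 - lK * m' / b12.
        by rewrite -Em' Ea; field; rewrite n12.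
      have i13' : pabs X13 <= 1 by rewrite /X13; intg.
      apply: (done (inr (inl (s, a)))
        (upm x' p' (c' * (s.+1%:R * t2 + t1 * a%:R + lK * t1 * t2))
             (a%:R * X13 + t2 * b13 - m' / b12) y' (c' * t1) X13 c' q' d')).
        have [-> _] := T1_repE (inr (inl (s, a))); rewrite E upm_mul.
        congr upm; rewrite ?Ex ?Ey ?Ec ?Ed ?Ep' ?Eq'; try ring.
        * by rewrite Ea Es; ring.
        * by rewrite E03 E13''; ring.
        * by rewrite Es; ring.
        * by rewrite E13''; ring.
      by apply: upm_int; intg.
    have [u02|[b02' i02' E02']] := unit_or_div i02.
      exfalso; apply: (@pabs_lK_eq1 l R K (m' + b03 * b12' - b02 * b12' * q' / c')).
        by intg.
      have -> : lK * (m' + b03 * b12' - b02 * b12' * q' / c') = b02 * b02 * d' / c'.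
        rewrite mulrBr mulrDr -Em' E13' E12'; field; rewrite c0'; split.
      by rewrite !pabsM u02 ud' pabsV uc' invr1 !mulr1.
    have E13'' : b13 = lK * ((b02' * d' + b12' * q') / c').
      by rewrite E13' E12' E02'; field; rewrite c0'.
    have u03 : pabs b03 = 1.
      have [//|[b03' i03' E03']] := unit_or_div i03; exfalso; apply: nb.
      have Ll a : pabs a <= 1 -> pabs (lK * a) <= lR^-1.
        by move=> ia; rewrite pabsM pabs_l ler_piMr // lV_ge0.
      rewrite E /upm; apply: (m4_forall (P := fun x => pabs x <= lR^-1));
        rewrite ?pabs0 ?lV_ge0 //.
      * by rewrite Ex Ll ?int_unit.
      * by rewrite Ep' Ll.
      * by rewrite E02' Ll.
      * by rewrite E03' Ll.
      * by rewrite Ey Ll ?int_unit.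
      * by rewrite E12' Ll.
      * by rewrite E13'' Ll //; intg.
      * by rewrite Ec Ll ?int_unit.
      * by rewrite Eq' Ll.
      * by rewrite Ed Ll ?int_unit.
    have [s [t [it Es]]] := residue_unit_pos ud' u03.
    apply: (done (inr (inr s)) (upm x' p' b02' (d' * t) y' b12' 
        ((b02' * d' + b12' * q') / c') c' q' d')).
      have [-> _] := T1_repE (inr (inr s)); rewrite E upm_mul.
      by congr upm; rewrite ?Ex ?Ey ?Ec ?Ed ?Ep' ?Eq' ?E02' ?E12' ?E13'' ?Es; ring.
    by apply: upm_int; intg.
  + have [m1 im1] := minor o0 o1 o0 o2; rewrite E !mxE /= mulr0 subr0 => Em1.
    have [m2 im2] := minor o0 o1 o0 o3; rewrite E !mxE /= mulr0 subr0 => Em2.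
    have [m3 im3] := minor o0 o2 o0 o3; rewrite E !mxE /= mulr0 subr0 => Em3.
    apply: (done (inl (inl (inl tt)))
      (upm x p b02 b03 y' (m1 / x) (m2 / x) c' (m3 / x) d')).
      have [-> _] := T1_repE (inl (inl (inl tt))); rewrite E upm_mul.
      rewrite (div_solve x0 Em1) (div_solve x0 Em2) (div_solve x0 Em3) Ey Ec Ed.
      by congr upm; ring.
    by apply: upm_int; intg.
- have c0' := unit_neq0 uc'.
  have [|[ud _]|[x' [d' [ux' ud' Ex Ed]]]|[ux _]] := @valuation2 x d ix id.
  + by rewrite xd.
  + by exfalso; apply: (two y d o1 o3 o1 o3); rewrite ?E ?mxE.
  + have [P [t1 [it1 EP]]] := residue_unit1 uy ip.
    have [m1 im1] := minor o0 o1 o1 o2; rewrite E !mxE /= => Em1.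
    have [m2 im2] := minor o0 o1 o1 o3; rewrite E !mxE /= => Em2.
    have E02' : b02 = (P%:R + lK * t1) * b12 - lK * m1 / y.
      by rewrite -Em1 EP; field; rewrite y0.
    have E03' : b03 = (P%:R + lK * t1) * b13 - lK * m2 / y.
      by rewrite -Em2 EP; field; rewrite y0.
    apply: (done (inl (inl (inr P)))
      (upm x' (y * t1) (t1 * b12 - m1 / y) (t1 * b13 - m2 / y) y b12 b13 c' (- (t1 * d')) d')).
      have [-> _] := T1_repE (inl (inl (inr P))); rewrite E upm_mul.
      rewrite E02' E03' Eq EP Ex Ec Ed; congr upm; try ring; by field; rewrite y0.
    by apply: upm_int; intg.
  + by exfalso; apply: (two x y o0 o1 o0 o1); rewrite ?E ?mxE.
Qed.

Lemma l2_absurd : pabs (lK ^+ 2) = pabs (1 : K) -> False.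
Proof.
have lt := lRV_lt1 K; have gt : 0 < lR^-1 by rewrite invr_gt0 (lR_gt0 K).
by rewrite pabsX pabs_l pabs1 => h; nra.
Qed.

Lemma l21_absurd : pabs (lK ^+ 2) = pabs lK -> False.
Proof.
have lt := lRV_lt1 K; have gt : 0 < lR^-1 by rewrite invr_gt0 (lR_gt0 K).
by rewrite pabsX pabs_l => h; nra.
Qed.

Lemma T1_inj i j : gsp4_int ((T1_rep i)^-1 * T1_rep j)%g -> i = j.
Proof.
have [Ei _] := T1_repE i; have [Ej _] := T1_repE j.
have l0 := l_neq0 K; have n1 := oner_neq0 K; have l20 := expf_neq0 2 l0.
have absurd (s : 'I_l.-1) X : pabs X <= 1 -> lK * X + s.+1%:R = 0 -> False.
  move=> iX /eqP; rewrite addr_eq0 => /eqP h; apply: (@pabs_lK_eq1 l R K X iX).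
  by rewrite h pabsN pabs_succ_ord.
have succ_inj (s s' : 'I_l.-1) X : pabs X <= 1 -> lK * X + s.+1%:R = s'.+1%:R -> s = s'.
  move=> iX h; have := @ord_of_lK1 l R K (Ordinal (succ_ord_lt s)) (Ordinal (succ_ord_lt s')) X h iX.
  by move=> /(congr1 val) /= [] /val_inj.
move: Ei Ej; case: i => [[[[]|p]|[[u w]|[[p u] v]]]|[[s a]|s]];
  case: j => [[[[]|p']|[[u' w']|[[p' u'] v']]]|[[s' a']|s']];
  move=> /= Ei Ej h; have [] := upm_coset_diag Ei Ej _ _ h; rewrite ?l0 ?l20 ?n1 //;
  try (by move=> A B; exfalso; first [exact: l1_absurd A|exact: l1_absurd B|
    exact: l1_absurd (esym A)|exact: l1_absurd (esym B)|exact: l2_absurd A|exact: l2_absurd B|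
    exact: l2_absurd (esym A)|exact: l2_absurd (esym B)|exact: l21_absurd A|exact: l21_absurd B|
    exact: l21_absurd (esym A)|exact: l21_absurd (esym B)]);
  move=> _ _; have [X01 [X02 [X03 [X12 [X13 [X23]]]]]] :=
    upm_coset_eq Ei Ej ltac:(by rewrite ?l20 l0 ?n1) h;
  move=> [[i01 i02 i03 i12 [i13 i23]] e01 e02 e03 [e12 e13 e23]].
- by rewrite (ord_of_lK1 e01 i01).
- rewrite mul0r addr0 in e02.
  by rewrite (ord_of_lK1 e02 i02) (ord_of_lK e12 i12).
- have eP : lK * - X23 + p%:R = p'%:R.
    by apply: oppr_inj; rewrite -e23; ring.
  have Ep := ord_of_lK1 eP (int_N i23); subst p'.
  rewrite mul0r addr0 in e13.
  have Eu := ord_of_lK1 e13 i13; subst u'.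
  have z23 : X23 = 0.
    apply: (mulfI l0); apply: (addIr (- p%:R)); by rewrite mulr0 add0r e23.
  have z13 : X13 = 0.
    apply: (mulfI l0); apply: (addIr u%:R); by rewrite mulr0 add0r e13.
  rewrite z23 z13 !mulr0 !addr0 in e03.
  by rewrite (ord_of_lK e03 i03).
- have Es := succ_inj _ _ _ i12 e12; subst s'.
  rewrite mul0r addr0 in e02; have us := pabs_succ_ord s; have s0 := unit_neq0 us.
  have ea : lK * (X02 / s.+1%:R) + a%:R = a'%:R.
    move: s0 e02; move: (s.+1%:R : K) => S s0 e02.
    by apply: (mulfI s0); rewrite -e02; field.
  have iX : pabs (X02 / s.+1%:R) <= 1 by intg.
  by rewrite (ord_of_lK1 ea iX).
- by exfalso; apply: absurd i12 e12.
- by exfalso; apply: (absurd s' (- X12)); [exact: int_N|rewrite -e12; ring].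
- rewrite !mul0r !addr0 in e03; by rewrite (succ_inj _ _ _ i03 e03).
Qed.

Section Eigenvalue.
Variables (nu1 nu2 rho : K -> C) (phi0 : G -> C).
Hypotheses (unu1 : unramified_char nu1) (unu2 : unramified_char nu2)
  (urho : unramified_char rho).
Hypothesis hphi0 : principal_series nu1 nu2 rho phi0.
Hypothesis phi0_neq0 : phi0 <> (fun=> 0).
Hypothesis phi0_inv : forall k, gsp4_int k -> rtrans k phi0 = phi0.
Local Notation n1 := (nu1 l%:R).
Local Notation n2 := (nu2 l%:R).

Lemma T1_eigen x : \sum_i phi0 (x * T1_rep i)%g =
  rho l%:R ^+ 2 * (l%:R ^+ 2 * (n1 + n2 + n1 * n2 ^+ 2 + n1 ^+ 2 * n2)
    + (l%:R ^+ 2 - 1) * n1 * n2) * phi0 x.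
Proof.
rewrite (hecke_eigen hphi0 phi0_neq0 phi0_inv T1_set_rep T1_set_Kl T1_set_Kr T1_reduce T1_inj).
congr (_ * _); apply: (mulIf (phi0_at1 hphi0 phi0_neq0 phi0_inv)).
rewrite divfK; last exact: (phi0_at1 hphi0 phi0_neq0 phi0_inv).
have lC0 := lC_neq0 K.
have sc (I : finType) (a : C) : \sum_(i : I) a = #|I|%:R * a by rewrite sumr_const mulr_natl.
have v i : phi0 (T1_rep i) = match i with
  | inl (inl (inl _)) => ps_char nu1 nu2 rho (lK ^+ 0) (lK ^+ 1) (lK ^+ 2)
  | inl (inl (inr _)) => ps_char nu1 nu2 rho (lK ^+ 1) (lK ^+ 0) (lK ^+ 2)
  | inl (inr (inl _)) => ps_char nu1 nu2 rho (lK ^+ 1) (lK ^+ 2) (lK ^+ 2)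
  | inl (inr (inr _)) => ps_char nu1 nu2 rho (lK ^+ 2) (lK ^+ 1) (lK ^+ 2)
  | inr (inl _) => ps_char nu1 nu2 rho (lK ^+ 1) (lK ^+ 1) (lK ^+ 2)
  | inr (inr _) => ps_char nu1 nu2 rho (lK ^+ 1) (lK ^+ 1) (lK ^+ 2)
  end * phi0 1%g.
  have := T1_repE i; case: i => [[[[]|p]|[[u w]|[[p u] v]]]|[[s a]|s]] [E sE];
    by rewrite (phi0_upm hphi0 E) ?sE ?expr0 ?expr1 //; ring.
rewrite (eq_bigr _ (fun i _ => v i)) -mulr_suml !big_sumType /= !sc.
rewrite !(ps_char_lX unu1 unu2 urho).
rewrite !card_prod !card_ord card_unit -subn1 !natrM natrB ?(ltnW (l_gt1 K)) //.
rewrite !exprMn (sqrtl2 K) !expr0 !expr1 !mulr1.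
congr (_ * _); field; exact: lC0.
Qed.

End Eigenvalue.
End HeckeT1.

(** * Invariant bilinear forms *)

Section LinearForms.
Variables (R : realType) (T : Type).
Local Notation C := R[i].
Variables (W : set (T -> C)) (L : (T -> C) -> C).
Hypothesis subW : fsubspace W.
Hypothesis linL : forall (a : C) f f', W f -> W f' ->
  L (fun x => a * f x + f' x) = a * L f + L f'.

Lemma lin0 : L (fun=> 0) = 0.
Proof.
have [W0 _] := subW; have := linL (-1) W0 W0.
have -> : (fun x : T => -1 * (0 : C) + 0) = (fun=> 0) by apply: funext => x; rewrite mulr0 addr0.
by rewrite mulN1r addNr.
Qed.

Lemma linZ a f : W f -> L (fun x => a * f x) = a * L f.
Proof.
move=> Wf; have [W0 _] := subW; rewrite -[RHS]addr0 -lin0 -linL //.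
by congr L; apply: funext => x; rewrite addr0.
Qed.

Lemma linD f f' : W f -> W f' -> L (fun x => f x + f' x) = L f + L f'.
Proof.
move=> Wf Wf'; rewrite -[L f]mul1r -linL //; congr L; apply: funext => x.
by rewrite mul1r.
Qed.

Lemma subspaceZ a f : W f -> W (fun x => a * f x).
Proof.
move=> Wf; have [W0 WD] := subW; have := WD a f _ Wf W0.
by congr W; apply: funext => x; rewrite addr0.
Qed.

Lemma subspace_comb a b f f' : W f -> W f' -> W (fun x => a * f x + b * f' x).
Proof. by move=> Wf Wf'; have [_ WD] := subW; apply: (WD a f _ Wf); exact: subspaceZ. Qed.

Lemma subspace_sum (I : finType) (f : I -> T -> C) : (forall i, W (f i)) ->
  W (fun x => \sum_i f i x).
Proof.
move=> Wf; have [W0 WD] := subW.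
suff H (s : seq I) : W (fun x => \sum_(i <- s) f i x) by exact: H.
elim: s => [|i s IH].
  by rewrite (_ : (fun _ => _) = (fun=> 0)) //; apply: funext => x; rewrite big_nil.
rewrite (_ : (fun _ => _) = (fun x => 1 * f i x + \sum_(j <- s) f j x)); first exact: WD.
by apply: funext => x; rewrite big_cons mul1r.
Qed.

Lemma lin_sum (I : finType) (f : I -> T -> C) : (forall i, W (f i)) ->
  L (fun x => \sum_i f i x) = \sum_i L (f i).
Proof.
move=> Wf; have [W0 WD] := subW.
have H (s : seq I) : W (fun x => \sum_(i <- s) f i x) /\
    L (fun x => \sum_(i <- s) f i x) = \sum_(i <- s) L (f i).
  elim: s => [|i s [IH1 IH2]].
    have -> : (fun x => \sum_(i <- [::]) f i x) = (fun=> 0).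
      by apply: funext => x; rewrite big_nil.
    by rewrite big_nil lin0.
  have E : (fun x => \sum_(j <- i :: s) f j x) = (fun x => 1 * f i x + \sum_(j <- s) f j x).
    by apply: funext => x; rewrite big_cons mul1r.
  by rewrite E big_cons linL // mul1r IH2; split=> //; exact: WD.
exact: (H _).2.
Qed.

End LinearForms.

Section Spaces.
Variables (l : nat) (R : realType) (K : padicFieldType l R).
Local Notation C := R[i].
Local Notation lR := (l%:R : R).
Local Notation G := (gsp4 K).

Lemma induced_subspace (chi psi : K -> C) : fsubspace (Defs.induced chi psi).
Proof.
split; first by split=> [|b g _]; [apply: filterE => k; exact: erefl|rewrite mulr0].
move=> a f f' [sf ef] [sf' ef']; split=> [|b g b10]; last first.
  by rewrite ef // ef' //; ring.
apply: filterS2 sf sf' => k Ef Ef'; apply: funext => x.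
by rewrite -{2}Ef -{2}Ef'.
Qed.

Lemma principal_series_subspace (nu1 nu2 rho : K -> C) :
  fsubspace (principal_series nu1 nu2 rho).
Proof.
split; first by split=> [|b g x y z _ _]; [apply: filterE => k; exact: erefl|rewrite mulr0].
move=> a f f' [sf ef] [sf' ef']; split=> [|b g x y z ub hb]; last first.
  by rewrite (ef _ _ _ _ _ ub hb) (ef' _ _ _ _ _ ub hb); ring.
apply: filterS2 sf sf' => k Ef Ef'; apply: funext => x.
by rewrite -{2}Ef -{2}Ef'.
Qed.

Definition gl2_level (t : nat) (k : gl2 K) : Prop :=
  [/\ forall i j, pabs (k i j) <= 1, pabs (k 1 0) <= lR ^- t &
      pabs (\det (k : 'M[K]_2)) = 1].

Lemma close_level t (k : gl2 K) : close_to_one (gl2_mx k) (lR ^- t.+1) -> gl2_level t k.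
Proof.
move=> h; have V0 : 0 <= lR^-1 := lV_ge0 l R.
have V1 : lR^-1 <= 1 by exact/ltW/(lRV_lt1 K).
have tV n : lR ^- n <= 1 by rewrite -exprVn exprn_ile1.
have tS : lR ^- t.+1 <= lR ^- t by rewrite -!exprVn exprS ler_piMl // exprn_ge0.
have t1 : lR ^- t.+1 <= lR^-1 by rewrite -!exprVn exprS ler_piMr // exprVn.
have h1 i j : pabs (k i j - (1%:M : 'M[K]_2) i j) <= lR^-1.
  by apply/ltW/(lt_le_trans (h i j)).
have ki i j : pabs (k i j) <= 1.
  rewrite -(subrK ((1%:M : 'M[K]_2) i j) (k i j)); apply: pabsD_le.
    exact: le_trans (h1 i j) V1.
  by rewrite mxE; case: eqP; rewrite ?pabs1 ?pabs0.
split=> //.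
  by have := h 1 0; rewrite mxE /= subr0 => /ltW /le_trans; apply.
rewrite -(@pabs1 l R K); apply: pabs_near; rewrite pabs1 pabsBC.
apply: le_lt_trans (lRV_lt1 K); rewrite det_mx2.
have -> : k 0 0 * k 1 1 - k 0 1 * k 1 0 - 1 =
    (k 0 0 - 1) * k 1 1 + (k 1 1 - 1) - (k 0 1 - 0) * k 1 0 by ring.
have := h1 0 0; have := h1 1 1; have := h1 0 1; rewrite !mxE /= => e1 e2 e3.
apply: pabsB_le; first apply: pabsD_le => //.
  by rewrite -[leRHS]mulr1; apply: pabsM_le.
by rewrite -[leRHS]mulr1; apply: pabsM_le.
Qed.

Lemma rtransM (gT : groupType) (T : Type) (g h : gT) (f : gT -> T) :
  rtrans g (rtrans h f) = rtrans (g * h)%g f.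
Proof. by apply: funext => x; rewrite /rtrans mulgA. Qed.

Lemma rtrans1 (gT : groupType) (T : Type) (f : gT -> T) : rtrans 1%g f = f.
Proof. by apply: funext => x; rewrite /rtrans mulg1. Qed.

Section SiegelQ.
Variables (k : nat) (tau : K -> C).
Hypotheses (htau : smooth_char tau) (utau : unramified tau).

Definition sq (t : nat) : gl2 K -> C := qsec (siegel_det k tau) (siegel_row k tau) t.

Let hA := siegel_det_uchar k htau utau.
Let hkap := siegel_row_uchar k htau utau.

Lemma sq_level t u : gl2_level t u -> rtrans u (sq t) = sq t.
Proof. by move=> [h1 h2 h3]; apply: funext => x; exact: qsec_level. Qed.

Lemma sq_induced t (g : gl2 K) : Defs.induced (siegel_chi k tau) (@siegel_psi l R K) (rtrans g (sq t)).
Proof.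
split.
  have gg : gl2_mx g^-1%g *m gl2_mx g = 1%:M by rewrite /= mulVmx ?gl2_unit.
  have [r r0 hr] := @conj_close l R K 2 (gl2_mx g) (gl2_mx g^-1%g) _ (pabs_lexp_gt0 K t.+1) gg.
  have := gl2_near1 K r0; apply: filterS => u /hr cu.
  rewrite rtransM; have -> : (u * g = g * (g^-1 * u * g))%g by rewrite !mulgA mulgV mul1g.
  have lev : gl2_level t (g^-1 * u * g)%g by apply: close_level.
  by rewrite -rtransM (sq_level lev).
move=> b x b10; have [_ AM _] := hA; have [_ kM _] := hkap.
have bd := gl2_unit b; rewrite unitmxE unitfE det_mx2 b10 mulr0 subr0 in bd.
have b0 : b 0 0 != 0 by apply: contraNneq bd => ->; rewrite mul0r.
have b1 : b 1 1 != 0 by apply: contraNneq bd => ->; rewrite mulr0.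
rewrite /rtrans -mulgA; move: (x * g)%g => {}x.
have xd := gl2_unit x; rewrite unitmxE unitfE in xd.
rewrite /sq /qsec /= det_mulmx det_mx2 b10 mulr0 subr0 !mulmx2E b10 !mul0r !add0r.
rewrite AM // AM // (mulrCA (l%:R ^+ t)) (kap_scale hkap) ?row1_lX //.
rewrite -siegel_chi_det /siegel_row /siegel_psi.
have -> : abspow 2^-1 (b 0 0 / b 1 1) = abspow 2^-1 (b 0 0) * (abspow 2^-1 (b 1 1) : C)^-1.
  have [_ aM _] := abspow_uchar K (2^-1 : C).
  rewrite aM ?invr_neq0 //; congr (_ * _).
  by rewrite /abspow pabsV cpowV // pabs_gt0.
rewrite /siegel_det.
have E1 : abspow (2 + k%:R) (b 1 1) = abspow (1 + k%:R) (b 1 1) * (abspow 1 (b 1 1) : C).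
  by rewrite -abspowD (_ : 2 + k%:R = 1 + k%:R + 1) //; ring.
have E2 : abspow 1 (b 1 1) = abspow 2^-1 (b 1 1) * (abspow 2^-1 (b 1 1) : C).
  by rewrite -abspowD (_ : 2^-1 + 2^-1 = 1) //; field.
have E3 : abspow (- 2^-1) (b 1 1) = (abspow 2^-1 (b 1 1) : C)^-1 by rewrite /abspow cpowN.
rewrite E1 E2 E3.
have n1 : abspow (1 + k%:R) (b 1 1) != 0 :> C by exact: cpow_neq0.
have n2 : abspow 2^-1 (b 1 1) != 0 :> C by exact: cpow_neq0.
have n3 : tau (b 1 1) != 0 by exact: uchar_neq0 (smooth_uchar htau utau) _ b1.
set T := (abspow (2 + k%:R) (dom _ _) * _)^-1; move: T => T.
by field; rewrite n1 n2 n3.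
Qed.

End SiegelQ.

Lemma rtrans_principal (nu1 nu2 rho : K -> C) (phi0 : G -> C) (g : G) :
  principal_series nu1 nu2 rho phi0 ->
  (forall k, gsp4_int k -> rtrans k phi0 = phi0) ->
  principal_series nu1 nu2 rho (rtrans g phi0).
Proof.
move=> [_ eq0] inv; split; last first.
  by move=> b x a y c ub hb; rewrite /rtrans -mulgA (eq0 _ _ _ _ _ ub hb).
have gg : gsp4_mx g^-1%g *m gsp4_mx g = 1%:M.
  by rewrite -gsp4_mxM mulVg.
have [r r0 hr] := @conj_close l R K 4 (gsp4_mx g) (gsp4_mx g^-1%g) 1 ltr01 gg.
have m0 : 0 < Num.min r 1 by rewrite lt_min r0 ltr01.
have := gsp4_near1 K m0; apply: filterS => u [cu su].
rewrite rtransM; have -> : (u * g = g * (g^-1 * u * g))%g by rewrite !mulgA mulgV mul1g.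
rewrite -rtransM (inv (g^-1 * u * g)%g) //; apply: gsp4_int_near1.
  rewrite !gsp4_mxM; apply: hr => i j; apply: lt_le_trans (cu i j) _.
  by rewrite ge_min lexx.
have -> : simil (g^-1 * u * g)%g = simil u.
  rewrite !similM /simil /= -/(simil g) -/(simil u) mulrAC mulVf ?mul1r //.
  exact: simil_neq0.
by apply: lt_le_trans su _; rewrite ge_min lexx orbT.
Qed.

End Spaces.

Section Beta.
Variables (l : nat) (R : realType) (K : padicFieldType l R).
Local Notation C := R[i].
Local Notation lR := (l%:R : R).
Local Notation lK := (l%:R : K).
Local Notation G := (gsp4 K).
Variables (nu1 nu2 rho : K -> C) (phi0 : G -> C).
Hypothesis hphi0 : principal_series nu1 nu2 rho phi0.
Hypothesis phi0_inv : forall k, gsp4_int k -> rtrans k phi0 = phi0.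
Variables (k1 k2 : nat) (tau1 tau2 : K -> C).
Hypotheses (htau1 : smooth_char tau1) (utau1 : unramified tau1)
  (htau2 : smooth_char tau2) (utau2 : unramified tau2).
Variable z : (hgrp K -> C) -> (G -> C) -> C.
Hypothesis hz : H_invariant_bilinear
  (induced_H (siegel_chi k1 tau1, siegel_chi k2 tau2) (@siegel_psi l R K, @siegel_psi l R K))
  (principal_series nu1 nu2 rho) z.
Local Notation V := (induced_H (siegel_chi k1 tau1, siegel_chi k2 tau2) (@siegel_psi l R K, @siegel_psi l R K)).
Local Notation I1 := (Defs.induced (siegel_chi k1 tau1) (@siegel_psi l R K)).
Local Notation I2 := (Defs.induced (siegel_chi k2 tau2) (@siegel_psi l R K)).
Local Notation q1 := (sq k1 tau1).
Local Notation q2 := (sq k2 tau2).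

Definition beta (s t : nat) (h1 h2 : gl2 K) (g : G) : C :=
  z (tens (rtrans h1 (q1 s)) (rtrans h2 (q2 t))) (rtrans g phi0).

Local Notation b0 := (beta 0 0 1%g 1%g).

Lemma tens_V f1 f2 : I1 f1 -> I2 f2 -> V (tens f1 f2).
Proof.
move=> h1 h2; exists 1%N, (fun=> f1), (fun=> f2); split=> //.
by apply: funext => h; rewrite big_ord1.
Qed.

Let Wg g : principal_series nu1 nu2 rho (rtrans g phi0).
Proof. exact: rtrans_principal. Qed.

Let Iq1 s h : I1 (rtrans h (q1 s)). Proof. exact: sq_induced. Qed.
Let Iq2 s h : I2 (rtrans h (q2 s)). Proof. exact: sq_induced. Qed.

Lemma z_lin1 f2 g : I2 f2 -> forall (a : C) f f', I1 f -> I1 f' ->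
  z (tens (fun x => a * f x + f' x) f2) (rtrans g phi0) =
  a * z (tens f f2) (rtrans g phi0) + z (tens f' f2) (rtrans g phi0).
Proof.
move=> h2 a f f' h h'; have [zl _ _] := hz; rewrite -zl; try exact: tens_V; last exact: Wg.
by congr z; apply: funext => x; rewrite /tens; ring.
Qed.

Lemma z_lin2 f1 g : I1 f1 -> forall (a : C) f f', I2 f -> I2 f' ->
  z (tens f1 (fun x => a * f x + f' x)) (rtrans g phi0) =
  a * z (tens f1 f) (rtrans g phi0) + z (tens f1 f') (rtrans g phi0).
Proof.
move=> h1 a f f' h h'; have [zl _ _] := hz; rewrite -zl; try exact: tens_V; last exact: Wg.
by congr z; apply: funext => x; rewrite /tens; ring.
Qed.

Lemma z_eigen f1 f2 (I : finType) (r : I -> G) (a : C) : I1 f1 -> I2 f2 ->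
  (forall x, \sum_i phi0 (x * r i)%g = a * phi0 x) ->
  \sum_i z (tens f1 f2) (rtrans (r i) phi0) = a * z (tens f1 f2) phi0.
Proof.
move=> h1 h2 E; have [_ zr _] := hz.
have lin : forall (c : C) f f', principal_series nu1 nu2 rho f -> principal_series nu1 nu2 rho f' ->
  z (tens f1 f2) (fun g => c * f g + f' g) = c * z (tens f1 f2) f + z (tens f1 f2) f'.
  by move=> *; apply: zr => //; exact: tens_V.
have sW := @principal_series_subspace l R K nu1 nu2 rho.
rewrite -(linZ sW lin) // -(lin_sum sW lin) //.
by congr (z _ _); apply: funext => x; rewrite -E.
Qed.

Lemma beta_emb s t h1 h2 (u : hgrp K) g :
  beta s t (u.1 * h1)%g (u.2 * h2)%g (emb u * g)%g = beta s t h1 h2 g.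
Proof.
have [_ _ zi] := hz; rewrite /beta -!rtransM -[RHS](zi u) //.
exact: tens_V.
Qed.

Lemma beta_coset s t h1 h2 (g g' : G) : gsp4_int (g^-1 * g')%g ->
  beta s t h1 h2 g' = beta s t h1 h2 g.
Proof. by move=> h; rewrite /beta -{2}(phi0_inv h) rtransM mulgA mulgV mul1g. Qed.

Lemma beta_level1 s t h1 h2 u g : gl2_level s u -> beta s t (h1 * u)%g h2 g = beta s t h1 h2 g.
Proof. by move=> h; rewrite /beta -(rtransM h1) (sq_level k1 htau1 utau1 h). Qed.

Lemma beta_level2 s t h1 h2 u g : gl2_level t u -> beta s t h1 (h2 * u)%g g = beta s t h1 h2 g.
Proof. by move=> h; rewrite /beta -(rtransM h2) (sq_level k2 htau2 utau2 h). Qed.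

Lemma beta_orbit s t h1 h2 (g g' : G) (u1 u2 : gl2 K) (X : 'M[K]_4) :
  \det (u1 : 'M[K]_2) = \det (u2 : 'M[K]_2) -> pabs (\det (u1 : 'M[K]_2)) = 1 ->
  gsp4_mx g *m X = gsp4_mx (emb (hp u1 u2)) *m gsp4_mx g' ->
  (forall i j, pabs (X i j) <= 1) -> pabs (simil g) = pabs (simil g') ->
  beta s t (u1 * h1)%g (u2 * h2)%g g = beta s t h1 h2 g'.
Proof.
move=> du d1 E iX es; rewrite -(beta_emb s t h1 h2 (hp u1 u2) g') hpE //=.
apply/esym/beta_coset; apply: (@coset_of_mx l R K g (emb (hp u1 u2) * g')%g X) => //.
by rewrite similM pabsM -es {2}/simil /= hpE //= d1 mul1r.
Qed.

Lemma beta_orbit11 s t (g g' : G) (u1 u2 : gl2 K) (X : 'M[K]_4) :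
  \det (u1 : 'M[K]_2) = \det (u2 : 'M[K]_2) -> gl2_level s u1 -> gl2_level t u2 ->
  gsp4_mx g *m X = gsp4_mx (emb (hp u1 u2)) *m gsp4_mx g' ->
  (forall i j, pabs (X i j) <= 1) -> pabs (simil g) = pabs (simil g') ->
  beta s t 1%g 1%g g = beta s t 1%g 1%g g'.
Proof.
move=> du v1 v2 E iX es; have [_ _ d1] := v1.
rewrite -(beta_orbit s t 1%g 1%g du d1 E iX es) !mulg1.
by rewrite -(beta_level1 _ _ _ _ v1) -(beta_level2 _ _ _ _ v2) !mul1g.
Qed.

Let hA1 := siegel_det_uchar k1 htau1 utau1.
Let hk1 := siegel_row_uchar k1 htau1 utau1.
Let hA2 := siegel_det_uchar k2 htau2 utau2.
Let hk2 := siegel_row_uchar k2 htau2 utau2.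
Local Notation X1 := (siegel_det k1 tau1 l%:R).
Local Notation X2 := (siegel_det k2 tau2 l%:R).
Local Notation y1 := (siegel_row k1 tau1 l%:R).
Local Notation y2 := (siegel_row k2 tau2 l%:R).

Let sI1 := @induced_subspace l R K (siegel_chi k1 tau1) (@siegel_psi l R K).
Let sI2 := @induced_subspace l R K (siegel_chi k2 tau2) (@siegel_psi l R K).

Lemma beta_hecke1 t h2 g : \sum_(j < l) beta 1 t (unip_lower j%:R) h2 g + beta 1 t weyl2 h2 g =
  (l%:R + y1) * beta 0 t 1%g h2 g.
Proof.
have lin := z_lin1 g (Iq2 t h2).
pose L f := z (tens f (rtrans h2 (q2 t))) (rtrans g phi0).
transitivity (L (fun x => \sum_(j < l) rtrans (unip_lower j%:R) (q1 1) x + rtrans weyl2 (q1 1) x)).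
  rewrite (@linD R _ I1 L lin) //; last exact: (subspace_sum sI1).
  by rewrite (@lin_sum R _ I1 L sI1 lin).
rewrite /beta -(linZ sI1 lin) //; congr (z (tens _ _) _); apply: funext => x.
by have := qsec_hecke (siegel_det k1 tau1) hk1 x; rewrite rtrans1 /rtrans /sq => <-.
Qed.

Lemma beta_hecke2 s h1 g : \sum_(j < l) beta s 1 h1 (unip_lower j%:R) g + beta s 1 h1 weyl2 g =
  (l%:R + y2) * beta s 0 h1 1%g g.
Proof.
have lin := z_lin2 g (Iq1 s h1).
pose L f := z (tens (rtrans h1 (q1 s)) f) (rtrans g phi0).
transitivity (L (fun x => \sum_(j < l) rtrans (unip_lower j%:R) (q2 1) x + rtrans weyl2 (q2 1) x)).
  rewrite (@linD R _ I2 L lin) //; last exact: (subspace_sum sI2).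
  by rewrite (@lin_sum R _ I2 L sI2 lin).
rewrite /beta -(linZ sI2 lin) //; congr (z (tens _ _) _); apply: funext => x.
by have := qsec_hecke (siegel_det k2 tau2) hk2 x; rewrite rtrans1 /rtrans /sq => <-.
Qed.

Lemma beta_recursion1 s t h2 g :
  \sum_(j < l) beta s.+2 t (unip_lower (j%:R * l%:R ^+ s.+1)) h2 g =
  (y1 + l%:R) * beta s.+1 t 1%g h2 g - y1 * beta s t 1%g h2 g.
Proof.
have lin := z_lin1 g (Iq2 t h2).
pose L f := z (tens f (rtrans h2 (q2 t))) (rtrans g phi0).
transitivity (L (fun x => \sum_(j < l) rtrans (unip_lower (j%:R * l%:R ^+ s.+1)) (q1 s.+2) x)).
  by rewrite (@lin_sum R _ I1 L sI1 lin).
rewrite -mulNr /beta -(linZ sI1 lin (- y1)) // -lin //; last first.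
  have [I0 ID] := sI1; rewrite (_ : (fun _ => _) = (fun x => - y1 * rtrans 1%g (q1 s) x + 0)).
    exact: ID.
  by apply: funext => x; rewrite addr0.
congr (z (tens _ _) _); apply: funext => x.
by have := qsec_recursion (siegel_det k1 tau1) hk1 s x; rewrite !rtrans1 mulNr /rtrans /sq => <-.
Qed.

Lemma beta_recursion2 s t h1 g :
  \sum_(j < l) beta s t.+2 h1 (unip_lower (j%:R * l%:R ^+ t.+1)) g =
  (y2 + l%:R) * beta s t.+1 h1 1%g g - y2 * beta s t h1 1%g g.
Proof.
have lin := z_lin2 g (Iq1 s h1).
pose L f := z (tens (rtrans h1 (q1 s)) f) (rtrans g phi0).
transitivity (L (fun x => \sum_(j < l) rtrans (unip_lower (j%:R * l%:R ^+ t.+1)) (q2 t.+2) x)).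
  by rewrite (@lin_sum R _ I2 L sI2 lin).
rewrite -mulNr /beta -(linZ sI2 lin (- y2)) // -lin //; last first.
  have [I0 ID] := sI2; rewrite (_ : (fun _ => _) = (fun x => - y2 * rtrans 1%g (q2 t) x + 0)).
    exact: ID.
  by apply: funext => x; rewrite addr0.
congr (z (tens _ _) _); apply: funext => x.
by have := qsec_recursion (siegel_det k2 tau2) hk2 t x; rewrite !rtrans1 mulNr /rtrans /sq => <-.
Qed.

Lemma beta_scale1 s t s' u u' a h1 h2 g : (forall x, q1 s (x * u)%g = a * q1 s' (x * u')%g) ->
  beta s t (h1 * u)%g h2 g = a * beta s' t (h1 * u')%g h2 g.
Proof.
move=> E; rewrite /beta -(linZ sI1 (z_lin1 g (Iq2 t h2))) //.
by congr (z (tens _ _) _); apply: funext => x; rewrite /rtrans !mulgA.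
Qed.

Lemma beta_scale2 s t t' u u' a h1 h2 g : (forall x, q2 t (x * u)%g = a * q2 t' (x * u')%g) ->
  beta s t h1 (h2 * u)%g g = a * beta s t' h1 (h2 * u')%g g.
Proof.
move=> E; rewrite /beta -(linZ sI2 (z_lin2 g (Iq1 s h1))) //.
by congr (z (tens _ _) _); apply: funext => x; rewrite /rtrans !mulgA.
Qed.

Lemma beta_diagl1 s t h1 h2 g :
  beta s t (h1 * diag2 l%:R^-1 1)%g h2 g = l%:R^-1 * beta s.+1 t h1 h2 g.
Proof.
rewrite (beta_scale1 t (s' := s.+1) (u' := 1%g) (a := l%:R^-1)) ?mulg1 // => x.
by rewrite /sq mulg1 (qsec_diagl hA1 hk1) siegel_detM_row.
Qed.

Lemma beta_diagl2 s t h1 h2 g :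
  beta s t h1 (h2 * diag2 l%:R^-1 1)%g g = l%:R^-1 * beta s t.+1 h1 h2 g.
Proof.
rewrite (beta_scale2 s (t' := t.+1) (u' := 1%g) (a := l%:R^-1)) ?mulg1 // => x.
by rewrite /sq mulg1 (qsec_diagl hA2 hk2) siegel_detM_row.
Qed.

Lemma beta_diagr2 s h1 h2 g :
  beta s 0 h1 (h2 * diag2 1 l%:R^-1)%g g = l%:R^-1 * beta s 1 h1 (h2 * weyl2)%g g.
Proof.
apply: beta_scale2 => x.
by rewrite /sq (qsec_diagr hA2 hk2) siegel_detM_row.
Qed.

Lemma beta_scalar1 s t h1 h2 g :
  beta s t (h1 * diag2 l%:R^-1 l%:R^-1)%g h2 g = (l%:R * X1)^-1 * beta s t h1 h2 g.
Proof.
rewrite (beta_scale1 t (s' := s) (u' := 1%g) (a := (l%:R * X1)^-1)) ?mulg1 // => x.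
by rewrite /sq mulg1 (qsec_scalar hA1 hk1) expr2 -mulrA siegel_detM_row // [_ * l%:R]mulrC.
Qed.

Lemma beta_scalar2 s t h1 h2 g :
  beta s t h1 (h2 * diag2 l%:R^-1 l%:R^-1)%g g = (l%:R * X2)^-1 * beta s t h1 h2 g.
Proof.
rewrite (beta_scale2 s (t' := t) (u' := 1%g) (a := (l%:R * X2)^-1)) ?mulg1 // => x.
by rewrite /sq mulg1 (qsec_scalar hA2 hk2) expr2 -mulrA siegel_detM_row // [_ * l%:R]mulrC.
Qed.

Local Notation alpha s t := (beta s t 1%g 1%g 1%g).

Lemma beta_K s t u1 u2 : gl2_int u1 -> gl2_int u2 ->
  \det (u1 : 'M[K]_2) = \det (u2 : 'M[K]_2) -> beta s t u1 u2 1%g = alpha s t.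
Proof.
move=> i1 i2 du; have [_ d1] := i1; rewrite -{1}(mulg1 u1) -{1}(mulg1 u2).
apply: (@beta_orbit s t 1%g 1%g 1%g 1%g u1 u2 (gsp4_mx (emb (hp u1 u2)))) => //.
  by rewrite mul1mx mulmx1.
have /gsp4_intP[h _] : gsp4_int (emb (hp u1 u2)) by apply: emb_int; rewrite hpE.
exact: h.
Qed.

Lemma unip_lower_int (c : K) : pabs c <= 1 -> gl2_int (unip_lower c).
Proof.
move=> c1; rewrite /gl2_int unip_lowerE det_mx2_of mulr1 mul0r subr0 pabs1; split=> // i j.
rewrite mxE; case: i => [[|[|?]] ?] //; case: j => [[|[|?]] ?] //=; by rewrite ?pabs0 ?pabs1.
Qed.

Lemma det_unip_lower (c : K) : \det (unip_lower c : 'M[K]_2) = 1.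
Proof. by rewrite unip_lowerE det_mx2_of mulr1 mul0r subr0. Qed.

Lemma det_weyl2 : \det (weyl2 : 'M[K]_2) = 1.
Proof. by rewrite weyl2E det_mx2_of mulr0 mul1r sub0r opprK. Qed.

Lemma det_gl2_1 : \det ((1%g : gl2 K) : 'M[K]_2) = 1.
Proof. exact: det1. Qed.

Lemma sum_ord_const (c : C) : \sum_(j < l) c = l%:R * c.
Proof. by rewrite sumr_const card_ord mulr_natl. Qed.

Lemma alpha_1t t : (l%:R + 1) * alpha 1 t = (l%:R + y1) * alpha 0 t.
Proof.
have i1 := gl2_int1 K; rewrite -beta_hecke1 mulrDl mul1r -sum_ord_const; congr (_ + _).
  apply: eq_bigr => j _; rewrite beta_K ?det_unip_lower ?det_gl2_1 //.
  exact/unip_lower_int/pabs_nat_le1.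
by rewrite beta_K ?det_weyl2 ?det_gl2_1 //; exact: weyl2_int.
Qed.

Lemma alpha_s1 s : (l%:R + 1) * alpha s 1 = (l%:R + y2) * alpha s 0.
Proof.
have i1 := gl2_int1 K; rewrite -beta_hecke2 mulrDl mul1r -sum_ord_const; congr (_ + _).
  apply: eq_bigr => j _; rewrite beta_K ?det_unip_lower ?det_gl2_1 //.
  exact/unip_lower_int/pabs_nat_le1.
by rewrite beta_K ?det_weyl2 ?det_gl2_1 //; exact: weyl2_int.
Qed.

Lemma alpha_rec1 s t : l%:R * alpha s.+2 t = (y1 + l%:R) * alpha s.+1 t - y1 * alpha s t.
Proof.
rewrite -beta_recursion1 -sum_ord_const; apply: eq_bigr => j _.
rewrite beta_K ?det_unip_lower ?det_gl2_1 //; last exact: gl2_int1.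
apply: unip_lower_int; intg.
Qed.

Lemma alpha_rec2 s t : l%:R * alpha s t.+2 = (y2 + l%:R) * alpha s t.+1 - y2 * alpha s t.
Proof.
rewrite -beta_recursion2 -sum_ord_const; apply: eq_bigr => j _.
rewrite beta_K ?det_unip_lower ?det_gl2_1 //; first exact: gl2_int1.
apply: unip_lower_int; intg.
Qed.

Lemma diag2_mulV (a d : K) : a != 0 -> d != 0 -> (diag2 a d * diag2 a^-1 d^-1 = 1)%g.
Proof.
move=> a0 d0; apply: val_inj; rewrite /= !diag2E ?invr_neq0 //.
apply/matrixP => i j; rewrite mulmx2E !mxE.
case: i => [[|[|?]] ?] //; case: j => [[|[|?]] ?] //=;
  by rewrite ?(mulr0, mul0r, addr0, add0r) ?mulfV.
Qed.

Lemma beta_torus s t h1 h2 (a d a' d' : K) g : a != 0 -> d != 0 -> a' != 0 -> d' != 0 ->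
  a * d = a' * d' ->
  beta s t h1 h2 (emb (hp (diag2 a d) (diag2 a' d')) * g)%g =
  beta s t (diag2 a^-1 d^-1 * h1)%g (diag2 a'^-1 d'^-1 * h2)%g g.
Proof.
move=> a0 d0 a0' d0' E.
have D : \det (diag2 a d : 'M[K]_2) = \det (diag2 a' d' : 'M[K]_2).
  by rewrite !diag2E // !det_mx2_of !mulr0 !subr0.
rewrite -(beta_emb s t _ _ (hp (diag2 a d) (diag2 a' d')) g) hpE //=.
by rewrite !mulgA !diag2_mulV // !mul1g.
Qed.

Let l0 := l_neq0 K.

Lemma beta_split s t : beta s t 1%g 1%g (emb (hp (diag2 lK 1) (diag2 lK 1))) =
  l%:R ^- 2 * alpha s.+1 t.+1.
Proof.
rewrite -[emb _]mulg1 beta_torus ?oner_neq0 // !mulg1 invr1.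
rewrite -{1}(mul1g (diag2 _ _)) beta_diagl1 -{1}(mul1g (diag2 _ _)) beta_diagl2.
by rewrite mulrA -invfM expr2.
Qed.

Lemma beta_split1 : b0 (emb (hp (diag2 (lK ^+ 2) 1) (diag2 lK lK))) =
  l%:R ^- 2 * (l%:R * X2)^-1 * alpha 2 0.
Proof.
have l20 : lK ^+ 2 != 0 by rewrite expf_neq0.
rewrite -[emb _]mulg1 beta_torus ?oner_neq0 //; last by rewrite mulr1.
rewrite !mulg1 invr1.
have -> : diag2 (lK ^- 2) 1 = (diag2 lK^-1 1 * diag2 lK^-1 1)%g.
  apply: val_inj; rewrite /= !diag2E ?invr_neq0 ?oner_neq0 //.
  apply/matrixP => i j; rewrite mulmx2E !mxE.
  case: i => [[|[|?]] ?] //; case: j => [[|[|?]] ?] //=;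
    by rewrite ?(mulr0, mul0r, mulr1, addr0, add0r) // -invfM expr2.
rewrite beta_diagl1 -{1}(mul1g (diag2 lK^-1 1)) beta_diagl1.
by rewrite -{1}(mul1g (diag2 _ _)) beta_scalar2 !mulrA -invfM expr2.
Qed.

Lemma beta_split2 : b0 (emb (hp (diag2 lK lK) (diag2 (lK ^+ 2) 1))) =
  l%:R ^- 2 * (l%:R * X1)^-1 * alpha 0 2.
Proof.
have l20 : lK ^+ 2 != 0 by rewrite expf_neq0.
rewrite -[emb _]mulg1 beta_torus ?oner_neq0 //; last by rewrite mulr1.
rewrite !mulg1 invr1.
have -> : diag2 (lK ^- 2) 1 = (diag2 lK^-1 1 * diag2 lK^-1 1)%g.
  apply: val_inj; rewrite /= !diag2E ?invr_neq0 ?oner_neq0 //.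
  apply/matrixP => i j; rewrite mulmx2E !mxE.
  case: i => [[|[|?]] ?] //; case: j => [[|[|?]] ?] //=;
    by rewrite ?(mulr0, mul0r, mulr1, addr0, add0r) // -invfM expr2.
rewrite beta_diagl2 -{1}(mul1g (diag2 lK^-1 1)) beta_diagl2.
by rewrite -{1}(mul1g (diag2 _ _)) beta_scalar1 !mulrA -invfM expr2.
Qed.

Lemma beta_xi g : b0 (emb (hp (diag2 lK 1) (diag2 1 lK)) * g)%g =
  l%:R ^- 2 * beta 1 1 1%g weyl2 g.
Proof.
rewrite beta_torus ?oner_neq0 //; last by rewrite mulr1 mul1r.
rewrite !mulg1 invr1 -{1}(mul1g (diag2 _ _)) beta_diagl1 -{1}(mul1g (diag2 _ _)) beta_diagr2.
by rewrite mul1g mulrA -invfM expr2.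
Qed.

Definition eta_mx : 'M[K]_4 := upm lK 0 1 0 lK 0 1 1 0 1.
Definition eta : G := gs eta_mx lK.

Lemma etaE : gsp4_mx eta = eta_mx /\ simil eta = lK.
Proof. by apply: gsE; apply: upm_gsp4 => //; ring. Qed.

Definition emb4 (a b c d a' b' c' d' : K) : 'M[K]_4 :=
  m4 a 0 0 b 0 a' b' 0 0 c' d' 0 c 0 0 d.

Lemma emb4E a b c d a' b' c' d' : a * d - b * c != 0 -> a * d - b * c = a' * d' - b' * c' ->
  gsp4_mx (emb (hp (gl2_of a b c d) (gl2_of a' b' c' d'))) = emb4 a b c d a' b' c' d' /\
  simil (emb (hp (gl2_of a b c d) (gl2_of a' b' c' d'))) = a * d - b * c.
Proof.
move=> n0 E; have n0' := n0; rewrite E in n0'.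
have H : hpair (hp (gl2_of a b c d) (gl2_of a' b' c' d')) = (gl2_of a b c d, gl2_of a' b' c' d').
  by apply: hpE; rewrite !gl2_ofE // !det_mx2_of.
by rewrite emb_mxE /simil /= H /= !gl2_ofE // det_mx2_of !mxE.
Qed.

Lemma gl2_of_level t a b c d : pabs a <= 1 -> pabs b <= 1 -> pabs c <= 1 -> pabs d <= 1 ->
  pabs c <= lR ^- t -> pabs (a * d - b * c) = 1 -> gl2_level t (gl2_of a b c d : gl2 K).
Proof.
move=> ia ib ic id lc D; have n0 := unit_neq0 D.
rewrite /gl2_level gl2_ofE // det_mx2_of; split=> //; last by rewrite mxE.
by move=> i j; rewrite mxE; case: i => [[|[|?]] ?] //; case: j => [[|[|?]] ?] //=.
Qed.

Lemma beta_move s t (g g' : G) a b c d a' b' c' d' X :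
  pabs a <= 1 /\ pabs b <= 1 -> pabs c <= 1 /\ pabs d <= 1 ->
  pabs a' <= 1 /\ pabs b' <= 1 -> pabs c' <= 1 /\ pabs d' <= 1 ->
  pabs c <= lR ^- s -> pabs c' <= lR ^- t -> pabs (a * d - b * c) = 1 ->
  a * d - b * c = a' * d' - b' * c' ->
  gsp4_mx g *m X = emb4 a b c d a' b' c' d' *m gsp4_mx g' ->
  (forall i j, pabs (X i j) <= 1) -> pabs (simil g) = pabs (simil g') ->
  beta s t 1%g 1%g g = beta s t 1%g 1%g g'.
Proof.
move=> [ia ib] [ic id] [ia' ib'] [ic' id'] ls lt D DD E iX es.
have n0 := unit_neq0 D; have n0' := n0; rewrite DD in n0'; have [EE _] := emb4E n0 DD.
apply: (@beta_orbit11 s t g g' (gl2_of a b c d) (gl2_of a' b' c' d') X) => //.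
- by rewrite !gl2_ofE // !det_mx2_of.
- exact: gl2_of_level.
- by apply: gl2_of_level; rewrite // -DD.
- by rewrite E EE.
Qed.

Lemma beta0_move (g g' : G) a b c d a' b' c' d' X :
  pabs a <= 1 /\ pabs b <= 1 -> pabs c <= 1 /\ pabs d <= 1 ->
  pabs a' <= 1 /\ pabs b' <= 1 -> pabs c' <= 1 /\ pabs d' <= 1 ->
  pabs (a * d - b * c) = 1 -> a * d - b * c = a' * d' - b' * c' ->
  gsp4_mx g *m X = emb4 a b c d a' b' c' d' *m gsp4_mx g' ->
  (forall i j, pabs (X i j) <= 1) -> pabs (simil g) = pabs (simil g') ->
  b0 g = b0 g'.
Proof.
move=> h1 h2 h3 h4; have [ic _] := h2; have [ic' _] := h4.
by apply: beta_move => //; rewrite expr0 invr1.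
Qed.

Lemma emb_diagE (a d a' d' : K) : a != 0 -> d != 0 -> a * d = a' * d' ->
  gsp4_mx (emb (hp (diag2 a d) (diag2 a' d'))) = upm a 0 0 0 a' 0 0 d' 0 d /\
  simil (emb (hp (diag2 a d) (diag2 a' d'))) = a * d.
Proof.
move=> a0 d0 E; have [| |-> ->] := @emb4E a 0 0 d a' 0 0 d'.
- by rewrite mul0r subr0 mulf_neq0.
- by rewrite !mul0r !subr0.
- by rewrite mul0r subr0.
Qed.

Local Notation dsp := (emb (hp (diag2 lK 1) (diag2 lK 1))).
Local Notation dsp1 := (emb (hp (diag2 (lK ^+ 2) 1) (diag2 lK lK))).
Local Notation dsp2 := (emb (hp (diag2 lK lK) (diag2 (lK ^+ 2) 1))).
Local Notation xi := (emb (hp (diag2 lK 1) (diag2 1 lK)) * eta)%g.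

Lemma dspE : gsp4_mx dsp = upm lK 0 0 0 lK 0 0 1 0 1 /\ simil dsp = lK.
Proof. by have [||| -> ->] := @emb_diagE lK 1 lK 1; rewrite ?oner_neq0 ?mulr1. Qed.

Lemma dsp1E : gsp4_mx dsp1 = upm (lK ^+ 2) 0 0 0 lK 0 0 lK 0 1 /\ simil dsp1 = lK ^+ 2.
Proof.
by have [||| -> ->] := @emb_diagE (lK ^+ 2) 1 lK lK; rewrite ?oner_neq0 ?expf_neq0 ?mulr1.
Qed.

Lemma dsp2E : gsp4_mx dsp2 = upm lK 0 0 0 (lK ^+ 2) 0 0 1 0 lK /\ simil dsp2 = lK ^+ 2.
Proof. by have [||| -> ->] := @emb_diagE lK lK (lK ^+ 2) 1; rewrite ?oner_neq0 ?mulr1. Qed.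

Lemma xiE : gsp4_mx xi = upm (lK ^+ 2) 0 lK 0 lK 0 1 lK 0 1 /\ simil xi = lK ^+ 2.
Proof.
rewrite gsp4_mxM similM; have [-> ->] := etaE.
have [||| -> ->] := @emb_diagE lK 1 1 lK; rewrite ?oner_neq0 ?mulr1 ?mul1r //.
by split=> //; rewrite /eta_mx upm_mul; congr upm; ring.
Qed.

Lemma pabs_ord_unit (u : 'I_l) : (u == 0 :> nat) = false -> pabs (u%:R : K) = 1.
Proof. by move=> /negbT u0; apply: pabs_unit_nat; rewrite lt0n u0 ltn_ord. Qed.

Ltac int2 := by split; intg.
Ltac int_m4 := by apply: (m4_forall (P := fun x => pabs x <= 1)); intg.
Ltac mul4 := rewrite /eta_mx /upm /emb4 !m4_mul; m4_eq.

Lemma beta_unip s t (g : G) (u v w : 'I_l) :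
  gsp4_mx g = upm lK 0 u%:R v%:R lK w%:R u%:R 1 0 1 -> simil g = lK ->
  beta s t 1%g 1%g g = if u == 0 :> nat then beta s t 1%g 1%g dsp else beta s t 1%g 1%g eta.
Proof.
move=> Eg sg; have V n : 0 <= lR ^- n by exact/ltW/(pabs_lexp_gt0 K).
case: (boolP (u == 0 :> nat)) => [/eqP u0|/negbTE /pabs_ord_unit uu].
  have [Ed sd] := dspE.
  apply: (@beta_move s t g dsp 1 v%:R 0 1 1 w%:R 0 1
    (m4 1 0 0 0 0 1 0 0 0 0 1 0 0 0 0 1)); try int2; rewrite ?pabs0 ?sg ?sd //.
  - by rewrite mulr0 subr0 mulr1 pabs1.
  - by ring.
  - by rewrite Eg Ed u0; mul4; ring.
  - by int_m4.
have [Ed sd] := etaE.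
apply: (@beta_move s t g eta u%:R v%:R 0 1 u%:R w%:R 0 1
    (m4 u%:R 0 0 0 0 u%:R 0 0 0 0 1 0 0 0 0 1)); try int2; rewrite ?pabs0 ?sg ?sd //.
- by rewrite mulr0 subr0 mulr1.
- by ring.
- by rewrite Eg Ed; mul4; ring.
- by int_m4.
Qed.

Lemma T_orbit i : b0 (T_rep K i) = match i with
  | inl (inl p) => if p.1.1 == 0 :> nat then b0 dsp else b0 eta
  | inl (inr p) => if p.1 == 0 :> nat then b0 dsp else b0 eta
  | inr _ => b0 dsp
  end.
Proof.
have [Ed sd] := dspE; have [Ee se] := etaE.
have := T_repE K i; case: i => [[[[u v] w]|[p v]]|[w|[]]] [/= Eg sg].
- by rewrite (beta_unip 0 0 Eg sg).
- case: (boolP (p == 0 :> nat)) => [/eqP p0|/negbTE /pabs_ord_unit up].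
    apply: (@beta0_move _ dsp 1 v%:R 0 1 0 1 (-1) 0
      (m4 1 0 0 0 0 0 1 0 0 (-1) 0 0 0 0 0 1)); try int2; rewrite ?sg ?sd //.
    + by rewrite mulr0 subr0 mulr1 pabs1.
    + by ring.
    + by rewrite Eg Ed p0; mul4; ring.
    + by int_m4.
  apply: (@beta0_move _ eta (- p%:R) v%:R 0 1 0 (-1) (- p%:R) 0
      (m4 (- p%:R) 0 0 0 0 0 (-1) 0 0 (- p%:R) 0 0 0 0 0 1)); try int2; rewrite ?sg ?se //.
  + by rewrite mulr0 subr0 mulr1 pabsN.
  + by ring.
  + by rewrite Eg Ee; mul4; ring.
  + by int_m4.
- apply: (@beta0_move _ dsp 0 1 (-1) 0 1 w%:R 0 1
      (m4 0 0 0 1 0 1 0 0 0 0 1 0 (-1) 0 0 0)); try int2; rewrite ?sg ?sd //.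
  + by rewrite mulr0 mul1r sub0r opprK pabs1.
  + by ring.
  + by rewrite Eg Ed; mul4; ring.
  + by int_m4.
- apply: (@beta0_move _ dsp 0 1 (-1) 0 0 1 (-1) 0
      (m4 0 0 0 1 0 0 1 0 0 (-1) 0 0 (-1) 0 0 0)); try int2; rewrite ?sg ?sd //.
  + by rewrite mulr0 mul1r sub0r opprK pabs1.
  + by rewrite Eg Ed; mul4; ring.
  + by int_m4.
Qed.

Lemma T1_orbit i : b0 (T1_rep K i) = match i with
  | inl (inl (inl _)) => b0 dsp1
  | inl (inl (inr p)) => if p == 0 :> nat then b0 dsp2 else b0 xi
  | inl (inr (inl p)) => if p.1 == 0 :> nat then b0 dsp2 else b0 xi
  | inl (inr (inr p)) => if (p.1.1 == 0 :> nat) && (p.1.2 == 0 :> nat)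
      then b0 dsp1 else b0 xi
  | inr (inl p) => if p.2 == 0 :> nat then b0 dsp2 else b0 xi
  | inr (inr _) => b0 dsp1
  end.
Proof.
have [Ed1 sd1] := dsp1E; have [Ed2 sd2] := dsp2E; have [Ex sx] := xiE.
have := T1_repE K i; case: i => [[[[]|p]|[[u w]|[[p u] v]]]|[[s a]|s]] [/= Eg sg].
- apply: (@beta0_move _ dsp1 0 1 (-1) 0 1 0 0 1
      (m4 0 0 0 1 0 1 0 0 0 0 1 0 (-1) 0 0 0)); try int2; rewrite ?sg ?sd1 //.
  + by rewrite mulr0 mul1r sub0r opprK pabs1.
  + by ring.
  + by rewrite Eg Ed1; mul4; ring.
  + by int_m4.
- case: (boolP (p == 0 :> nat)) => [/eqP p0|/negbTE /pabs_ord_unit up].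
    apply: (@beta0_move _ dsp2 1 0 0 1 0 1 (-1) 0
      (m4 1 0 0 0 0 0 1 0 0 (-1) 0 0 0 0 0 1)); try int2; rewrite ?sg ?sd2 //.
    + by rewrite mulr0 subr0 mulr1 pabs1.
    + by ring.
    + by rewrite Eg Ed2 p0; mul4; ring.
    + by int_m4.
  have np := unit_neq0 up; move: up np Eg; move: (p%:R : K) => P up np Eg.
  apply: (@beta0_move _ xi 0 P (- P^-1) 0 1 0 0 1
    (m4 0 (- P) 0 0 0 lK 0 1 (-1) 0 0 0 (- (lK / P)) 0 (- P^-1) 0));
    try int2; rewrite ?sg ?sx //.
  + by rewrite mul0r sub0r mulrN opprK mulfV // pabs1.
  + by field.
  + by rewrite Eg Ex; mul4; field.
  + by int_m4.
- case: (boolP (u == 0 :> nat)) => [/eqP u0|/negbTE /pabs_ord_unit uu].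
    apply: (@beta0_move _ dsp2 1 0 0 1 1 w%:R 0 1
      (m4 1 0 0 0 0 1 0 0 0 0 1 0 0 0 0 1)); try int2; rewrite ?sg ?sd2 //.
    + by rewrite mulr0 subr0 mulr1 pabs1.
    + by ring.
    + by rewrite Eg Ed2 u0; mul4; ring.
    + by int_m4.
  have nu := unit_neq0 uu; move: uu nu Eg; move: (u%:R : K) => U uu nu Eg.
  apply: (@beta0_move _ xi 0 U (- U^-1) 0 w%:R (-1) 1 0
    (m4 0 (- U) 0 0 1 0 0 0 0 lK 0 1 (- (lK / U)) 0 (- U^-1) 0));
    try int2; rewrite ?sg ?sx //.
  + by rewrite mul0r sub0r mulrN opprK mulfV // pabs1.
  + by field.
  + by rewrite Eg Ex; mul4; field.
  + by int_m4.
- case: (boolP ((p == 0 :> nat) && (u == 0 :> nat))) => [/andP[/eqP p0 /eqP u0]|pu].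
    apply: (@beta0_move _ dsp1 1 v%:R 0 1 1 0 0 1
      (m4 1 0 0 0 0 1 0 0 0 0 1 0 0 0 0 1)); try int2; rewrite ?sg ?sd1 //.
    + by rewrite mulr0 subr0 mulr1 pabs1.
    + by ring.
    + by rewrite Eg Ed1 p0 u0; mul4; ring.
    + by int_m4.
  have [b [d [ib id bd]]] : exists b d : K,
      [/\ pabs b <= 1, pabs d <= 1 & u%:R * d + p%:R * b = 1].
    case: (boolP (u == 0 :> nat)) pu => [/eqP u0|/negbTE /pabs_ord_unit uu _].
      rewrite andbT => /negbTE /pabs_ord_unit up; exists (p%:R^-1), 0.
      by split; [intg|intg|rewrite mulr0 add0r mulfV // unit_neq0].
    by exists 0, (u%:R^-1); split; [intg|intg|rewrite mulr0 addr0 mulfV // unit_neq0].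
  have Ebd : lK = lK * (u%:R * d + p%:R * b) by rewrite bd mulr1.
  apply: (@beta0_move _ xi 1 v%:R 0 1 u%:R b (- p%:R) d
    (m4 1 0 0 0 0 u%:R b 0 0 (- p%:R) d 0 0 0 0 1)); try int2; rewrite ?sg ?sx //.
  + by rewrite mulr0 subr0 mulr1 pabs1.
  + by rewrite mulr0 subr0 mulr1 -[LHS]bd; ring.
  + rewrite Eg Ex; mul4; try ring.
    by rewrite [in RHS]Ebd; ring.
  + by int_m4.
- have us : pabs (s.+1%:R : K) = 1 by exact: pabs_succ_ord.
  case: (boolP (a == 0 :> nat)) => [/eqP a0|/negbTE /pabs_ord_unit ua].
    rewrite a0 in Eg; have ns := unit_neq0 us; move: us ns Eg; move: (s.+1%:R : K) => S us ns Eg.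
    apply: (@beta0_move _ dsp2 1 0 0 1 0 S (- S^-1) lK
      (m4 1 0 0 0 0 1 0 0 0 (- (lK / S)) 1 0 0 0 0 1)); try int2; rewrite ?sg ?sd2 //.
    + by rewrite mulr0 subr0 mulr1 pabs1.
    + by field.
    + by rewrite Eg Ed2; mul4; field.
    + by int_m4.
  have ns := unit_neq0 us; move: us ns Eg; move: (s.+1%:R : K) => S us ns Eg.
  have na := unit_neq0 ua; move: ua na Eg; move: (a%:R : K) => A ua na Eg.
  apply: (@beta0_move _ xi 0 (S * A) (- (S^-1 * A^-1)) 0 S 0 lK S^-1
    (m4 A (- (S * A)) 0 0 1 0 0 0 0 lK S^-1 1 (- (lK * (S^-1 * A^-1))) 0 (- (S^-1 * A^-1)) 0));
    try int2; rewrite ?sg ?sx //.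
  + have -> : 0 * 0 - S * A * - (S^-1 * A^-1) = 1 by field; rewrite ns na.
    exact: pabs1.
  + by field; rewrite ns na.
  + by rewrite Eg Ex; mul4; field; rewrite ?ns ?na.
  + by int_m4.
- have us : pabs (s.+1%:R : K) = 1 by exact: pabs_succ_ord.
  have ns := unit_neq0 us; move: us ns Eg; move: (s.+1%:R : K) => S us ns Eg.
  apply: (@beta0_move _ dsp1 0 S (- S^-1) lK 1 0 0 1
    (m4 1 0 0 0 0 1 0 0 0 0 1 0 (- (lK / S)) 0 0 1)); try int2; rewrite ?sg ?sd1 //.
  + by rewrite mul0r sub0r mulrN opprK mulfV // pabs1.
  + by field.
  + by rewrite Eg Ed1; mul4; field.
  + by int_m4.
Qed.

Lemma sum_pair_fst (I J : finType) (F : I -> C) :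
  \sum_(p : I * J) F p.1 = #|J|%:R * \sum_i F i.
Proof.
rewrite -(pair_bigA _ (fun i (_ : J) => F i)) mulr_sumr /=; apply: eq_bigr => i _.
by rewrite sumr_const mulr_natl.
Qed.

Lemma sum_pair_snd (I J : finType) (F : J -> C) :
  \sum_(p : I * J) F p.2 = #|I|%:R * \sum_j F j.
Proof.
rewrite -(pair_bigA _ (fun (_ : I) j => F j)) /= sumr_const mulr_natl.
by [].
Qed.

Lemma sum_ord_if0 (a b : C) :
  \sum_(u < l) (if u == 0 :> nat then a else b) = a + (l%:R - 1) * b.
Proof.
have := ltnW (l_gt1 K); case: (l) => // n _.
rewrite big_ord_recl /= (eq_bigr (fun=> b)) // sumr_const card_ord -[b *+ n]mulr_natl.
by rewrite -natr1 addrK.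
Qed.

Lemma T_sum : \sum_i b0 (T_rep K i) =
  (l%:R + 1) ^+ 2 * b0 dsp + l%:R * (l%:R ^+ 2 - 1) * b0 eta.
Proof.
rewrite (eq_bigr _ (fun i _ => T_orbit i)) !big_sumType /=.
move: (b0 dsp) (b0 eta) => a b.
rewrite (sum_pair_fst _ (fun p : 'I_l * 'I_l => if p.1 == 0 :> nat then a else b)).
rewrite !(sum_pair_fst _ (fun u : 'I_l => if u == 0 :> nat then a else b)) !sum_ord_if0.
rewrite !sumr_const card_unit !card_ord -[a *+ l]mulr_natl -[a *+ 1]mulr_natl; ring.
Qed.

Lemma T1_sum : \sum_i b0 (T1_rep K i) =
  l%:R * (l%:R + 1) * (b0 dsp1 + b0 dsp2
    + (l%:R ^+ 2 - 1) * b0 xi).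
Proof.
rewrite (eq_bigr _ (fun i _ => T1_orbit i)) !big_sumType /=.
move: (b0 dsp1) (b0 dsp2) (b0 xi) => a1 a2 b.
rewrite (sum_pair_fst _ (fun u : 'I_l => if u == 0 :> nat then a2 else b)).
rewrite (sum_pair_snd _ (fun u : 'I_l => if u == 0 :> nat then a2 else b)).
rewrite (sum_pair_fst _ (fun p : 'I_l * 'I_l =>
  if (p.1 == 0 :> nat) && (p.2 == 0 :> nat) then a1 else b)).
rewrite -(pair_bigA _ (fun i j : 'I_l => if (i == 0 :> nat) && (j == 0 :> nat) then a1 else b)) /=.
have -> : \sum_(i < l) \sum_(j < l) (if (i == 0 :> nat) && (j == 0 :> nat) then a1 else b) =
    a1 + (l%:R - 1) * b + (l%:R - 1) * (l%:R * b).
  rewrite -sum_ord_if0; apply: eq_bigr => i _.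
  by case: (i == 0 :> nat); rewrite /= ?sum_ord_if0 ?sum_ord_const.
rewrite !sum_ord_if0 !sumr_const card_unit !card_ord -subn1.
rewrite -[a1 *+ (l - 1)]mulr_natl -[a1 *+ 1]mulr_natl !natrM natrB ?(ltnW (l_gt1 K)) //; ring.
Qed.

Lemma upper_level t (j : 'I_l) : gl2_level t (gl2_of 1 j%:R 0 1 : gl2 K).
Proof.
apply: gl2_of_level; intg; first by rewrite pabs0; exact/ltW/(pabs_lexp_gt0 K).
by rewrite mulr0 subr0 mulr1 pabs1.
Qed.

Lemma eta_stab s t h1 h2 a b c d a' b' c' d' X :
  pabs (a * d - b * c) = 1 -> a * d - b * c = a' * d' - b' * c' ->
  eta_mx *m X = emb4 a b c d a' b' c' d' *m eta_mx ->
  (forall i j, pabs (X i j) <= 1) ->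
  beta s t (gl2_of a b c d * h1)%g (gl2_of a' b' c' d' * h2)%g eta = beta s t h1 h2 eta.
Proof.
move=> D DD E iX; have [Ee _] := etaE; have n0 := unit_neq0 D.
have n0' := n0; rewrite DD in n0'; have [EE _] := emb4E n0 DD.
apply: (@beta_orbit s t h1 h2 eta eta (gl2_of a b c d) (gl2_of a' b' c' d') X) => //.
- by rewrite !gl2_ofE // !det_mx2_of.
- by rewrite gl2_ofE // det_mx2_of.
- by rewrite Ee EE E.
Qed.

Lemma eta_lower1 s t (j : 'I_l) : beta s t (unip_lower j%:R) 1%g eta = beta s t 1%g 1%g eta.
Proof.
rewrite -(@beta_level2 s t (unip_lower j%:R) 1%g _ eta (upper_level t j)) mul1g.
rewrite -{1}(mulg1 (unip_lower _)) -{1}(mulg1 (gl2_of _ _ _ _)).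
apply: (@eta_stab s t 1%g 1%g 1 0 j%:R 1 1 j%:R 0 1
  (m4 1 0 0 0 (- j%:R) 1 0 0 0 0 1 0 (j%:R * lK) 0 j%:R 1)).
- by rewrite mul0r subr0 mulr1 pabs1.
- by ring.
- by mul4; ring.
- by int_m4.
Qed.

Lemma eta_lower2 s t (j : 'I_l) : beta s t 1%g (unip_lower j%:R) eta = beta s t 1%g 1%g eta.
Proof.
rewrite -(@beta_level1 s t 1%g (unip_lower j%:R) _ eta (upper_level s j)) mul1g.
rewrite -{1}(mulg1 (unip_lower _)) -{1}(mulg1 (gl2_of _ _ _ _)).
apply: (@eta_stab s t 1%g 1%g 1 j%:R 0 1 1 0 j%:R 1
  (m4 1 (- j%:R) 0 0 0 1 0 0 0 (j%:R * lK) 1 j%:R 0 0 0 1)).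
- by rewrite mulr0 subr0 mulr1 pabs1.
- by ring.
- by mul4; ring.
- by int_m4.
Qed.

Lemma weyl_inv_level0 : gl2_level 0 (gl2_of 0 (-1) 1 0 : gl2 K).
Proof.
apply: gl2_of_level; rewrite ?expr0 ?invr1; intg.
by rewrite mul0r sub0r mulN1r opprK pabs1.
Qed.

Lemma eta_weyl1 s : beta s 0 weyl2 1%g eta = beta s 0 1%g 1%g eta.
Proof.
rewrite -(@beta_level2 s 0 weyl2 1%g _ eta weyl_inv_level0) mul1g.
rewrite -{1}(mulg1 weyl2) -{1}(mulg1 (gl2_of 0 (-1) 1 0)).
apply: (@eta_stab s 0 1%g 1%g 0 1 (-1) 0 0 (-1) 1 0
  (m4 0 (-1) 0 0 1 0 0 0 0 lK 0 1 (- lK) 0 (-1) 0)).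
- by rewrite mulr0 mul1r sub0r opprK pabs1.
- by ring.
- by mul4; ring.
- by int_m4.
Qed.

Lemma eta_weyl2 t : beta 0 t 1%g weyl2 eta = beta 0 t 1%g 1%g eta.
Proof.
rewrite -(@beta_level1 0 t 1%g weyl2 _ eta weyl_inv_level0) mul1g.
rewrite -{1}(mulg1 weyl2) -{1}(mulg1 (gl2_of 0 (-1) 1 0)).
apply: (@eta_stab 0 t 1%g 1%g 0 (-1) 1 0 0 1 (-1) 0
  (m4 0 1 0 0 (-1) 0 0 0 0 (- lK) 0 (-1) lK 0 1 0)).
- by rewrite mul0r sub0r mulN1r opprK pabs1.
- by ring.
- by mul4; ring.
- by int_m4.
Qed.

Lemma eta_hecke1 : (l%:R + 1) * beta 1 0 1%g 1%g eta = (l%:R + y1) * b0 eta.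
Proof.
rewrite -beta_hecke1 eta_weyl1 mulrDl mul1r -sum_ord_const; congr (_ + _).
by apply: eq_bigr => j _; rewrite eta_lower1.
Qed.

Lemma eta_hecke2 : (l%:R + 1) * beta 0 1 1%g 1%g eta = (l%:R + y2) * b0 eta.
Proof.
rewrite -beta_hecke2 eta_weyl2 mulrDl mul1r -sum_ord_const; congr (_ + _).
by apply: eq_bigr => j _; rewrite eta_lower2.
Qed.

Lemma eta_hecke12 : l%:R * beta 1 1 1%g 1%g eta + beta 1 1 1%g weyl2 eta =
  (l%:R + y2) * beta 1 0 1%g 1%g eta.
Proof.
rewrite -beta_hecke2 -sum_ord_const; congr (_ + _).
by apply: eq_bigr => j _; rewrite eta_lower2.
Qed.

(* l^-(t+1) (q_(t+1) - X^-1 q_t), which is the Siegel section of phi_lev t.+1. *)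
Definition sf k tau (t : nat) : gl2 K -> C :=
  fun x => l%:R ^- t.+1 * (sq k tau t.+1 x - (siegel_det k tau l%:R)^-1 * sq k tau t x).

Lemma z_level t g : z (tens (sf k1 tau1 t) (sf k2 tau2 t)) (rtrans g phi0) =
  l%:R ^- t.+1 * l%:R ^- t.+1 * (beta t.+1 t.+1 1%g 1%g g - X2^-1 * beta t.+1 t 1%g 1%g g
    - X1^-1 * beta t t.+1 1%g 1%g g + X1^-1 * X2^-1 * beta t t 1%g 1%g g).
Proof.
have W1 n : I1 (q1 n) by rewrite -(rtrans1 (q1 n)).
have W2 n : I2 (q2 n) by rewrite -(rtrans1 (q2 n)).
have E1 f2 a b m n : I2 f2 -> z (tens (fun x => a * q1 m x + b * q1 n x) f2) (rtrans g phi0) =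
    a * z (tens (q1 m) f2) (rtrans g phi0) + b * z (tens (q1 n) f2) (rtrans g phi0).
  move=> Wf; rewrite (z_lin1 g Wf) //; first by rewrite (linZ sI1 (z_lin1 g Wf)).
  exact: (subspaceZ sI1).
have E2 f1 a b m n : I1 f1 -> z (tens f1 (fun x => a * q2 m x + b * q2 n x)) (rtrans g phi0) =
    a * z (tens f1 (q2 m)) (rtrans g phi0) + b * z (tens f1 (q2 n)) (rtrans g phi0).
  move=> Wf; rewrite (z_lin2 g Wf) //; first by rewrite (linZ sI2 (z_lin2 g Wf)).
  exact: (subspaceZ sI2).
have -> : sf k1 tau1 t = (fun x => l%:R ^- t.+1 * q1 t.+1 x + - (l%:R ^- t.+1 * X1^-1) * q1 t x).
  by apply: funext => x; rewrite /sf; ring.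
have -> : sf k2 tau2 t = (fun x => l%:R ^- t.+1 * q2 t.+1 x + - (l%:R ^- t.+1 * X2^-1) * q2 t x).
  by apply: funext => x; rewrite /sf; ring.
rewrite E1; last exact: (subspace_comb sI2).
by rewrite !E2 // /beta !rtrans1; ring.
Qed.

Lemma z_U : z (tens (sf k1 tau1 0) (sf k2 tau2 0)) (U_op phi0) =
  l%:R ^+ 2 * (z (tens (sf k1 tau1 0) (sf k2 tau2 0)) (rtrans dsp phi0)
    + (l%:R - 1) * z (tens (sf k1 tau1 0) (sf k2 tau2 0)) (rtrans eta phi0)).
Proof.
pose r (p : 'I_l * 'I_l * 'I_l) : G :=
  U_elt p.1.1%:R p.1.2%:R p.2%:R (padic_prime_neq0 K).
have -> : U_op phi0 = (fun g => \sum_p rtrans (r p) phi0 g).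
  apply: funext => g; rewrite /U_op.
  rewrite -(pair_bigA _ (fun (q : 'I_l * 'I_l) w => rtrans (r (q, w)) phi0 g)) /=.
  by rewrite -(pair_bigA _ (fun u v : 'I_l => \sum_w rtrans (r ((u, v), w)) phi0 g)).
have Vf : V (tens (sf k1 tau1 0) (sf k2 tau2 0)).
  apply: tens_V.
    rewrite (_ : sf k1 tau1 0 = (fun x => l%:R ^- 1 * rtrans 1%g (q1 1) x
      + - (l%:R ^- 1 * X1^-1) * rtrans 1%g (q1 0) x)); first exact: (subspace_comb sI1).
    by apply: funext => x; rewrite !rtrans1 /sf; ring.
  rewrite (_ : sf k2 tau2 0 = (fun x => l%:R ^- 1 * rtrans 1%g (q2 1) x
    + - (l%:R ^- 1 * X2^-1) * rtrans 1%g (q2 0) x)); first exact: (subspace_comb sI2).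
  by apply: funext => x; rewrite !rtrans1 /sf; ring.
have lin : forall (c : C) f f', principal_series nu1 nu2 rho f -> principal_series nu1 nu2 rho f' ->
    z (tens (sf k1 tau1 0) (sf k2 tau2 0)) (fun g => c * f g + f' g) =
    c * z (tens (sf k1 tau1 0) (sf k2 tau2 0)) f + z (tens (sf k1 tau1 0) (sf k2 tau2 0)) f'.
  by have [_ zr _] := hz; move=> *; apply: zr.
rewrite (lin_sum (@principal_series_subspace l R K nu1 nu2 rho) lin); last by move=> p; exact: Wg.
rewrite (eq_bigr (fun p : 'I_l * 'I_l * 'I_l => if p.1.1 == 0 :> nat
    then z (tens (sf k1 tau1 0) (sf k2 tau2 0)) (rtrans dsp phi0)
    else z (tens (sf k1 tau1 0) (sf k2 tau2 0)) (rtrans eta phi0))); last first.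
  move=> [[u v] w] _ /=; rewrite !z_level.
  have Eg : gsp4_mx (r (u, v, w)) = upm lK 0 u%:R v%:R lK w%:R u%:R 1 0 1 by [].
  have sg : simil (r (u, v, w)) = lK by [].
  by rewrite !(beta_unip _ _ Eg sg); case: (u == 0 :> nat).
move: (z _ (rtrans dsp phi0)) (z _ (rtrans eta phi0)) => a b.
rewrite (sum_pair_fst _ (fun p : 'I_l * 'I_l => if p.1 == 0 :> nat then a else b)).
rewrite (sum_pair_fst _ (fun u : 'I_l => if u == 0 :> nat then a else b)) sum_ord_if0.
by rewrite card_ord; ring.
Qed.

End Beta.

Section FinalIdentities.
Variable F : fieldType.

Lemma recursion_diff (l y X : F) (f : nat -> F) : l != 0 -> l + 1 != 0 -> X != 0 ->
  X * y = l -> (l + 1) * f 1 = (l + y) * f 0 ->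
  (forall s, l * f s.+2 = (y + l) * f s.+1 - y * f s) ->
  forall s, f s.+1 - X^-1 * f s = l * (1 - y / l ^+ 2) / (l + 1) * f 0.
Proof.
move=> l0 l1 X0 Xy f1 frec; elim=> [|s IH].
  have -> : f 1 = (l + y) * f 0 / (l + 1) by rewrite -f1 mulrC mulKf.
  have -> : X^-1 = y / l by rewrite -Xy invfM mulrCA mulfV ?mulr1 //; rewrite -Xy mulf_eq0 in l0; apply: contraNneq l0 => ->; rewrite eqxx orbT.
  by field; rewrite l1 l0.
rewrite -IH; apply: (mulfI l0); rewrite mulrBr frec.
have -> : l * (X^-1 * f s.+1) = y * f s.+1 by rewrite -{1}Xy; field.
have -> : l * (f s.+1 - X^-1 * f s) = l * f s.+1 - y * f s by rewrite -{1 2}Xy; field.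
by ring.
Qed.

(* The two Hecke equations are solved for b00 and D; the constraint on the central
   character then eliminates e2. *)
Lemma hecke_identity (h N1 N2 r e1 e2 : F) (a : nat -> nat -> F)
    (b00 b10 b01 b11 D : F) :
  let l := h ^+ 2 in let y1 := l ^+ 2 * e1 in let y2 := l ^+ 2 * e2 in
  let X1 := (l * e1)^-1 in let X2 := (l * e2)^-1 in
  [&& h != 0, l + 1 != 0, l - 1 != 0, e1 != 0 & e2 != 0] -> N1 * N2 * r ^+ 2 = e1 * e2 ->
  (forall t, (l + 1) * a 1 t = (l + y1) * a 0 t) ->
  (forall s, (l + 1) * a s 1 = (l + y2) * a s 0) ->
  (forall s t, l * a s.+2 t = (y1 + l) * a s.+1 t - y1 * a s t) ->
  (forall s t, l * a s t.+2 = (y2 + l) * a s t.+1 - y2 * a s t) ->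
  (l + 1) ^+ 2 * (l ^- 2 * a 1 1) + l * (l ^+ 2 - 1) * b00 =
    l * h * r * (1 + N1) * (1 + N2) * a 0 0 ->
  l * (l + 1) * (l ^- 2 * (l * X2)^-1 * a 2 0 + l ^- 2 * (l * X1)^-1 * a 0 2
    + (l ^+ 2 - 1) * (l ^- 2 * D)) =
    r ^+ 2 * (l ^+ 2 * (N1 + N2 + N1 * N2 ^+ 2 + N1 ^+ 2 * N2) + (l ^+ 2 - 1) * N1 * N2) * a 0 0 ->
  (l + 1) * b10 = (l + y1) * b00 -> (l + 1) * b01 = (l + y2) * b00 ->
  l * b11 + D = (l + y2) * b10 ->
  l ^+ 2 * (l^-1 * l^-1 * (l ^- 2 * a 2 2 - X2^-1 * (l ^- 2 * a 2 1) - X1^-1 * (l ^- 2 * a 1 2)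
      + X1^-1 * X2^-1 * (l ^- 2 * a 1 1))
    + (l - 1) * (l^-1 * l^-1 * (b11 - X2^-1 * b10 - X1^-1 * b01 + X1^-1 * X2^-1 * b00))) =
  l / (l + 1) ^+ 2 * ((1 - e1) * (1 - e2)
    - (1 - r * h) * (1 - r * N1 * h) * (1 - r * N2 * h) * (1 - r * N1 * N2 * h)) * a 0 0.
Proof.
move=> l y1 y2 X1 X2 /and5P[h0 l1 lm e10 e20] om ha1 ha2 hr1 hr2 hT hT1 hb10 hb01 hb11.
have l0 : l != 0 by rewrite expf_neq0.
have lm2 : l ^+ 2 - 1 != 0 by rewrite -(expr1n F 2) subr_sqr mulf_neq0.
have sol (u v w : F) : u != 0 -> u * v = w -> v = w / u by move=> u0 <-; rewrite mulrC mulKf.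
have E10 : a 1 0 = _ := sol _ _ _ l1 (ha1 0).
have E01 : a 0 1 = _ := sol _ _ _ l1 (ha2 0).
have E11 : a 1 1 = _ := sol _ _ _ l1 (ha1 1).
have E20 : a 2 0 = _ := sol _ _ _ l0 (hr1 0 0).
have E02 : a 0 2 = _ := sol _ _ _ l0 (hr2 0 0).
have E21 : a 2 1 = _ := sol _ _ _ l0 (hr1 0 1).
have E12 : a 1 2 = _ := sol _ _ _ l0 (hr2 1 0).
have E22 : a 2 2 = _ := sol _ _ _ l0 (hr2 2 0).
have Eb10 : b10 = _ := sol _ _ _ l1 hb10.
have Eb01 : b01 = _ := sol _ _ _ l1 hb01.
have Eb11 : b11 = ((l + y2) * b10 - D) / l by apply: sol; rewrite // -hb11 addrK.
have Eb00 : b00 = (l * h * r * (1 + N1) * (1 + N2) * a 0 0 -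
    (l + 1) ^+ 2 * (l ^- 2 * a 1 1)) / (l * (l ^+ 2 - 1)).
  by apply: sol; [rewrite mulf_neq0|rewrite -hT; ring].
have ED : D = ((r ^+ 2 * (l ^+ 2 * (N1 + N2 + N1 * N2 ^+ 2 + N1 ^+ 2 * N2)
      + (l ^+ 2 - 1) * N1 * N2) * a 0 0) - l * (l + 1) * (l ^- 2 * (l * X2)^-1 * a 2 0
      + l ^- 2 * (l * X1)^-1 * a 0 2)) / (l * (l + 1) * (l ^+ 2 - 1) * l ^- 2).
  apply: sol; first by rewrite !mulf_neq0 ?invr_neq0 ?expf_neq0.
  by rewrite -hT1; ring.
rewrite Eb11 Eb10 Eb01 ED Eb00 E22 E21 E12 E20 E02 E11 E10 E01.
have om' : e2 = N1 * N2 * r ^+ 2 / e1 by rewrite om mulrC mulKf.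
rewrite /X1 /X2 /y1 /y2 !invrK /l.
have nz : N1 * N2 * r ^+ 2 != 0 by rewrite om mulf_neq0.
have [N10 N20 r0] : [/\ N1 != 0, N2 != 0 & r != 0].
  by move: nz; rewrite !mulf_eq0 !negb_or => /andP[/andP[-> ->] /andP[->]].
rewrite om'; move: (a 0 0) => A.
rewrite /l in l1 lm lm2.
by field; rewrite ?h0 ?l1 ?lm2 ?e10 ?N10 ?N20 ?r0 oner_neq0.
Qed.

End FinalIdentities.

Lemma Lchar_unramified (l : nat) (R : realType) (K : padicFieldType l R) (chi : K -> R[i]) s :
  unramified chi -> Lchar chi s = (1 - chi l%:R * cpow l%:R (- s))^-1.
Proof. by move=> u; rewrite /Lchar asboolT. Qed.

Unset Implicit Arguments.
Local Close Scope classical_set_scope.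

Theorem theorem3p7p1
  (l : nat) (hl : prime l) (R : realType) (K : padicFieldType l R)
  (dx dtx : {measure set (borel K) -> \bar R}) (e : K -> R[i])
  (hdx : additive_haar dx) (hdtx : multiplicative_haar dtx)
  (he : standard_additive_char e)
  (nu1 nu2 rho : K -> R[i])
  (hnu1 : smooth_char nu1) (hnu2 : smooth_char nu2) (hrho : smooth_char rho)
  (unu1 : unramified nu1) (unu2 : unramified nu2) (urho : unramified rho)
  (hps : principal_series_cond nu1 nu2)
  (hirr : irreducible (principal_series nu1 nu2 rho) (@rtrans (gsp4 K) R[i]))
  (phi0 : gsp4 K -> R[i])
  (hphi0 : principal_series nu1 nu2 rho phi0)
  (phi0_neq0 : phi0 <> (fun=> 0))
  (phi0_inv : forall k, gsp4_int k -> rtrans k phi0 = phi0)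
  (k1 k2 : nat) (tau1 tau2 : K -> R[i])
  (htau1 : smooth_char tau1) (htau2 : smooth_char tau2)
  (ftau1 : finite_order tau1) (ftau2 : finite_order tau2)
  (utau1 : unramified tau1) (utau2 : unramified tau2) :
  let sigma := principal_series nu1 nu2 rho in
  let omega : K -> R[i] := fun x => nu1 x * nu2 x * rho x ^+ 2 in
  let psi1 : K -> R[i] := abspow (- 2^-1) in
  let psi2 : K -> R[i] := abspow (- 2^-1) in
  let chi1 : K -> R[i] := fun x => abspow (2^-1 + k1%:R) x * tau1 x in
  let chi2 : K -> R[i] := fun x => abspow (2^-1 + k2%:R) x * tau2 x in
  let chi := (chi1, chi2) in
  let psi := (psi1, psi2) in
  let F phi := F_section dx dtx e (phi, phi) chi psi in
  let E : R[i] := (1 - l%:R ^+ k1 / tau1 l%:R) * (1 - l%:R ^+ k2 / tau2 l%:R) in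
  forall
  (hcentral : forall x, x != 0 ->
    chi1 x * chi2 x * psi1 x * psi2 x * omega x = 1)
  (htemp : k1 = 0%N \/ k2 = 0%N ->
    essentially_tempered sigma (@rtrans (gsp4 K) R[i]))
  (z : (hgrp K -> R[i]) -> (gsp4 K -> R[i]) -> R[i])
  (hz : H_invariant_bilinear (induced_H chi psi) sigma z),
  (forall t : nat, (1 <= t)%N ->
    z (F (phi_lev t)) phi0
    = 1 / (l%:R ^+ (2 * t - 2) * (l%:R + 1) ^+ 2) * E * z (F (@phi_sph l R K)) phi0)
  /\
  z (F (phi_lev 1)) (U_op phi0)
  = l%:R / (l%:R + 1) ^+ 2 * (E - (Lspin nu1 nu2 rho (- 2^-1))^-1)
    * z (F (@phi_sph l R K)) phi0.
Proof.
move=> sigma omega psi1 psi2 chi1 chi2 chi psi F E hcentral htemp z hz.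
have n1 := smooth_uchar hnu1 unu1; have n2 := smooth_uchar hnu2 unu2.
have nr := smooth_uchar hrho urho.
have lC0 := lC_neq0 K.
have lC1 : (l%:R + 1 : R[i]) != 0 by rewrite natr1 pnatr_eq0.
have lCm : (l%:R - 1 : R[i]) != 0.
  by rewrite subr_eq0 -[1]/(1%:R) eqr_nat; have := l_gt1 K; case: (l) => [|[]].
pose q1 := sq k1 tau1; pose q2 := sq k2 tau2.
pose be s t g := @beta l R K phi0 k1 k2 tau1 tau2 z s t 1%g 1%g g.
pose al s t := be s t 1%g.
have z0 : z (F (@phi_sph l R K)) phi0 = al 0%N 0%N.
  rewrite /al /be /beta !rtrans1; congr z; apply: funext => h.
  by rewrite /F /F_section /tens (siegel_section_sph hdx hdtx he k1 htau1 ftau1 utau1)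
    (siegel_section_sph hdx hdtx he k2 htau2 ftau2 utau2).
have Flev t : F (phi_lev t.+1) = tens (sf k1 tau1 t) (sf k2 tau2 t).
  apply: funext => h.
  by rewrite /F /F_section /tens (siegel_section_lev hdx hdtx he k1 htau1 ftau1 utau1)
    (siegel_section_lev hdx hdtx he k2 htau2 ftau2 utau2).
pose e1 : R[i] := l%:R ^+ k1 / tau1 l%:R; pose e2 : R[i] := l%:R ^+ k2 / tau2 l%:R.
have t10 : tau1 l%:R != 0 := uchar_l_neq0 (smooth_uchar htau1 utau1).
have t20 : tau2 l%:R != 0 := uchar_l_neq0 (smooth_uchar htau2 utau2).
have e10 : e1 != 0 by rewrite mulf_neq0 ?invr_neq0 ?expf_neq0.
have e20 : e2 != 0 by rewrite mulf_neq0 ?invr_neq0 ?expf_neq0.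
have X1E : siegel_det k1 tau1 l%:R = (l%:R * e1)^-1.
  by rewrite siegel_det_l // /e1 exprS !invfM invrK; ring.
have X2E : siegel_det k2 tau2 l%:R = (l%:R * e2)^-1.
  by rewrite siegel_det_l // /e2 exprS !invfM invrK; ring.
have y1E : siegel_row k1 tau1 l%:R = l%:R ^+ 2 * e1.
  have := siegel_detM_row k1 htau1 utau1; rewrite X1E => H.
  by rewrite -[LHS](mulVKf (mulf_neq0 lC0 e10)) H; ring.
have y2E : siegel_row k2 tau2 l%:R = l%:R ^+ 2 * e2.
  have := siegel_detM_row k2 htau2 utau2; rewrite X2E => H.
  by rewrite -[LHS](mulVKf (mulf_neq0 lC0 e20)) H; ring.
have ha1 t : (l%:R + 1) * al 1%N t = (l%:R + l%:R ^+ 2 * e1) * al 0%N t.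
  by rewrite -y1E; apply: (alpha_1t hphi0 phi0_inv htau1 utau1 htau2 utau2 hz).
have ha2 s : (l%:R + 1) * al s 1%N = (l%:R + l%:R ^+ 2 * e2) * al s 0%N.
  by rewrite -y2E; apply: (alpha_s1 hphi0 phi0_inv htau1 utau1 htau2 utau2 hz).
have hr1 s t : l%:R * al s.+2 t = (l%:R ^+ 2 * e1 + l%:R) * al s.+1 t - l%:R ^+ 2 * e1 * al s t.
  by rewrite -y1E; apply: (alpha_rec1 hphi0 phi0_inv htau1 utau1 htau2 utau2 hz).
have hr2 s t : l%:R * al s t.+2 = (l%:R ^+ 2 * e2 + l%:R) * al s t.+1 - l%:R ^+ 2 * e2 * al s t.
  by rewrite -y2E; apply: (alpha_rec2 hphi0 phi0_inv htau1 utau1 htau2 utau2 hz).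
have zl t g := z_level hphi0 phi0_inv htau1 utau1 htau2 utau2 hz t g.
clearbody F; rewrite z0; split=> [[//|t] _|].
  rewrite Flev -{1}(rtrans1 phi0) zl X1E X2E !invrK.
  rewrite -/(be t.+1 t.+1 1%g) -/(be t.+1 t 1%g) -/(be t t.+1 1%g) -/(be t t 1%g).
  rewrite -/(al t.+1 t.+1) -/(al t.+1 t) -/(al t t.+1) -/(al t t).
  have Xy (c : R[i]) : c != 0 -> (l%:R * c)^-1 * (l%:R ^+ 2 * c) = l%:R.
    by move=> c0; field; rewrite lC0 c0.
  have d1 s : al t.+1 s - l%:R * e1 * al t s = l%:R * (1 - e1) / (l%:R + 1) * al 0%N s.
    have := @recursion_diff R[i] _ _ _ (fun i => al i s) lC0 lC1
      (invr_neq0 (mulf_neq0 lC0 e10)) (Xy _ e10) (ha1 s) (fun i => hr1 i s) t.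
    by rewrite invrK [_ * e1 / _]mulrAC mulfV ?expf_neq0 // mul1r.
  have d2 : al 0%N t.+1 - l%:R * e2 * al 0%N t = l%:R * (1 - e2) / (l%:R + 1) * al 0%N 0%N.
    have := @recursion_diff R[i] _ _ _ (fun i => al 0%N i) lC0 lC1
      (invr_neq0 (mulf_neq0 lC0 e20)) (Xy _ e20) (ha2 0%N) (fun i => hr2 0%N i) t.
    by rewrite invrK [_ * e2 / _]mulrAC mulfV ?expf_neq0 // mul1r.
  have -> : al t.+1 t.+1 - l%:R * e2 * al t.+1 t - l%:R * e1 * al t t.+1
      + l%:R * e1 * (l%:R * e2) * al t t =
      l%:R * (1 - e1) / (l%:R + 1) * (l%:R * (1 - e2) / (l%:R + 1) * al 0%N 0%N).
    transitivity (l%:R * (1 - e1) / (l%:R + 1) * al 0%N t.+1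
        - l%:R * e2 * (l%:R * (1 - e1) / (l%:R + 1) * al 0%N t)).
      by rewrite -(d1 t.+1) -(d1 t); ring.
    by rewrite -d2; ring.
  rewrite /E -/e1 -/e2 (_ : 2 * t.+1 - 2 = t + t)%N; last by lia.
  rewrite exprD !exprS; move: (_ ^+ t) (expf_neq0 t lC0) => L L0.
  by field; rewrite lC0 lC1 L0.
rewrite Flev (z_U hphi0 phi0_inv htau1 utau1 htau2 utau2 hz) !zl expr1.
have bsp s t := beta_split hphi0 phi0_inv htau1 utau1 htau2 utau2 hz s t.
rewrite !bsp X1E X2E.
have sq2 := sqrtl2 K; set h := sqrtl l R in sq2.
have h0 : h != 0 by apply: contraNneq lC0 => h0; rewrite -sq2 h0 expr0n.
have om : nu1 l%:R * nu2 l%:R * rho l%:R ^+ 2 = e1 * e2.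
  have := hcentral l%:R (l_neq0 K); rewrite /chi1 /chi2 /psi1 /psi2 /omega.
  have A k : abspow (2^-1 + k%:R) (l%:R : K) * abspow (- 2^-1) (l%:R : K) = (l%:R ^- k : R[i]).
    by rewrite -abspowD (_ : 2^-1 + k%:R - 2^-1 = k%:R) ?abspow_l //; ring.
  move=> H; have {}H : (l%:R ^- k1 * tau1 l%:R) * (l%:R ^- k2 * tau2 l%:R) *
      (nu1 l%:R * nu2 l%:R * rho l%:R ^+ 2) = 1 by rewrite -(A k1) -(A k2) -[RHS]H; ring.
  rewrite /e1 /e2; apply: (mulfI (_ : (l%:R ^- k1 * tau1 l%:R) * (l%:R ^- k2 * tau2 l%:R) != 0)).
    by rewrite !mulf_neq0 ?invr_neq0 ?expf_neq0.
  rewrite H; move: (_ ^+ k1) (_ ^+ k2) (expf_neq0 k1 lC0) (expf_neq0 k2 lC0) => u v u0 v0.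
  by field; rewrite u0 v0 t10 t20.
have Linv : (Lspin nu1 nu2 rho (- 2^-1))^-1 = (1 - rho l%:R * h) * (1 - rho l%:R * nu1 l%:R * h)
    * (1 - rho l%:R * nu2 l%:R * h) * (1 - rho l%:R * nu1 l%:R * nu2 l%:R * h).
  rewrite /Lspin !Lchar_unramified ?opprK; last first.
  - exact: urho.
  - by move=> u u1; rewrite /GRing.mul_fun /= urho // unu1 // mulr1.
  - by move=> u u1; rewrite /GRing.mul_fun /= urho // unu2 // mulr1.
  - by move=> u u1; rewrite /GRing.mul_fun /= urho // unu1 // unu2 // !mulr1.
  by rewrite !invfM !invrK.
rewrite Linv /E -/e1 -/e2.
have sI1 := @sq_induced l R K k1 tau1 htau1 utau1.
have sI2 := @sq_induced l R K k2 tau2 htau2 utau2.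
have hT : (l%:R + 1) ^+ 2 * (l%:R ^- 2 * al 1%N 1%N) + l%:R * (l%:R ^+ 2 - 1) * be 0%N 0%N (eta K) =
    l%:R * h * rho l%:R * (1 + nu1 l%:R) * (1 + nu2 l%:R) * al 0%N 0%N.
  rewrite -[X in _ * X + _]bsp -(T_sum hphi0 phi0_inv htau1 utau1 htau2 utau2 hz).
  rewrite /al /be /beta (rtrans1 phi0).
  by apply: (z_eigen hphi0 phi0_inv hz) => //; exact: T_eigen.
have hT1 : l%:R * (l%:R + 1) * (l%:R ^- 2 * (l%:R * (l%:R * e2)^-1)^-1 * al 2%N 0%N
    + l%:R ^- 2 * (l%:R * (l%:R * e1)^-1)^-1 * al 0%N 2%N
    + (l%:R ^+ 2 - 1) * (l%:R ^- 2 * @beta l R K phi0 k1 k2 tau1 tau2 z 1 1 1%g weyl2 (eta K))) =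
    rho l%:R ^+ 2 * (l%:R ^+ 2 * (nu1 l%:R + nu2 l%:R + nu1 l%:R * nu2 l%:R ^+ 2
      + nu1 l%:R ^+ 2 * nu2 l%:R) + (l%:R ^+ 2 - 1) * nu1 l%:R * nu2 l%:R) * al 0%N 0%N.
  rewrite -X1E -X2E -(beta_split1 hphi0 phi0_inv htau1 utau1 htau2 utau2 hz).
  rewrite -(beta_split2 hphi0 phi0_inv htau1 utau1 htau2 utau2 hz).
  rewrite -(beta_xi hphi0 phi0_inv htau1 utau1 htau2 utau2 hz).
  rewrite -(T1_sum hphi0 phi0_inv htau1 utau1 htau2 utau2 hz).
  rewrite /al /be /beta (rtrans1 phi0).
  by apply: (z_eigen hphi0 phi0_inv hz) => //; exact: T1_eigen.
have := eta_hecke1 hphi0 phi0_inv htau1 utau1 htau2 utau2 hz.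
have := eta_hecke2 hphi0 phi0_inv htau1 utau1 htau2 utau2 hz.
have := eta_hecke12 hphi0 phi0_inv htau1 utau1 htau2 utau2 hz.
rewrite y1E y2E => h12 h2 h1.
have nz : [&& h != 0, h ^+ 2 + 1 != 0, h ^+ 2 - 1 != 0, e1 != 0 & e2 != 0].
  by rewrite sq2 h0 lC1 lCm e10 e20.
have := @hecke_identity _ h (nu1 l%:R) (nu2 l%:R) (rho l%:R) e1 e2 al _ _ _ _ _ nz om.
rewrite /= sq2 => H; apply: (H _ _ _ _ _ ha1 ha2 hr1 hr2 hT hT1 h1 h2 h12).
Qed.
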